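(* Let $\kappa>0$. Let $\nu_N=\mathcal N(\vec 0,(\kappa L_N)^{-1})$ be the centered Gaussian measure on $\mathbb{R}^N$ with covariance matrix $(\kappa L_N)^{-1}$, and let $\nu=\mathcal N(\vec 0,(\kappa\mathcal L)^{-1})$ be the centered Gaussian measure on $L^2(S^1)$ with covariance operator $(\kappa\mathcal L)^{-1}$, $\mathcal L=-\partial_t^2+\mathrm{Id}$. Then $(\mathcal I_N)_\#\nu_N\Rightarrow\nu$ weakly as probability measures on $L^2(S^1)$ as $N\to\infty$.
   Context: $S^1$ is the interval $[0,1]$ with endpoints glued; $L^2(S^1)$ is the real $L^2$ space; $\mathcal L=-\partial_t^2+\mathrm{Id}$ is taken with periodic boundary conditions (domain $H^2(S^1)$). Vectors in $\mathbb{R}^N$ are $\vec f=(f_0,\dots,f_{N-1})$ with indices understood modulo $N$. The reconstruction map $\mathcal I_N:\mathbb{R}^N\to L^2(S^1)$ is $(\mathcal I_N\vec f)(t)=f_m$ for $t\in[m/N,(m+1)/N)$, $0\le m\le N-1$, and $(\mathcal I_N)_\#$ denotes pushforward of measures. The symmetric positive definite matrix $L_N$ is defined by $$\langle\vec f,L_N\vec f\rangle_{\ell^2}=\frac1N\sum_{i=0}^{N-1}\big[f_i^2+N^2(f_{i+1}-f_i)^2\big],$$ i.e. $(L_N\vec f)_i=\frac1N\big[f_i-N^2(f_{i+1}-2f_i+f_{i-1})\big]$. *)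

(* Defs.v *)
From HB Require Import structures.
From mathcomp Require Import all_boot all_order all_algebra.
From mathcomp Require Import all_classical all_reals all_analysis.
From mathcomp Require Import measurable_realfun ring.

Set Implicit Arguments.
Unset Strict Implicit.
Unset Printing Implicit Defensive.

Import Order.TTheory GRing.Theory Num.Theory.
Import numFieldNormedType.Exports.

Local Open Scope classical_set_scope.
Local Open Scope ring_scope.

Notation borel T := (g_sigma_algebraType (@open T)).

Lemma continuous_borel_measurable (T U : ptopologicalType) (f : T -> U) :
  continuous f -> measurable_fun [set: borel T] (f : borel T -> borel U).
Proof.
move=> cf.
apply: (@measurability _ _ (borel T) (borel U) setT f (@open U)) => //.
move=> _ [B oB <-].
by rewrite setTI; apply: sub_sigma_algebra; exact: (continuousP _).1.
Qed.

Section weak_convergence.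
Context {R : realType} {T : ptopologicalType}.

Definition weakly_converges (P : nat -> probability (borel T) R)
    (Q : probability (borel T) R) :=
  forall phi : T -> R, continuous phi -> bounded_fun phi ->
    \int[P n]_x phi x @[n --> \oo] --> \int[Q]_x phi x.

End weak_convergence.

Section gaussian.
Context {R : realType}.

(* [normal_prob m 0] is a junk value; the Gaussian law of variance 0 is the
   Dirac mass. *)
Definition gaussian_law (m s : R) : set (measurableTypeR R) -> \bar R :=
  if s == 0 then \d_m else normal_prob m s.

Context {T : ptopologicalType} (dot : T -> T -> R).

Definition gaussian_measure (P : probability (borel T) R) :=
  forall h : T, exists m s : R, forall A : set (measurableTypeR R),
    measurable A -> pushforward P (dot h) A = gaussian_law m s A.

Definition centered (P : probability (borel T) R) :=
  forall h : T, ('E_P[dot h] = 0)%E.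

Definition covariance_operator (P : probability (borel T) R) (C : T -> T) :=
  forall h k : T, covariance P (dot h) (dot k) = (dot h (C k))%:E.

Definition centered_gaussian (C : T -> T) (P : probability (borel T) R) :=
  [/\ gaussian_measure P, centered P & covariance_operator P C].

End gaussian.

Section circle.
Context (R : realType).

(* Lebesgue measure on [0, 1[, the circle being [0, 1] with glued endpoints *)
Definition circle_measure : {measure set (measurableTypeR R) -> \bar R} :=
  mrestr (@lebesgue_measure R) (measurable_itv `[0%R, 1%R[).

Local Notation mu := circle_measure.

Definition L2circle : Type := LspaceType2 mu.

Definition L2fun (f : L2circle) : measurableTypeR R -> R :=
  (f : {mfun_ mu, _ >-> _}).
Coercion L2fun : L2circle >-> Funclass.

HB.instance Definition _ := gen_eqMixin L2circle.
HB.instance Definition _ := gen_choiceMixin L2circle.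

Lemma measurable_L2fun (f : L2circle) : measurable_fun setT f.
Proof. exact: (measurable_funPT (repr (LebesgueSpace.sort f))). Qed.

Lemma L2fun_fin (f : L2circle) : finite_norm mu 2%:E f.
Proof. by case: f => f [[]]. Qed.

Lemma Lnorm2E (f : measurableTypeR R -> R) :
  ('N[mu]_2%:E[EFin \o f] = (\int[mu]_x (f x ^+ 2)%:E) `^ 2^-1)%E.
Proof.
rewrite unlock; congr poweR; apply: eq_integral => x _ /=.
by rewrite powR_mulrn ?normr_ge0// real_normK ?num_real.
Qed.

Lemma Lnorm2_ae (f g : measurableTypeR R -> R) :
  measurable_fun setT f -> measurable_fun setT g ->
  {ae mu, forall x, f x = g x} ->
  ('N[mu]_2%:E[EFin \o f] = 'N[mu]_2%:E[EFin \o g])%E.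
Proof.
move=> mf mg fg; rewrite !Lnorm2E; congr poweR.
apply: ae_eq_integral => //.
- by apply/measurable_EFinP; exact: measurable_funX.
- by apply/measurable_EFinP; exact: measurable_funX.
- by apply: filterS fg => x /= -> _.
Qed.

Lemma L2fun_eq (f g : L2circle) : {ae mu, forall x, f x = g x} -> f = g.
Proof.
case: f g => [f [[fF]]] [g [[gF]]]; rewrite /L2fun /= => fg.
have e : f = g.
  rewrite -[f]reprK -[g]reprK; apply/eqP; rewrite eqmodE; apply/asboolP.
  by apply: filterS fg => x e _; exact: e.
by subst g; rewrite (bool_irrelevance gF fF).
Qed.

Section L2_of.
Variable f : {mfun measurableTypeR R >-> measurableTypeR R}.
Let q : {mfun_ mu, measurableTypeR R >-> measurableTypeR R} := \pi%qT f.

Let repr_ae : {ae mu, forall x, q x = f x}.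
Proof.
have : (\pi_({mfun_ mu, measurableTypeR R >-> measurableTypeR R}) (repr q) ==
  \pi_({mfun_ mu, measurableTypeR R >-> measurableTypeR R}) f)%qT.
  by rewrite reprK.
by rewrite eqmodE => /asboolP; apply: filterS => x /(_ Logic.I).
Qed.

Hypothesis fF : finite_norm mu 2%:E f.

Let qF : finite_norm mu 2%:E q.
Proof.
rewrite /finite_norm (Lnorm2_ae _ _ repr_ae)//.
  exact: (measurable_funPT (repr q)).
exact: (measurable_funPT f).
Qed.

(* the class of [f] modulo almost everywhere equality *)
Definition L2_of : L2circle :=
  LebesgueSpace.Pack (LebesgueSpace.Class
    (isFinLebesgue.Build _ _ _ mu 2%:E (lee1n 2) q qF)).

Lemma L2_ofE : {ae mu, forall x, L2_of x = f x}.
Proof. exact: repr_ae. Qed.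

End L2_of.

Definition L2dist (f g : L2circle) : R := fine 'N[mu]_2%:E[EFin \o (f \- g)].

Let L2B_lty (f g : L2circle) : ('N[mu]_2%:E[EFin \o (f \- g)%R] < +oo)%E.
Proof.
have mf := measurable_L2fun f; have mg := measurable_L2fun g.
have -> : (f \- g = f \+ (\- g))%R by [].
apply: (le_lt_trans (eminkowski _ _ _ _)) => //.
- exact: measurableT_comp.
- by rewrite lee1n.
- rewrite lte_add_pinfty//; first exact: L2fun_fin.
  rewrite (_ : EFin \o _ = \- (EFin \o g))%E// oppe_Lnorm; exact: L2fun_fin.
Qed.

Lemma L2distE f g : ((L2dist f g)%:E = 'N[mu]_2%:E[EFin \o (f \- g)%R])%E.
Proof. by rewrite /L2dist fineK// ge0_fin_numE ?Lnorm_ge0// L2B_lty. Qed.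

Lemma L2distxx f : L2dist f f = 0.
Proof.
apply/EFin_inj; rewrite L2distE -[RHS](@Lnorm0 _ _ _ mu 2%:E).
  by apply: eq_Lnorm => x /=; rewrite subrr.
by rewrite eqe pnatr_eq0.
Qed.

Lemma L2dist_positivity f g : L2dist f g = 0 -> f = g.
Proof.
move=> fg; apply: L2fun_eq.
have : ('N[mu]_2%:E[EFin \o (f \- g)%R] = 0)%E by rewrite -L2distE fg.
move/Lnorm_eq0_eq0.
have h : measurable_fun setT (EFin \o (f \- g)%R).
  apply/measurable_EFinP; apply: measurable_funB; exact: measurable_L2fun.
move=> /(_ h); rewrite lte_fin ltr0n => /(_ isT).
by apply: filterS => x /(_ Logic.I) /= [] /eqP; rewrite subr_eq0 => /eqP.
Qed.

Lemma L2dist_sym f g : L2dist f g = L2dist g f.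
Proof.
apply/EFin_inj; rewrite !L2distE -[LHS]oppe_Lnorm.
by apply: eq_Lnorm => x /=; rewrite opprB.
Qed.

Lemma L2dist_triangle g f h : L2dist f h <= L2dist f g + L2dist g h.
Proof.
rewrite -lee_fin EFinD !L2distE.
rewrite (@eq_Lnorm _ _ _ mu _ _ (EFin \o ((f \- g) \+ (g \- h)))%R); last first.
  by move=> x /=; rewrite addrA subrK.
apply: eminkowski; rewrite ?lee1n//; apply: measurable_funB;
  exact: measurable_L2fun.
Qed.

HB.instance Definition _ := isMetric.Build R L2circle
  L2distxx L2dist_positivity L2dist_sym L2dist_triangle.

Let cst0F :
  finite_norm mu 2%:E (cst 0 : measurableTypeR R -> measurableTypeR R).
Proof. by rewrite /finite_norm Lnorm0// eqe pnatr_eq0. Qed.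

HB.instance Definition _ := isPointed.Build L2circle (L2_of cst0F).

Definition L2dot (f g : L2circle) : R := \int[mu]_x (f x * g x).

(* smooth functions on the circle, as 1-periodic smooth functions on the line *)
Definition periodic_smooth (phi : R -> R) :=
  (forall n x, derivable (derive1n n phi) x 1) /\
  (forall x, phi (x + 1) = phi x).

(* no boundary terms, the test functions being periodic *)
Definition weak_derivative (u v : L2circle) :=
  forall phi : R -> R, periodic_smooth phi ->
    \int[mu]_x (u x * derive1 phi x) = - \int[mu]_x (v x * phi x).

(* the graph of - d^2/dt^2 + Id on its domain H^2, i.e., the functions with weak
   first and second derivatives in L^2 *)
Definition scrL_graph (u g : L2circle) :=
  exists v w : L2circle, [/\ weak_derivative u v, weak_derivative v w &
    {ae mu, forall x, g x = - w x + u x}].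

Definition scale_graph (kappa : R) (A : L2circle -> L2circle -> Prop)
    (u g : L2circle) :=
  exists2 h, A u h & {ae mu, forall x, g x = kappa * h x}.

(* the inverse of an injective and surjective operator given by its graph *)
Definition inverse_operator (A : L2circle -> L2circle -> Prop) (g : L2circle) :
  L2circle := get [set u | A u g].

Section reconstruction.
Variable n : nat.
Local Notation N := n.+1.

(* the values outside of [0, 1[ are irrelevant *)
Definition step_fun (f : 'cV[R]_N) (t : measurableTypeR R) :
  measurableTypeR R :=
  \sum_(m < N) f m 0 * \1_(`[m%:R / N%:R, m.+1%:R / N%:R[ : set R) t.

Lemma measurable_step_fun f : measurable_fun setT (step_fun f).
Proof.
by apply: measurable_sum => m; exact: measurable_funM.
Qed.

HB.instance Definition _ f :=
  @isMeasurableFun.Build _ _ _ _ (step_fun f) (measurable_step_fun f).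

Let Lnorm_bound (h : measurableTypeR R -> R) (c : R) : measurable_fun setT h ->
  (forall x, `|h x| <= c) -> ('N[mu]_2%:E[EFin \o h] <= c%:E)%E.
Proof.
move=> mh hc.
have c0 : 0 <= c by exact: le_trans (hc 0).
have -> : (c%:E = (\int[mu]_x (c ^+ 2)%:E) `^ 2^-1)%E.
  rewrite integral_cst//=.
  have -> : mu setT = 1%E.
    rewrite /mu/= /mrestr setTI lebesgue_measure_itv/= lte_fin ltr01.
    by rewrite oppr0 adde0.
  by rewrite mule1 poweR_EFin -powR_mulrn// -powRrM mulfV ?powRr1// pnatr_eq0.
rewrite Lnorm2E; apply: gt0_ler_poweR.
- by rewrite invr_ge0.
- by rewrite in_itv/= leey andbT integral_ge0// => x _; rewrite lee_fin sqr_ge0.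
- by rewrite in_itv/= leey andbT integral_ge0// => x _; rewrite lee_fin sqr_ge0.
apply: ge0_le_integral => //.
- by move=> x _; rewrite lee_fin sqr_ge0.
- by apply/measurable_EFinP; exact: measurable_funX.
- by move=> x _; rewrite lee_fin -(real_normK (num_real (h x))) lerXn2r ?nnegrE.
Qed.

Let step_fun_le f t : `|step_fun f t| <= N%:R * `|f|.
Proof.
apply: (le_trans (ler_norm_sum _ _ _)).
have -> : N%:R * `|f| = \sum_(m < N) `|f|.
  by rewrite sumr_const card_ord mulr_natl.
apply: ler_sum => m _.
rewrite normrM -[leRHS]mulr1; apply: ler_pM => //.
  rewrite [leRHS]mx_normrE.
  exact: (le_bigmax_cond _ (fun i : 'I_N * 'I_1 => `|f i.1 i.2|) (j := (m, 0))).
by rewrite indicE; case: (_ \in _); rewrite ?normr1 ?normr0.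
Qed.

Let step_fun_fin f : finite_norm mu 2%:E (step_fun f).
Proof.
apply: (@le_lt_trans _ _ (N%:R * `|f|)%:E); last exact: ltry.
by apply: Lnorm_bound; [exact: measurable_step_fun|exact: step_fun_le].
Qed.

Definition reconstruction (f : 'cV[R]_N) : L2circle :=
  L2_of (step_fun_fin f).

Let L2dist_reconstruction f g :
  L2dist (reconstruction f) (reconstruction g) <= N%:R * `|f - g|.
Proof.
rewrite -lee_fin L2distE (@Lnorm2_ae _ (step_fun (f - g))).
- by apply: Lnorm_bound; [exact: measurable_step_fun|exact: step_fun_le].
- apply: measurable_funB; exact: measurable_L2fun.
- exact: measurable_step_fun.
have := L2_ofE (step_fun_fin f); have := L2_ofE (step_fun_fin g).
apply: filterS2 => x /= -> ->; rewrite /step_fun -sumrB; apply: eq_bigr => m _.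
by rewrite !mxE mulrBl.
Qed.

Lemma continuous_reconstruction : continuous reconstruction.
Proof.
move=> f A /nbhs_ballP[e /= e0 eA].
have N0 : (0 : R) < N%:R by rewrite ltr0n.
suff h : nbhs f (reconstruction @^-1` A) by exact: h.
apply/nbhs_ballP; exists (e / N%:R) => /=; first by rewrite divr_gt0.
move=> g; rewrite -ball_normE /= => fg; apply: eA; rewrite ballEmdist/=.
by rewrite (le_lt_trans (L2dist_reconstruction f g))// mulrC -ltr_pdivlMr.
Qed.

Lemma measurable_reconstruction :
  measurable_fun [set: borel 'cV[R]_N] (reconstruction : _ -> borel L2circle).
Proof.
exact: (@continuous_borel_measurable 'cV[R]_N L2circle _
  continuous_reconstruction).
Qed.

Definition reconstruction_mfun : {mfun borel 'cV[R]_N >-> borel L2circle} :=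
  mfun_Sub (mem_set measurable_reconstruction).

End reconstruction.

End circle.

Section discrete_operator.
Context {R : realType} (n : nat).
Local Notation N := n.+1.

Definition vec_dot (f g : 'cV[R]_N) : R := \sum_(i < N) f i 0 * g i 0.

(* [ordS] and [ord_pred] are successor and predecessor modulo N; for N <= 2
   some of the indices i, i + 1, i - 1 coincide and their contributions add. *)
Definition discreteL : 'M[R]_N :=
  \matrix_(i, j) (N%:R^-1 * ((j == i)%:R - N%:R ^+ 2 *
    ((j == ordS i)%:R - 2 * (j == i)%:R + (j == ord_pred i)%:R))).

Lemma discreteLE (f : 'cV[R]_N) i : (discreteL *m f) i 0 = N%:R^-1 *
  (f i 0 - N%:R ^+ 2 * (f (ordS i) 0 - 2 * f i 0 + f (ord_pred i) 0)).
Proof.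
have S k : \sum_(j < N) (j == k)%:R * f j 0 = f k 0.
  rewrite (bigD1 k)//= eqxx mul1r big1 ?addr0// => j /negbTE ->.
  by rewrite mul0r.
rewrite mxE; under eq_bigr do rewrite mxE -mulrA.
rewrite -mulr_sumr; congr (_ * _).
rewrite -[in RHS](S i) -(S (ordS i)) -(S (ord_pred i)).
rewrite (mulr_sumr _ _ _ 2) -sumrB -big_split/= mulr_sumr -sumrB.
by apply: eq_bigr => j _; rewrite mulrBl -!mulrA mulrDl mulrBl -!mulrA.
Qed.

Lemma discreteL_form (f : 'cV[R]_N) : vec_dot f (discreteL *m f) = N%:R^-1 *
  \sum_(i < N) (f i 0 ^+ 2 + N%:R ^+ 2 * (f (ordS i) 0 - f i 0) ^+ 2).
Proof.
rewrite /vec_dot; under eq_bigr do rewrite discreteLE mulrCA.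
rewrite -mulr_sumr; congr (_ * _).
have E1 : \sum_(i < N) f (ordS i) 0 ^+ 2 = \sum_(i < N) f i 0 ^+ 2.
  by rewrite [RHS](reindex_inj (can_inj (@ordSK N))).
have E2 : \sum_(i < N) f i 0 * f (ord_pred i) 0 =
          \sum_(i < N) f i 0 * f (ordS i) 0.
  rewrite (reindex_inj (can_inj (@ordSK N))); apply: eq_bigr => i _ /=.
  by rewrite ordSK mulrC.
transitivity (\sum_(i < N) f i 0 ^+ 2 - N%:R ^+ 2 *
  (\sum_(i < N) f i 0 * f (ordS i) 0 - 2 * (\sum_(i < N) f i 0 ^+ 2)
   + \sum_(i < N) f i 0 * f (ord_pred i) 0)).
  rewrite (mulr_sumr _ _ _ 2) -sumrB -big_split/= mulr_sumr -sumrB.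
  by apply: eq_bigr => i _; ring.
rewrite E2 big_split/= -mulr_sumr.
have -> : \sum_(i < N) (f (ordS i) 0 - f i 0) ^+ 2 =
  \sum_(i < N) f (ordS i) 0 ^+ 2 - 2 * (\sum_(i < N) f i 0 * f (ordS i) 0)
  + \sum_(i < N) f i 0 ^+ 2.
  rewrite (mulr_sumr _ _ _ 2) -sumrB -big_split/=.
  by apply: eq_bigr => i _; ring.
by rewrite E1; ring.
Qed.

End discrete_operator.

(* Main.v *)
Require Import Defs.
From HB Require Import structures.
From mathcomp Require Import all_boot all_order all_algebra.
From mathcomp Require Import all_classical all_reals all_analysis.
From mathcomp Require Import measurable_realfun ring lra.

Set Implicit Arguments.
Unset Strict Implicit.
Unset Printing Implicit Defensive.

Import Order.TTheory GRing.Theory Num.Theory.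
Import numFieldNormedType.Exports.

Local Open Scope classical_set_scope.
Local Open Scope ring_scope.

(** Bounded Lipschitz test functions [phi] suffice, since a bounded continuous
    function is the increasing limit of its inf-convolutions with multiples of
    the distance.  Replacing [x] by its projection on the functions constant on
    [K] cells costs little, uniformly in [N]: for the discrete Gaussians the
    energy of [L_N] bounds the variance of an increment [f_i - f_j] by
    [|i - j| / (kappa N)], and for the limit the projections converge pointwise.

    It remains to treat [phi] applied to finitely many linear functionals of
    [x].  In each of them, Bernstein polynomials in the sine of the functional
    divided by a large constant approximate [phi] in mean, so everything reduces
    to the expectations of cosines of linear functionals.  Uniform second moment
    bounds allow taking these functionals in a dense set, the trigonometric
    polynomials.  There the expectation is a continuous function of the variance
    alone, and both variances are explicit: the cell integrals of a mode
    [cos (2 pi k t + b)] form an eigenvector of [L_N], the mode itself is an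
    eigenfunction of [- d^2/dt^2 + Id], and the eigenvalues converge. *)

(** In infinite dimension, convergence of characteristic functionals does not give weak convergence:
    mass may escape towards ever finer scales. The usual remedy is tightness and compactness. Here
    the mean square distance from a sample to its projection on K cells, at most (1/K + 1/N) / kappa
    under each discrete measure, takes that role and leaves a finite-dimensional problem, with K
    fixed before N grows.

    The Gaussian hypotheses enter through second moments, which control every truncation error, and
    through the fact that the expectation of cos (X + b) depends on the variance of X alone. The
    sine is a bounded substitute for X whose polynomials are again sums of cosines, and its error |X
    - L sin (X / L)| <= X^2 / L asks for no more than a second moment. The phases b keep sines and
    products of cosines in one family.

    On trigonometric polynomials both inverse operators are explicit. The coordinates of the
    projection are indicators of cells, which are not of this kind; this is why a density argument
    has to come in between. *)

Section bernstein.
Context {R : realType}.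
Implicit Types (F G : nat -> R) (p : R).

(* The Bernstein operator as the expectation of [F] at time [m] of the random
   walk on [nat] started at [y] that moves up with probability [p]; a degree [m]
   polynomial in [p]. *)
Fixpoint bern (m : nat) F p (y : nat) : R :=
  if m is m'.+1 then p * bern m' F p y.+1 + (1 - p) * bern m' F p y else F y.

Lemma le_bern m F G p y : 0 <= p <= 1 -> (forall j, F j <= G j) ->
  bern m F p y <= bern m G p y.
Proof.
move=> /andP[p0 p1] FG; elim: m y => [|m IH] y //=.
by apply: lerD; apply: ler_wpM2l => //; rewrite subr_ge0.
Qed.

Lemma ler_norm_bern m F p y : 0 <= p <= 1 ->
  `|bern m F p y| <= bern m (fun j => `|F j|) p y.
Proof.
move=> /andP[p0 p1]; elim: m y => [|m IH] y //=.
apply: le_trans (ler_normD _ _) _; rewrite !normrM.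
have q0 : 0 <= 1 - p by rewrite subr_ge0.
by rewrite (ger0_norm p0) (ger0_norm q0); apply: lerD; apply: ler_wpM2l.
Qed.

Lemma bern_cst m (c : R) p y : bern m (fun=> c) p y = c.
Proof. by elim: m y => [|m IH] y //=; rewrite !IH; ring. Qed.

Lemma bernB m F G p y :
  bern m (fun j => F j - G j) p y = bern m F p y - bern m G p y.
Proof. by elim: m y => [|m IH] y //=; rewrite !IH; ring. Qed.

Lemma bernD m F G p y :
  bern m (fun j => F j + G j) p y = bern m F p y + bern m G p y.
Proof. by elim: m y => [|m IH] y //=; rewrite !IH; ring. Qed.

Lemma bernZ m (c : R) F p y : bern m (fun j => c * F j) p y = c * bern m F p y.
Proof. by elim: m y => [|m IH] y //=; rewrite !IH; ring. Qed.

(** Squared bias plus variance: after [m] steps the walk has mean [y + m p] and variance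
    [m p (1 - p)]. Start and centre are arbitrary so that the induction closes. *)
Lemma bern_sqr m (c : R) p y : bern m (fun j => (j%:R - c) ^+ 2) p y =
  (y%:R + m%:R * p - c) ^+ 2 + m%:R * (p * (1 - p)).
Proof.
elim: m y => [|m IH] y /=; first by ring.
by rewrite !IH -!natr1; ring.
Qed.

Lemma bern_variance m p : (0 < m)%N -> 0 <= p <= 1 ->
  bern m (fun j => (j%:R / m%:R - p) ^+ 2) p 0 <= m%:R^-1.
Proof.
move=> m0 /andP[p0 p1]; have mR : (0 : R) < m%:R by rewrite ltr0n.
have -> : (fun j : nat => (j%:R / m%:R - p) ^+ 2) =
          (fun j : nat => m%:R ^- 2 * (j%:R - m%:R * p) ^+ 2).
  by apply/funext => j; field; rewrite gt_eqF.
rewrite bernZ bern_sqr add0r subrr expr0n/= add0r.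
have -> : m%:R ^- 2 * (m%:R * (p * (1 - p))) = m%:R^-1 * (p * (1 - p)).
  by field; rewrite gt_eqF.
by apply: ler_piMr; [rewrite invr_ge0 ltW|nra].
Qed.

End bernstein.

(** * Elementary estimates for sine and cosine *)

Section trigo_bounds.
Context {R : realType}.

Lemma ler_norm_cosB (x y : R) : `|cos x - cos y| <= `|x - y|.
Proof.
wlog : x y / y <= x.
  move=> H; have [/H//|/ltW/H] := leP y x.
  by rewrite distrC [in leRHS]distrC.
move=> yx.
have [c _ ->] : exists2 c, c \in `[y, x]%R & cos x - cos y = - sin c * (x - y).
  apply: (@MVT_segment R cos (fun x => - sin x)) => //.
  exact: continuous_subspaceT (@continuous_cos R).
by rewrite normrM normrN ler_piMl// sin_max.
Qed.

(** By the mean value theorem sin u - u = (cos c - 1) u for some c between 0 and u, and |cos c - 1|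
    <= |c|. A quadratic bound is what second moments can integrate. *)
Lemma sin_sub_le (u : R) : `|sin u - u| <= u ^+ 2.
Proof.
have H (v : R) : 0 <= v -> `|sin v - v| <= v ^+ 2.
  move=> v0.
  have [c cv] : exists2 c, c \in `[0, v]%R & sin v - sin 0 = cos c * (v - 0).
    apply: (@MVT_segment R sin cos) => //.
    exact: continuous_subspaceT (@continuous_sin R).
  rewrite sin0 !subr0 => ->.
  rewrite -[X in _ - X]mul1r -mulrBl normrM (ger0_norm v0) expr2 ler_wpM2r//.
  move: cv; rewrite in_itv/= => /andP[c0 cv].
  rewrite -(@cos0 R); apply: le_trans (ler_norm_cosB _ _) _.
  by rewrite subr0 ger0_norm.
have [/H//|/ltW u0] := leP 0 u.
have := H (- u); rewrite oppr_ge0 => /(_ u0).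
by rewrite sinN -opprD normrN sqrrN.
Qed.

End trigo_bounds.

(** * Integration of bounded functions under a probability *)

Section bounded_integrals.
Context d (T : measurableType d) (R : realType) (P : probability T R).

Definition bounded_measurable (f : T -> R) :=
  measurable_fun setT f /\ exists M, forall x, `|f x| <= M.

Lemma bounded_measurable_integrable f : bounded_measurable f ->
  P.-integrable setT (EFin \o f).
Proof.
move=> [mf [M fM]]; apply: measurable_bounded_integrable => //.
- by rewrite -ge0_fin_numE// fin_num_measure.
- exists M; split; first exact: num_real.
  by move=> x Mx t _; apply: le_trans (fM t) (ltW Mx).
Qed.

Lemma bounded_measurable_cst c : bounded_measurable (cst c).
Proof. by split => //; exists `|c|. Qed.

Lemma bounded_measurableD f g : bounded_measurable f -> bounded_measurable g ->
  bounded_measurable (fun x => f x + g x).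
Proof.
move=> [mf [M fM]] [mg [N gN]]; split; first exact: measurable_funD.
by exists (M + N) => x; apply: le_trans (ler_normD _ _) (lerD _ _).
Qed.

Lemma bounded_measurableM f g : bounded_measurable f -> bounded_measurable g ->
  bounded_measurable (fun x => f x * g x).
Proof.
move=> [mf [M fM]] [mg [N gN]]; split; first exact: measurable_funM.
by exists (M * N) => x; rewrite normrM ler_pM.
Qed.

Lemma bounded_measurableN f : bounded_measurable f ->
  bounded_measurable (fun x => - f x).
Proof.
move=> [mf [M fM]]; split; first exact: measurable_funN.
by exists M => x; rewrite normrN.
Qed.

Lemma bounded_measurableB f g : bounded_measurable f -> bounded_measurable g ->
  bounded_measurable (fun x => f x - g x).
Proof.
by move=> bf bg; apply: bounded_measurableD bf (bounded_measurableN bg).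
Qed.

Lemma Rintegral_dist_le f g (c : R) :
  bounded_measurable f -> bounded_measurable g ->
  (\int[P]_x `|f x - g x|%:E <= c%:E)%E ->
  `|\int[P]_x f x - \int[P]_x g x| <= c.
Proof.
move=> bf bg fgc; have bfg := bounded_measurableB bf bg.
rewrite -RintegralB//; try exact: bounded_measurable_integrable.
apply: le_trans (le_normr_Rintegral _ _) _ => //.
  exact: bounded_measurable_integrable.
rewrite -lee_fin /Rintegral fineK//.
apply: integrable_fin_num => //.
have := integrable_abse (bounded_measurable_integrable bfg).
exact: eq_integrable.
Qed.

Lemma Rintegral_le f g : bounded_measurable f -> bounded_measurable g ->
  (forall x, f x <= g x) -> \int[P]_x f x <= \int[P]_x g x.
Proof.
by move=> bf bg fg; apply: le_Rintegral => //;
  exact: bounded_measurable_integrable.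
Qed.

Lemma bounded_cvg_Rintegral (f_ : nat -> T -> R) (f : T -> R) (M : R) :
  (forall n, measurable_fun setT (f_ n)) -> measurable_fun setT f ->
  (forall n x, `|f_ n x| <= M) -> {ae P, forall x, f_ n x @[n --> \oo] --> f x} ->
  \int[P]_x f_ n x @[n --> \oo] --> \int[P]_x f x.
Proof.
move=> mf_ mf fM f_f.
have [] := @dominated_convergence _ _ _ P setT measurableT
  (fun n => EFin \o f_ n) (EFin \o f) (cst M%:E).
- by move=> n; apply/measurable_EFinP.
- exact/measurable_EFinP.
- by apply: filterS f_f => x h _; apply: cvg_EFin; [exact: nearW|exact: h].
- have := bounded_measurable_integrable (bounded_measurable_cst M).
  exact: eq_integrable.
- by apply: aeW => x n _ /=; rewrite lee_fin.
move=> fi _ h; apply: fine_cvg; rewrite fineK//.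
exact: integrable_fin_num.
Qed.

(** Pointwise |y| <= e + y^2 / e. For e the square root of [v] this is Cauchy-Schwarz up to a factor
    2; a free [e] avoids square roots in the error budgets. *)
Lemma le_integral_norm_sqr (f : T -> R) (v e : R) : measurable_fun setT f ->
  0 < e -> (\int[P]_x (f x ^+ 2)%:E <= v%:E)%E ->
  (\int[P]_x `|f x|%:E <= (e + v / e)%:E)%E.
Proof.
move=> mf e0 fv.
apply: (@le_trans _ _ (\int[P]_x (e%:E + (e^-1)%:E * (f x ^+ 2)%:E))%E).
  apply: ge0_le_integral => //.
  - by apply/measurable_EFinP; apply: measurableT_comp.
  - apply: emeasurable_funD => //.
    by apply/measurable_EFinP; apply: measurable_funM => //; exact: measurable_funX.
  - move=> x _; rewrite -EFinM -EFinD lee_fin.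
    have [fe|fe] := leP `|f x| e.
      by apply: le_trans fe _; rewrite lerDl mulr_ge0 ?invr_ge0 ?sqr_ge0 ?ltW.
    rewrite -(real_normK (num_real (f x))).
    rewrite -lerBlDl mulrC ler_pdivlMr// mulrBl.
    by have := normr_ge0 (f x); nra.
rewrite ge0_integralD//=.
- rewrite integral_cst// [X in (_ * X)%E]probability_setT mule1 ge0_integralZl_EFin//.
  + by rewrite EFinD leeD2l// EFinM muleC lee_wpmul2r// lee_fin invr_ge0 ltW.
  + by move=> x _; rewrite lee_fin sqr_ge0.
  + by apply/measurable_EFinP; exact: measurable_funX.
  + by rewrite invr_ge0 ltW.
- by move=> x _; rewrite lee_fin ltW.
- by move=> x _; rewrite -EFinM lee_fin mulr_ge0 ?sqr_ge0 ?invr_ge0 ?ltW.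
- by apply/measurable_EFinP; apply: measurable_funM => //; exact: measurable_funX.
Qed.

End bounded_integrals.

(** * One-dimensional Gaussian laws *)

Section gaussian_integrals.
Context {R : realType}.
Local Notation leb := (@lebesgue_measure R).
Local Notation gam := (normal_prob (0 : R) 1).

(** The change of variables speaks of the Radon-Nikodym derivative, which agrees almost everywhere
    with [normal_pdf] because both have the same integral over every measurable set. *)
Lemma integral_normal_prob (m s : R) (f : R -> \bar R) :
  (forall x, 0 <= f x)%E -> measurable_fun setT f ->
  (\int[normal_prob m s]_x f x = \int[leb]_x (f x * (normal_pdf m s x)%:E))%E.
Proof.
move=> f0 mf.
have dom := normal_prob_dominates m s.
have mpdf : measurable_fun setT (EFin \o normal_pdf m s).
  by apply/measurable_EFinP; exact: measurable_normal_pdf.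
rewrite -(Radon_Nikodym_SigmaFinite.change_of_variables dom)//.
have fi := Radon_Nikodym_SigmaFinite.f_integrable dom.
apply: ae_eq_integral => //.
- by apply: emeasurable_funM => //; exact: (measurable_int leb).
- exact: emeasurable_funM.
have : ae_eq leb setT (Radon_Nikodym_SigmaFinite.f (normal_prob m s) leb)
    (EFin \o normal_pdf m s).
  apply: integral_ae_eq => // E _ mE.
  by rewrite -Radon_Nikodym_SigmaFinite.f_integral.
by apply: filterS => x /= /(_ I) -> _.
Qed.

(** Substitution x = |s| z + m. The density depends on [s] through its square, and the absolute
    value makes the substitution increasing for either sign of [s]. *)
Lemma integral_normal_prob_standardize (m s : R) (G : R -> R) : s != 0 ->
  continuous G -> (forall x, 0 <= G x) ->
  (\int[normal_prob m s]_x (G x)%:E = \int[gam]_z (G (`|s| * z + m))%:E)%E.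
Proof.
move=> s0 cG G0.
have sp : 0 < `|s| by rewrite normr_gt0.
pose F (z : R^o) : R^o := `|s| * z + m.
have F' : F^`()%classic = cst `|s|.
  apply/funext => x; rewrite /F derive1E deriveD// deriveM// !derive_cst scaler0 addr0.
  by rewrite derive_id addr0 /GRing.scale/= mulr1.
have cF : continuous F.
  move=> x; apply: cvgD; last exact: cvg_cst.
  by apply: cvgM; [exact: cvg_cst|exact: cvg_id].
have cGF : continuous (fun z => G (`|s| * z + m)).
  by move=> x; apply: (@continuous_comp _ _ _ F G); [exact: cF|exact: cG].
rewrite (integral_normal_prob m s (f := EFin \o G)); last 2 first.
- by move=> x; rewrite lee_fin.
- by apply/measurable_EFinP; exact: continuous_measurable_fun.
rewrite (integral_normal_prob 0 1 (f := fun z => (G (`|s| * z + m))%:E)); last 2 first.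
- by move=> x; rewrite lee_fin.
- by apply/measurable_EFinP; exact: (@continuous_measurable_fun R).
transitivity (\int[leb]_x (G x * normal_pdf m s x)%:E)%E.
  by apply: eq_integral => x _; rewrite EFinM.
rewrite (@increasing_ge0_integration_by_substitutionT _ F
  (fun x => G x * normal_pdf m s x)).
- apply: eq_integral => z _; rewrite F' !fctE -EFinM; congr (_%:E).
  rewrite -mulrA; congr (_ * _); rewrite !normal_pdfE ?oner_neq0//.
  rewrite /normal_peak /normal_fun /F addrK subr0 exprMn real_normK ?num_real//.
  rewrite expr1n mul1r -(mulr_natr (_ * pi)) -(mulr_natr pi) -(mulr_natr (s ^+ 2)).
  have s2 : 0 < s ^+ 2 by rewrite exprn_even_gt0.
  rewrite -mulrA (sqrtrM (pi * 2) (ltW s2)) sqrtr_sqr invfM.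
  have -> : - (s ^+ 2 * z ^+ 2) / (s ^+ 2 * 2) = - z ^+ 2 / 2 by field.
  by rewrite mulrC !mulrA divff ?gt_eqF// mul1r.
- by move=> x y xy; rewrite /F ltrD2r ltr_pM2l.
- by rewrite F' => x; exact: cvg_cst.
- by rewrite F'; exact: is_cvg_cst.
- by rewrite F'; exact: is_cvg_cst.
- by move=> x; exact: derivableD.
- rewrite /F; apply: (@cvg_comp _ _ _ (fun z => `|s| * z) (fun z => z + m)).
    by apply/gt0_cvgMrNy => //.
  exact: cvg_addrr_Ny.
- rewrite /F; apply: (@cvg_comp _ _ _ (fun z => `|s| * z) (fun z => z + m)).
    by apply/gt0_cvgMry => //.
  exact: cvg_addrr.
- move=> x; apply: cvgM; first exact: cG.
  exact: continuous_normal_pdf.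
- by move=> x; rewrite mulr_ge0// normal_pdf_ge0.
Qed.

Lemma standard_normal_sqr_lty : (\int[gam]_z (z ^+ 2)%:E < +oo)%E.
Proof.
rewrite integral_normal_prob; last 2 first.
- by move=> x; rewrite lee_fin sqr_ge0.
- by apply/measurable_EFinP; exact: measurable_funX.
have n2 : (2 : R) != 0 by rewrite pnatr_eq0.
(* The integrand is dominated by the density of standard deviation 2: z^2 exp (- z^2 / 2) splits as
   z^2 exp (- 3 z^2 / 8) times exp (- z^2 / 8), and y exp (- 3 y / 8) <= 8 / 3 follows from 1 + x <=
   exp x. The ratio of peaks adjusts the normalisations. *)
pose C : R := 8 / 3 * normal_peak 1 / normal_peak 2.
apply: (@le_lt_trans _ _ (\int[leb]_z (C%:E * (normal_pdf 0 2 z)%:E))%E).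
  apply: ge0_le_integral => //.
  - by move=> x _; rewrite -EFinM lee_fin mulr_ge0 ?sqr_ge0 ?normal_pdf_ge0.
  - apply: emeasurable_funM; apply/measurable_EFinP.
      exact: measurable_funX.
    exact: measurable_normal_pdf.
  - apply: emeasurable_funM => //; apply/measurable_EFinP.
    exact: measurable_normal_pdf.
  move=> x _; rewrite -!EFinM lee_fin !normal_pdfE ?oner_neq0//.
  have p1 : 0 < normal_peak (1 : R) by rewrite normal_peak_gt0 ?oner_neq0.
  have p2 : 0 < normal_peak (2 : R) by rewrite normal_peak_gt0.
  have -> : C * (normal_peak 2 * normal_fun 0 2 x) =
      normal_peak 1 * (8 / 3 * normal_fun 0 2 x).
    by rewrite /C; field; rewrite gt_eqF.
  rewrite mulrCA ler_wpM2l ?(ltW p1)//.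
  rewrite /normal_fun subr0 expr1n.
  have -> : - x ^+ 2 / (1 *+ 2) = - x ^+ 2 / (2 ^+ 2 *+ 2) - x ^+ 2 * (3 / 8).
    by rewrite !mulr2n; field.
  have key : x ^+ 2 * expR (- (x ^+ 2 * (3 / 8))) <= 8 / 3.
    rewrite expRN ler_pdivrMr ?expR_gt0//.
    by have := @expR_ge1Dx R (x ^+ 2 * (3 / 8)); lra.
  rewrite expRD; set A := expR (_ / _).
  have A0 : 0 <= A by exact: expR_ge0.
  by rewrite mulrCA (mulrC (8 / 3)) ler_wpM2l.
rewrite ge0_integralZl_EFin//.
- by rewrite integral_normal_pdf mule1 ltry.
- by move=> x _; rewrite lee_fin normal_pdf_ge0.
- by apply/measurable_EFinP; exact: measurable_normal_pdf.
- rewrite /C mulr_ge0 ?invr_ge0 ?normal_peak_ge0//.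
  by rewrite mulr_ge0 ?normal_peak_ge0// divr_ge0.
Qed.

Lemma standard_normal_integrable : gam.-integrable setT (EFin \o id).
Proof.
apply/integrableP; split; first exact/measurable_EFinP.
have := standard_normal_sqr_lty; rewrite -ge0_fin_numE; last first.
  by apply: integral_ge0 => x _; rewrite lee_fin sqr_ge0.
move=> /fineK e.
apply: le_lt_trans (ltry (1 + fine (\int[gam]_z (z ^+ 2)%:E)%E / 1)).
apply: (@le_integral_norm_sqr _ _ _ gam id) => //.
by rewrite e.
Qed.

Lemma standard_normal_mean : (\int[gam]_z z%:E = 0)%E.
Proof.
rewrite integralE.
have fin : (\int[gam]_z (EFin \o id)^\+ z)%E \is a fin_num.
  have /integrable_funepos := standard_normal_integrable.
  by move=> /(_ measurableT)/integrable_fin_num; apply.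
suff <- : (\int[gam]_z (EFin \o id)^\+ z = \int[gam]_z (EFin \o id)^\- z)%E.
  exact: subee.
have mid : measurable_fun setT (EFin \o (@id R)) by exact/measurable_EFinP.
have cpdf (a : R) : continuous (fun z : R => a * z * normal_pdf 0 1 z).
  move=> z; apply: cvgM; last by apply: continuous_normal_pdf; exact: oner_neq0.
  by apply: cvgM; [exact: cvg_cst|exact: cvg_id].
rewrite !integral_normal_prob//; last 2 first.
- exact: measurable_funeneg.
- exact: measurable_funepos.
(* The two parts are exchanged by z -> - z; the bound [- 0] gives the domain the form that the
   substitution expects. *)
rewrite [RHS](_ : _ = \int[leb]_(z in `]-oo, (- 0)%R])
    (- 1 * z * normal_pdf 0 1 z)%:E)%E; last first.
  rewrite [RHS]integral_mkcond; apply: eq_integral => z _.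
  rewrite patchE oppr0 mem_setE in_itv/= funenegE/=.
  have [z0|z0] := leP z 0.
    by rewrite max_l ?lee_fin ?oppr_ge0// mulN1r.
  by rewrite max_r ?mul0e// lee_fin oppr_le0 ltW.
rewrite ge0_integration_by_substitutionNy.
- rewrite [RHS]integral_mkcond; apply: eq_integral => z _.
  rewrite patchE mem_setE in_itv/= andbT funeposE/=.
  have [z0|z0] := leP 0 z.
    rewrite max_l ?lee_fin// mulrNN mul1r; congr (_ * _)%:E.
    by rewrite !normal_pdfE ?oner_neq0// /normal_fun !subr0 sqrrN.
  by rewrite max_r ?mul0e// lee_fin ltW.
- exact: continuous_subspaceT.
- move=> z; rewrite in_itv/= oppr0 => z0.
  by rewrite mulr_ge0 ?normal_pdf_ge0// mulN1r oppr_ge0 ltW.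
Qed.

End gaussian_integrals.

(** * Expectations of cosines of Gaussian variables *)

Section gaussian_cosine.
Context {R : realType}.
Local Notation gam := (normal_prob (0 : R) 1).

Definition standard_normal_sqr : R := fine (\int[gam]_z (z ^+ 2)%:E)%E.

Lemma standard_normal_sqrE :
  (\int[gam]_z (z ^+ 2)%:E = standard_normal_sqr%:E)%E.
Proof.
rewrite fineK// ge0_fin_numE ?standard_normal_sqr_lty//.
by apply: integral_ge0 => x _; rewrite lee_fin sqr_ge0.
Qed.

(** Otherwise z = 0 almost surely, but a law with a density does not charge the point 0. *)
Lemma standard_normal_sqr_gt0 : 0 < standard_normal_sqr.
Proof.
rewrite lt_neqAle; apply/andP; split; last first.
  by apply: fine_ge0; apply: integral_ge0 => x _; rewrite lee_fin sqr_ge0.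
apply/eqP => e0.
have : (\int[gam]_z `|(z ^+ 2)%:E| = 0)%E.
  transitivity (\int[gam]_z (z ^+ 2)%:E)%E; last first.
    by rewrite standard_normal_sqrE -e0.
  apply: eq_integral => x _.
  by rewrite gee0_abs// lee_fin sqr_ge0.
have mz : measurable_fun setT (fun z : R => (z ^+ 2)%:E).
  by apply/measurable_EFinP; exact: measurable_funX.
move/(ae_eq_integral_abs gam measurableT mz) => z0.
have : ~ {ae gam, forall z : R, z = 0}.
  have g0 : gam [set (0 : R)] = 0%E.
    by rewrite /normal_prob integral_set1.
  move=> [A [mA A0 sA]].
  have : (gam setT <= gam (A `|` [set (0 : R)%R]))%E.
    apply: le_measure; rewrite ?inE//; first exact: measurableU.
    move=> x _; have [->|x0] := eqVneq x 0; first by right.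
    by left; apply: sA => /= /eqP; rewrite (negbTE x0).
  apply/negP; rewrite -ltNge [ltRHS]probability_setT.
  apply: (@le_lt_trans _ _ (gam A + gam [set (0 : R)%R])%E).
    exact: measureU2.
  by rewrite A0 [X in (_ + X)%E]g0 adde0 lte01.
apply; apply: filterS z0 => z /(_ I) /= [] /eqP.
by rewrite sqrf_eq0 => /eqP.
Qed.

(* A centered Gaussian law enters only through this function of its standard
   deviation; continuity in [s] is all that is needed, not the closed form. *)
Definition gaussian_cos (b s : R) : R := \int[gam]_z cos (s * z + b).

Lemma measurable_cos_affine (s b : R) :
  measurable_fun setT (fun z : R => cos (s * z + b)).
Proof.
apply: continuous_measurable_fun => z.
apply: (@continuous_comp _ _ _ (fun z => s * z + b) cos).
  apply: cvgD; last exact: cvg_cst.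
  by apply: cvgM; [exact: cvg_cst|exact: cvg_id].
exact: continuous_cos.
Qed.

Lemma cvg_gaussian_cos (b : R) (s_ : nat -> R) (s : R) :
  s_ n @[n --> \oo] --> s ->
  gaussian_cos b (s_ n) @[n --> \oo] --> gaussian_cos b s.
Proof.
move=> ss; apply: (bounded_cvg_Rintegral (M := 1)).
- by move=> n; exact: measurable_cos_affine.
- exact: measurable_cos_affine.
- by move=> n x; exact: cos_max.
- apply: aeW => z; apply: (@cvg_comp _ _ _ (fun n => s_ n * z + b) cos _
    (nbhs (s * z + b))); last exact: continuous_cos.
  by apply: cvgD; [apply: cvgM => //; exact: cvg_cst|exact: cvg_cst].
Qed.

Context d (T : measurableType d) (P : probability T R).

(** A nonnegative [G] keeps the identity in the extended reals, free of integrability conditions.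
    The Dirac case is covered by the same formula, since |0| z + m = m. *)
Lemma integral_gaussian_law (X : T -> R) (m s : R) (G : R -> R) :
  measurable_fun setT X ->
  (forall A : set (measurableTypeR R), measurable A ->
    pushforward P X A = gaussian_law m s A) ->
  continuous G -> (forall x, 0 <= G x) ->
  (\int[P]_x (G (X x))%:E = \int[gam]_z (G (`|s| * z + m))%:E)%E.
Proof.
move=> mX XP cG G0.
have mG : measurable_fun setT (EFin \o G).
  by apply/measurable_EFinP; exact: continuous_measurable_fun.
have mX' : @measurable_fun _ _ T (measurableTypeR R) setT X by [].
pose Y : {mfun T >-> measurableTypeR R} := @mfun_Sub _ _ T (measurableTypeR R) X (mem_set mX').
transitivity (\int[distribution P Y]_y (G y)%:E)%E.
  by rewrite ge0_integral_distribution// => y; rewrite lee_fin.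
move: XP; rewrite /gaussian_law; have [->|s0] := eqVneq s 0 => XP.
  rewrite (@eq_measure_integral _ (measurableTypeR R) _ _ (@dirac _ (measurableTypeR R) m R)); last by move=> A mA _; exact: XP.
  rewrite integral_dirac//= diracT mul1e.
  under eq_integral do rewrite normr0 mul0r add0r.
  by rewrite integral_cst//= [X in (_ * X)%E]probability_setT mule1.
rewrite -integral_normal_prob_standardize//.
by apply: eq_measure_integral => A mA _; exact: XP.
Qed.

(** The parameters of the law are only known to exist. The first moment forces [m = 0] and the
    second forces [s ^+ 2 = v / standard_normal_sqr], which determines |s| and hence the law. *)
Lemma centered_gaussian_cos (X : T -> R) (m s v b : R) :
  measurable_fun setT X ->
  (forall A : set (measurableTypeR R), measurable A ->
    pushforward P X A = gaussian_law m s A) ->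
  (\int[P]_x (X x)%:E = 0)%E -> (\int[P]_x (X x ^+ 2)%:E = v%:E)%E ->
  \int[P]_x cos (X x + b) =
    gaussian_cos b (Num.sqrt (v / standard_normal_sqr)).
Proof.
move=> mX XP EX EX2.
have law := integral_gaussian_law mX XP.
have m0 : m = 0.
  have iZ : gam.-integrable setT (EFin \o (fun z => `|s| * z + m)).
    rewrite (_ : EFin \o _ = fun z => (`|s|%:E * z%:E + m%:E)%E); last first.
      by apply/funext => z; rewrite -EFinM -EFinD.
    apply: (integrableD measurableT).
      by apply: (integrableZl measurableT); exact: standard_normal_integrable.
    have := bounded_measurable_integrable gam (@bounded_measurable_cst _ _ _ m).
    exact: eq_integrable.
  have : (\int[gam]_z (`|s| * z + m)%:E = 0)%E.
    rewrite -EX integralE [RHS]integralE; congr (_ - _)%E.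
      under eq_integral do rewrite funeposE -EFin_max.
      under [RHS]eq_integral do rewrite funeposE -EFin_max.
      rewrite (law (fun x => Num.max x 0))//.
      - by move=> x; apply: continuous_max; [exact: cvg_id|exact: cvg_cst].
      - by move=> x; rewrite le_max lexx orbT.
    under eq_integral do rewrite funenegE -EFin_max.
    under [RHS]eq_integral do rewrite funenegE -EFin_max.
    rewrite (law (fun x => Num.max (- x) 0))//.
    - move=> x; apply: continuous_max; last exact: cvg_cst.
      by apply: cvgN; exact: cvg_id.
    - by move=> x; rewrite le_max lexx orbT.
  have -> : (\int[gam]_z (`|s| * z + m)%:E =
      \int[gam]_z (`|s|%:E * z%:E + m%:E))%E.
    by apply: eq_integral => z _.
  rewrite integralD//.
  - rewrite integralZl//; last exact: standard_normal_integrable.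
    rewrite standard_normal_mean mule0 add0e integral_cst//.
    by rewrite [X in (_ * X)%E]probability_setT mule1 => -[].
  - by apply: (integrableZl measurableT); exact: standard_normal_integrable.
  - have := bounded_measurable_integrable gam (@bounded_measurable_cst _ _ _ m).
    exact: eq_integrable.
have vE : v = s ^+ 2 * standard_normal_sqr.
  have : (v%:E = (s ^+ 2)%:E * standard_normal_sqr%:E)%E.
    rewrite -EX2 (law (fun x => x ^+ 2)).
    - rewrite -standard_normal_sqrE -ge0_integralZl_EFin//.
      + apply: eq_integral => z _; rewrite m0 addr0 exprMn real_normK ?num_real//.
      + by move=> x _; rewrite lee_fin sqr_ge0.
      + by apply/measurable_EFinP; exact: measurable_funX.
      + by rewrite sqr_ge0.
    - exact: sqr_continuous.
    - by move=> x; rewrite sqr_ge0.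
  by move=> [].
have -> : v / standard_normal_sqr = s ^+ 2.
  by rewrite vE mulfK// gt_eqF// standard_normal_sqr_gt0.
rewrite sqrtr_sqr /gaussian_cos.
have mcX : measurable_fun setT (fun x => cos (X x + b)).
  rewrite (_ : (fun _ => _) = (fun z => cos (1 * z + b)) \o X); last first.
    by apply/funext => x /=; rewrite mul1r.
  by apply: measurableT_comp => //; exact: measurable_cos_affine.
(* Adding 1 makes the cosine nonnegative, as [law] requires; [R1] removes it from both sides. *)
have e : (\int[P]_x (cos (X x + b) + 1)%:E =
    \int[gam]_z (cos (`|s| * z + b) + 1)%:E)%E.
  rewrite (law (fun x => cos (x + b) + 1)).
  - by apply: eq_integral => z _; rewrite m0 addr0.
  - move=> x; apply: cvgD; last exact: cvg_cst.
    apply: (@continuous_comp _ _ _ (fun z => z + b) cos).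
      by apply: cvgD; [exact: cvg_id|exact: cvg_cst].
    exact: continuous_cos.
  - by move=> x; rewrite -lerBlDr sub0r cos_geN1.
have bX : bounded_measurable (fun x => cos (X x + b)).
  by split => //; exists 1 => x; exact: cos_max.
have bZ : bounded_measurable (fun z : R => cos (`|s| * z + b)).
  by split; [exact: measurable_cos_affine|exists 1 => x; exact: cos_max].
have R1 d' (T' : measurableType d') (P' : probability T' R) (f : T' -> R) :
    bounded_measurable f -> \int[P']_x (f x + 1) = \int[P']_x f x + 1.
  move=> bf; rewrite RintegralD//.
  - by rewrite Rintegral_cst// [X in fine X]probability_setT mul1r.
  - exact: bounded_measurable_integrable.
  - by apply: bounded_measurable_integrable; exact: bounded_measurable_cst.
by apply: (@addIr _ 1); rewrite -R1// -[RHS]R1// /Rintegral e.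
Qed.

End gaussian_cosine.

(** * The Hilbert space of the circle *)

Section circle_L2.
Context {R : realType}.
Local Notation mu := (circle_measure R).

Lemma circle_measureT : mu setT = 1%E.
Proof.
by rewrite /circle_measure/= /mrestr setTI lebesgue_measure_itv/= lte_fin ltr01
  oppr0 adde0.
Qed.

(** A copy of [circle_measure] that carries a probability structure, so that the results on bounded
    functions apply to the circle. *)
Definition circle_prob : set (measurableTypeR R) -> \bar R :=
  mrestr (@lebesgue_measure R) (measurable_itv `[0%R, 1%R[).
HB.instance Definition _ := Measure.on circle_prob.
HB.instance Definition _ :=
  @Measure_isProbability.Build _ _ R circle_prob circle_measureT.

Lemma circle_bounded_cvg (f_ : nat -> R -> R) (f : R -> R) (M : R) :
  (forall n, measurable_fun setT (f_ n)) -> measurable_fun setT f ->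
  (forall n x, `|f_ n x| <= M) -> {ae mu, forall x, f_ n x @[n --> \oo] --> f x} ->
  \int[mu]_x f_ n x @[n --> \oo] --> \int[mu]_x f x.
Proof. exact: (@bounded_cvg_Rintegral _ _ R circle_prob f_ f M). Qed.

(** Most of the work is done with functions rather than with classes, because step functions and
    trigonometric polynomials are handled pointwise; [mkL2] passes to the quotient. *)
Definition sqint (f : R -> R) :=
  measurable_fun setT f /\ (\int[mu]_x (f x ^+ 2)%:E < +oo)%E.

Definition ip (f g : R -> R) : R := \int[mu]_x (f x * g x).

Lemma sqint_bounded f : bounded_measurable f -> sqint f.
Proof.
move=> bf; split; first exact: bf.1.
have := bounded_measurable_integrable circle_prob (bounded_measurableM bf bf).
move=> /integrableP[_]; apply: le_lt_trans.
apply: ge0_le_integral => //.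
- by move=> x _; rewrite lee_fin sqr_ge0.
- by apply/measurable_EFinP; apply: measurable_funX; exact: bf.1.
- apply: measurableT_comp => //.
  by apply/measurable_EFinP; apply: measurable_funM; exact: bf.1.
- by move=> x _; rewrite lee_fin -expr2 ler_norm.
Qed.

Lemma sqint_integrableM f g : sqint f -> sqint g ->
  mu.-integrable setT (EFin \o (fun x => f x * g x)).
Proof.
move=> [mf fi] [mg gi].
have if2 : mu.-integrable setT (fun x => (f x ^+ 2)%:E).
  apply/integrableP; split.
    by apply/measurable_EFinP; exact: measurable_funX.
  by under eq_integral do rewrite gee0_abs ?lee_fin ?sqr_ge0//.
have ig2 : mu.-integrable setT (fun x => (g x ^+ 2)%:E).
  apply/integrableP; split.
    by apply/measurable_EFinP; exact: measurable_funX.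
  by under eq_integral do rewrite gee0_abs ?lee_fin ?sqr_ge0//.
apply: le_integrable (integrableD measurableT if2 ig2) => //.
  by apply/measurable_EFinP; exact: measurable_funM.
move=> x _ /=; rewrite lee_fin [leRHS]ger0_norm ?addr_ge0 ?sqr_ge0//.
rewrite normrM -(real_normK (num_real (f x))) -(real_normK (num_real (g x))).
have := sqr_ge0 (`|f x| - `|g x|); have := sqr_ge0 (`|f x| + `|g x|); nra.
Qed.

Lemma sqintD f g : sqint f -> sqint g -> sqint (fun x => f x + g x).
Proof.
move=> sf sg; split; first exact: measurable_funD sf.1 sg.1.
have i1 := sqint_integrableM sf sf; have i2 := sqint_integrableM sf sg.
have i3 := sqint_integrableM sg sg.
have /integrableP[_] := integrableD measurableT
  (integrableD measurableT i1 i2) (integrableD measurableT i2 i3).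
apply: le_lt_trans; apply: ge0_le_integral => //.
- by move=> x _; rewrite lee_fin sqr_ge0.
- apply/measurable_EFinP; apply: measurable_funX.
  exact: measurable_funD sf.1 sg.1.
- apply: measurableT_comp => //.
  have := integrableD measurableT
    (integrableD measurableT i1 i2) (integrableD measurableT i2 i3).
  exact: measurable_int.
- move=> x _ /=; rewrite lee_fin.
  apply: le_trans (ler_norm _); rewrite le_eqVlt; apply/orP; left; apply/eqP; ring.
Qed.

Lemma sqintZ (a : R) f : sqint f -> sqint (fun x => a * f x).
Proof.
move=> sf; split.
  by apply: measurable_funM => //; exact: sf.1.
have /integrableP[_] := integrableZl measurableT (a ^+ 2) (sqint_integrableM sf sf).
apply: le_lt_trans; apply: ge0_le_integral => //.
- by move=> x _; rewrite lee_fin sqr_ge0.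
- apply/measurable_EFinP; apply: measurable_funX.
  by apply: measurable_funM => //; exact: sf.1.
- apply: measurableT_comp => //.
  apply: emeasurable_funM => //; apply/measurable_EFinP.
  exact: measurable_funM sf.1 sf.1.
- move=> x _ /=; rewrite lee_fin.
  apply: le_trans (ler_norm _); rewrite le_eqVlt; apply/orP; left; apply/eqP; ring.
Qed.

Lemma sqintB f g : sqint f -> sqint g -> sqint (fun x => f x - g x).
Proof.
move=> sf sg; have := sqintD sf (sqintZ (-1) sg).
by under eq_fun do rewrite mulN1r.
Qed.

Lemma sqint_cst (c : R) : sqint (fun=> c).
Proof. by apply: sqint_bounded; exact: bounded_measurable_cst. Qed.

Lemma sqint_sum (I : Type) (s : seq I) (f : I -> R -> R) :
  (forall i, sqint (f i)) -> sqint (fun x => \sum_(i <- s) f i x).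
Proof.
move=> sf; elim: s => [|i s IH].
  by under eq_fun do rewrite big_nil; exact: sqint_cst.
by under eq_fun do rewrite big_cons; exact: sqintD.
Qed.

Lemma sqint_L2fun (x : L2circle R) : sqint x.
Proof.
split; first exact: measurable_L2fun.
have := L2fun_fin x; rewrite /finite_norm Lnorm2E.
have : (0 <= \int[mu]_t (x t ^+ 2)%:E)%E.
  by apply: integral_ge0 => t _; rewrite lee_fin sqr_ge0.
case: (\int[mu]_t (x t ^+ 2)%:E)%E => [r| |]// _.
  by move=> _; exact: ltry.
by rewrite poweRyr// invr_eq0 pnatr_eq0.
Qed.

Lemma ipC f g : ip f g = ip g f.
Proof. by apply: eq_Rintegral => x _; rewrite mulrC. Qed.

Lemma ipDl f g h : sqint f -> sqint g -> sqint h ->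
  ip (fun x => f x + g x) h = ip f h + ip g h.
Proof.
move=> sf sg sh; rewrite -RintegralD//; try exact: sqint_integrableM.
by apply: eq_Rintegral => x _; rewrite mulrDl.
Qed.

Lemma ipZl (a : R) f g : sqint f -> sqint g ->
  ip (fun x => a * f x) g = a * ip f g.
Proof.
move=> sf sg; rewrite -RintegralZl//; try exact: sqint_integrableM.
by apply: eq_Rintegral => x _; rewrite mulrA.
Qed.

Lemma ipZr (a : R) f g : sqint f -> sqint g ->
  ip f (fun x => a * g x) = a * ip f g.
Proof. by move=> sf sg; rewrite ipC ipZl// ipC. Qed.

Lemma ipBl f g h : sqint f -> sqint g -> sqint h ->
  ip (fun x => f x - g x) h = ip f h - ip g h.
Proof.
move=> sf sg sh; rewrite -RintegralB//; try exact: sqint_integrableM.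
by apply: eq_Rintegral => x _; rewrite mulrBl.
Qed.

Lemma ip0l g : ip (fun=> 0) g = 0.
Proof.
transitivity (\int[mu]_x (0 : R)).
  by apply: eq_Rintegral => x _; rewrite mul0r.
by rewrite Rintegral_cst// mul0r.
Qed.

Lemma ip_suml (I : Type) (s : seq I) (f : I -> R -> R) g :
  (forall i, sqint (f i)) -> sqint g ->
  ip (fun x => \sum_(i <- s) f i x) g = \sum_(i <- s) ip (f i) g.
Proof.
move=> sf sg; elim: s => [|i s IH].
  by under eq_fun do rewrite big_nil; rewrite big_nil ip0l.
under eq_fun do rewrite big_cons.
by rewrite ipDl// ?big_cons ?IH//; exact: sqint_sum.
Qed.

Lemma ip_ge0 f : 0 <= ip f f.
Proof. by apply: Rintegral_ge0 => x _; rewrite -expr2 sqr_ge0. Qed.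

Lemma ip_sqrE f : sqint f -> (\int[mu]_x (f x ^+ 2)%:E = (ip f f)%:E)%E.
Proof.
move=> sf; rewrite /ip /Rintegral fineK//.
by apply: integrable_fin_num => //; exact: sqint_integrableM.
Qed.

Lemma circle_aeS (p q : R -> Prop) : (forall x, p x -> q x) ->
  {ae mu, forall x, p x} -> {ae mu, forall x, q x}.
Proof. exact: (@filterS _ _ (ae_filter_ringOfSetsType mu)). Qed.

Lemma ip_ae f f' g : sqint f -> sqint f' -> sqint g ->
  {ae mu, forall x, f x = f' x} -> ip f g = ip f' g.
Proof.
move=> sf sf' sg ff'; rewrite /ip /Rintegral; congr fine.
apply: ae_eq_integral => //.
- by apply/measurable_EFinP; exact: measurable_funM sf.1 sg.1.
- by apply/measurable_EFinP; exact: measurable_funM sf'.1 sg.1.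
- by apply: circle_aeS ff' => x /= -> _.
Qed.

Lemma ip_sqrD f g : sqint f -> sqint g ->
  ip (fun x => f x + g x) (fun x => f x + g x) = ip f f + 2 * ip f g + ip g g.
Proof.
move=> sf sg; rewrite ipDl//; last exact: sqintD.
rewrite (ipC f (fun _ => _)) (ipC g (fun _ => _)) !ipDl//.
rewrite (ipC g f); ring.
Qed.

Lemma ip_cauchy f g : sqint f -> sqint g -> ip f g ^+ 2 <= ip f f * ip g g.
Proof.
move=> sf sg.
have H a : 0 <= ip f f + 2 * (a * ip f g) + a ^+ 2 * ip g g.
  have := ip_ge0 (fun x => f x + a * g x).
  have sag := sqintZ a sg.
  by rewrite ip_sqrD// ipZr// ipZl// ipZr// (mulrA a a) -expr2.
have := ip_ge0 g; rewrite le0r => /orP[/eqP g0|g0].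
  rewrite g0 mulr0; suff -> : ip f g = 0 by rewrite expr0n.
  apply/eqP/negPn/negP => fg0.
  (* When [ip g g = 0] the expression in [H] is affine in [a], and this [a] makes it equal to -1. *)
  have := H (- (ip f f + 1) / (2 * ip f g)).
  rewrite g0 mulr0 addr0.
  have -> : 2 * (- (ip f f + 1) / (2 * ip f g) * ip f g) = - (ip f f + 1).
    by field.
  lra.
have := H (- ip f g / ip g g).
have -> : ip f f + 2 * (- ip f g / ip g g * ip f g) +
   (- ip f g / ip g g) ^+ 2 * ip g g = (ip f f * ip g g - ip f g ^+ 2) / ip g g.
  by field; rewrite gt_eqF.
by rewrite pmulr_lge0 ?invr_gt0// subr_ge0.
Qed.

Lemma finite_norm_sqint f : sqint f -> finite_norm mu 2%:E f.
Proof.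
by move=> sf; rewrite /finite_norm Lnorm2E ip_sqrE// poweR_EFin ltry.
Qed.

(** Made total by the default value [point], the zero class, so that it applies to an expression
    depending on [x] without carrying a proof of square integrability. *)
Definition mkL2 (f : R -> R) : L2circle R :=
  match pselect (sqint f) with
  | left sf => @L2_of R (@mfun_Sub _ _ (measurableTypeR R) (measurableTypeR R) f
      (mem_set sf.1)) (finite_norm_sqint sf)
  | right _ => point
  end.

Lemma mkL2E f : sqint f -> {ae mu, forall x, mkL2 f x = f x}.
Proof.
rewrite /mkL2; case: pselect => // sf _.
exact: (@L2_ofE R (@mfun_Sub _ _ (measurableTypeR R) (measurableTypeR R) f
      (mem_set sf.1)) (finite_norm_sqint sf)).
Qed.

Lemma ip_mkL2l f g : sqint f -> sqint g -> ip (mkL2 f) g = ip f g.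
Proof.
move=> sf sg; apply: ip_ae => //; first exact: sqint_L2fun.
exact: mkL2E.
Qed.

Definition nrm (f : R -> R) := Num.sqrt (ip f f).

Lemma L2dist_nrm (x y : L2circle R) : L2dist x y = nrm (fun t => x t - y t).
Proof.
have s : sqint (fun t => x t - y t).
  by apply: sqintB; exact: sqint_L2fun.
rewrite /L2dist Lnorm2E ip_sqrE// poweR_EFin/= /nrm.
by rewrite powR12_sqrt//; exact: ip_ge0.
Qed.

Lemma nrm_ae f f' : sqint f -> sqint f' -> {ae mu, forall x, f x = f' x} ->
  nrm f = nrm f'.
Proof.
move=> sf sf' ff'; rewrite /nrm (ip_ae sf sf' sf ff') ipC.
by rewrite (ip_ae sf sf' sf' ff').
Qed.

Lemma L2dist_mkL2 f g : sqint f -> sqint g ->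
  L2dist (mkL2 f) (mkL2 g) = nrm (fun x => f x - g x).
Proof.
move=> sf sg; rewrite L2dist_nrm; apply: nrm_ae.
- by apply: sqintB; exact: sqint_L2fun.
- exact: sqintB.
- by apply: (@filterS2 _ _ (ae_filter_ringOfSetsType mu) _ _ _ _ (mkL2E sf) (mkL2E sg)) => x -> ->.
Qed.

Lemma mkL2K (x : L2circle R) : mkL2 x = x.
Proof. by apply: L2fun_eq; apply: mkL2E; exact: sqint_L2fun. Qed.

Lemma nrm_ge0 f : 0 <= nrm f. Proof. exact: sqrtr_ge0. Qed.

Lemma sqr_nrm f : nrm f ^+ 2 = ip f f.
Proof. by rewrite sqr_sqrtr// ip_ge0. Qed.

Lemma nrmD f g : sqint f -> sqint g -> nrm (fun x => f x + g x) <= nrm f + nrm g.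
Proof.
move=> sf sg; have s0 := sqint_cst 0; have sN := sqintZ (-1) sg.
have := L2dist_triangle (mkL2 (fun=> 0)) (mkL2 f) (mkL2 (fun x => -1 * g x)).
rewrite !L2dist_mkL2//.
under eq_fun do rewrite mulN1r opprK.
under [X in _ <= nrm X + _]eq_fun do rewrite subr0.
by under [X in _ <= _ + nrm X]eq_fun do rewrite mulN1r opprK add0r.
Qed.

Lemma nrmZ a f : sqint f -> nrm (fun x => a * f x) = `|a| * nrm f.
Proof.
move=> sf; rewrite /nrm ipZl//; last exact: sqintZ.
rewrite ipC ipZl// mulrA -expr2 sqrtrM ?sqr_ge0//.
by rewrite sqrtr_sqr.
Qed.

Lemma ip_nrm f g : sqint f -> sqint g -> `|ip f g| <= nrm f * nrm g.
Proof.
move=> sf sg; rewrite -(ler_pXn2r (n := 2))// ?nnegrE ?mulr_ge0 ?nrm_ge0//.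
by rewrite real_normK ?num_real// exprMn !sqr_nrm ip_cauchy.
Qed.

(** Lebesgue measure is the sum of its restrictions to [[0, 1[] and to the complement. The integrand
    cut off outside [[0, 1[] vanishes almost everywhere for the second and equals [f] almost
    everywhere for the first. *)
Lemma integral_circle (f : R -> \bar R) : (forall x, 0 <= f x)%E ->
  measurable_fun setT f ->
  (\int[mu]_x f x = \int[@lebesgue_measure R]_(x in `[0%R, 1%R[) f x)%E.
Proof.
move=> f0 mf.
have mD : measurable (`[0%R, 1%R[%classic : set (measurableTypeR R)).
  exact: measurable_itv.
pose mu' := mrestr (@lebesgue_measure R) (measurableC mD).
have h : measurable_fun setT (f \_ `[0%R, 1%R[).
  exact/(measurable_restrictT _ mD)/measurable_funTS.
have h0 x : (0 <= (f \_ `[0%R, 1%R[) x)%E by rewrite patchE; case: ifP.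
rewrite [RHS]integral_mkcond.
have -> : (\int[@lebesgue_measure R]_x (f \_ `[0%R, 1%R[) x =
   \int[measure_add mu mu']_x (f \_ `[0%R, 1%R[) x)%E.
  apply: eq_measure_integral => A mA _.
  rewrite [RHS]measure_addE /= /mrestr -measureU; first by rewrite -setIUr setUv setIT.
  - exact: measurableI.
  - by apply: measurableI => //; exact: measurableC.
  - by rewrite setIACA setICr setI0.
rewrite ge0_integral_measure_add//.
rewrite [X in (_ + X)%E](_ : _ = 0%E) ?adde0.
  apply: ae_eq_integral => //; exists (~` `[0%R, 1%R[%classic); split.
  - exact: measurableC.
  - by rewrite /= /mrestr setICl measure0.
  - by move=> x /=; apply: contra_not => xD _; rewrite patchE mem_set.
rewrite -(integral0 mu' setT); apply: ae_eq_integral => //.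
exists `[0%R, 1%R[%classic; split => //.
- by rewrite /= /mrestr setICr measure0.
- move=> x /=; apply: contra_notP => xD _; rewrite patchE memNset//.
Qed.

Lemma circle_ae (p : R -> Prop) : (forall x, 0 < x -> x < 1 -> p x) ->
  {ae mu, forall x, p x}.
Proof.
move=> H; exists (~` `]0%R, 1%R[%classic); split.
- by apply: measurableC; exact: measurable_itv.
- rewrite /= /mrestr; apply/eqP; rewrite eq_le measure_ge0 andbT.
  rewrite -(@lebesgue_measure_set1 R 0); apply: le_measure; rewrite ?inE.
  + apply: measurableI; last exact: measurable_itv.
    by apply: measurableC; exact: measurable_itv.
  + exact: measurable_set1.
  + move=> x /= []; rewrite !in_itv/= => h /andP[x0 x1]; apply/eqP.
    rewrite eq_le x0 andbT leNgt; apply/negP => x0'; apply: h.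
    by rewrite x0' x1.
- move=> x /=; apply: contra_not; rewrite in_itv/= => /andP[]; exact: H.
Qed.

End circle_L2.

(** * Step functions on a uniform grid and the projection onto them *)

Section cells.
Context {R : realType}.
Local Notation mu := (circle_measure R).
Implicit Types (f g : R -> R).

Definition cell (n m : nat) : set R := `[m%:R / n.+1%:R, m.+1%:R / n.+1%:R[%classic.

Definition cellf (n m : nat) (t : R) : R := \1_(cell n m) t.

(** Convertible to [step_fun] for the values [f m 0] of a column [f]; values given by a function
    also suit averages and samples. *)
Definition stepf (n : nat) (c : 'I_n.+1 -> R) (t : R) : R :=
  \sum_(m < n.+1) c m * cellf n m t.

Lemma measurable_cellf n m : measurable_fun setT (cellf n m).
Proof. by apply: measurable_indic; exact: measurable_itv. Qed.

Lemma sqint_cellf n m : sqint (cellf n m).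
Proof.
apply: sqint_bounded; split; first exact: measurable_cellf.
by exists 1 => x; rewrite /cellf indicE; case: (_ \in _); rewrite ?normr1 ?normr0.
Qed.

Lemma sqint_stepf n c : sqint (@stepf n c).
Proof. by apply: sqint_sum => i; apply: sqintZ; exact: sqint_cellf. Qed.

Lemma cell_inj n m m' (t : R) : cell n m t -> cell n m' t -> m = m'.
Proof.
have N0 : (0 : R) < n.+1%:R by rewrite ltr0n.
rewrite /cell /= !in_itv/= !ler_pdivrMr// !ltr_pdivlMr//.
move=> /andP[a b] /andP[c d]; apply/eqP; rewrite eqn_leq; apply/andP; split.
  by rewrite -ltnS -(ltr_nat R); exact: le_lt_trans a d.
by rewrite -ltnS -(ltr_nat R); exact: le_lt_trans c b.
Qed.

Lemma cell_ex n (t : R) : 0 <= t -> t < 1 ->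
  exists m : 'I_n.+1, cell n m t.
Proof.
move=> t0 t1; have N0 : (0 : R) < n.+1%:R by rewrite ltr0n.
have Nt : 0 <= t * n.+1%:R by rewrite mulr_ge0// ltW.
have lt : (Num.truncn (t * n.+1%:R) < n.+1)%N.
  by rewrite truncn_lt_nat// gtr_pMl.
exists (Ordinal lt); rewrite /cell /= in_itv/= ler_pdivrMr// ltr_pdivlMr//.
exact: truncn_itv.
Qed.

Lemma stepf_cell n c (m : 'I_n.+1) t : cell n m t -> stepf c t = c m.
Proof.
move=> tm; rewrite /stepf (bigD1 m)//= big1 ?addr0.
  by rewrite /cellf indicE mem_set// mulr1.
move=> i /eqP im; rewrite /cellf indicE memNset ?mulr0// => ti.
by apply: im; apply: val_inj; exact: cell_inj ti tm.
Qed.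

Lemma cellfM n m m' t : cellf n m t * cellf n m' t = (m == m')%:R * cellf n m t.
Proof.
rewrite /cellf !indicE; have [->|mm'] := eqVneq m m'.
  by case: (_ \in _); rewrite ?mulr1 ?mulr0.
case/boolP: (t \in cell n m) => tm; last by rewrite mul0r mulr0.
rewrite memNset ?mulr0 ?mul0r// => tm'; move/eqP: mm'; apply.
by apply: cell_inj tm'; exact: set_mem.
Qed.

Lemma ip_cellf_self n (m : 'I_n.+1) : ip (cellf n m) (cellf n m) = n.+1%:R^-1.
Proof.
have N0 : (0 : R) < n.+1%:R by rewrite ltr0n.
rewrite /ip (_ : (fun x => _) = cellf n m); last first.
  by apply/funext => x; rewrite cellfM eqxx mul1r.
rewrite /Rintegral /cellf integral_indic//; last exact: measurable_itv.
rewrite setIT /= /mrestr setIidl; last first.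
  apply: subset_itv; rewrite bnd_simp.
    by rewrite divr_ge0// ler0n.
  by rewrite ler_pdivrMr// mul1r ler_nat.
rewrite lebesgue_measure_itv/= lte_fin ltr_pM2r ?invr_gt0// ltr_nat ltnSn/=.
by rewrite -mulrBl -natrB// subSnn mul1r.
Qed.

Lemma ip_cellf n (m m' : 'I_n.+1) :
  ip (cellf n m) (cellf n m') = (m == m')%:R / n.+1%:R.
Proof.
have [<-|mm'] := eqVneq m m'; first by rewrite ip_cellf_self mul1r.
rewrite mul0r -(@ip0l R (cellf n m')); apply: eq_Rintegral => x _.
by rewrite cellfM; move: mm'; rewrite -val_eqE => /negbTE ->; rewrite !mul0r.
Qed.

Lemma ip_stepfl n (c : 'I_n.+1 -> R) g : sqint g ->
  ip (stepf c) g = \sum_(m < n.+1) c m * ip (cellf n m) g.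
Proof.
move=> sg; rewrite ip_suml//; last by move=> i; apply: sqintZ; exact: sqint_cellf.
by apply: eq_bigr => m _; rewrite ipZl//; exact: sqint_cellf.
Qed.

Lemma ip_stepf n (c c' : 'I_n.+1 -> R) :
  ip (stepf c) (stepf c') = n.+1%:R^-1 * \sum_(m < n.+1) c m * c' m.
Proof.
rewrite ip_stepfl; last exact: sqint_stepf.
rewrite mulr_sumr; apply: eq_bigr => m _.
rewrite ipC ip_stepfl; last exact: sqint_cellf.
rewrite (bigD1 m)//= big1 ?addr0; last first.
  by move=> i im; rewrite ip_cellf (negbTE im) mul0r mulr0.
by rewrite ip_cellf eqxx mul1r; ring.
Qed.

Definition cell_avg n f (m : 'I_n.+1) : R := n.+1%:R * ip f (cellf n m).

Definition cell_proj n f : R -> R := stepf (@cell_avg n f).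

Lemma sqint_cell_proj n f : sqint (cell_proj n f).
Proof. exact: sqint_stepf. Qed.

Lemma stepfB n (c c' : 'I_n.+1 -> R) t :
  stepf c t - stepf c' t = stepf (fun m => c m - c' m) t.
Proof. by rewrite /stepf -sumrB; apply: eq_bigr => m _; rewrite mulrBl. Qed.

Lemma ip_cell_proj n f (c : 'I_n.+1 -> R) : sqint f ->
  ip f (stepf c) = ip (cell_proj n f) (stepf c).
Proof.
move=> sf; rewrite ip_stepf ipC ip_stepfl// mulr_sumr; apply: eq_bigr => m _.
by rewrite /cell_avg (ipC (cellf n m)) !mulrA mulVf ?pnatr_eq0// mul1r mulrC.
Qed.

(** Pythagoras: [f - cell_proj n f] is orthogonal to step functions, so a further step function can
    only increase its norm. A projection error is thus bounded by exhibiting any convenient step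
    function. *)
Lemma cell_proj_best n f (c : 'I_n.+1 -> R) : sqint f ->
  nrm (fun t => f t - cell_proj n f t) <= nrm (fun t => f t - stepf c t).
Proof.
move=> sf; have sp := sqint_cell_proj n f; have sc := sqint_stepf c.
rewrite ler_sqrt ?ip_ge0//.
have -> : (fun t => f t - stepf c t) =
    (fun t => (f t - cell_proj n f t) + stepf (fun m => cell_avg f m - c m) t).
  by apply/funext => t; rewrite -stepfB addrA subrK.
have sfp := sqintB sf sp.
have sd := sqint_stepf (fun m => cell_avg f m - c m).
rewrite (ip_sqrD sfp sd).
rewrite (ipBl sf sp sd) (ip_cell_proj _ sf) subrr mulr0 addr0 lerDl.
exact: ip_ge0.
Qed.

Lemma nrm_cell_proj n f : sqint f -> nrm (cell_proj n f) <= nrm f.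
Proof.
move=> sf; have sp := sqint_cell_proj n f.
rewrite ler_sqrt ?ip_ge0//.
have sfp := sqintB sf sp.
have -> : ip f f = ip (fun t => (f t - cell_proj n f t) + cell_proj n f t)
    (fun t => (f t - cell_proj n f t) + cell_proj n f t).
  by apply: eq_Rintegral => t _; rewrite !subrK.
rewrite (ip_sqrD sfp sp) (ipBl sf sp sp).
rewrite (_ : ip f (cell_proj n f) = ip (cell_proj n f) (cell_proj n f)).
  by rewrite subrr mulr0 addr0 lerDr ip_ge0.
exact: ip_cell_proj.
Qed.

End cells.

(** * Strong convergence of the projections *)

Section cell_projection_density.
Context {R : realType}.
Local Notation mu := (circle_measure R).
Implicit Types (f g : R -> R).

Lemma cvg_nrm0 (f_ : nat -> R -> R) :
  ip (f_ n) (f_ n) @[n --> \oo] --> (0 : R) ->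
  nrm (f_ n) @[n --> \oo] --> (0 : R).
Proof.
move=> h; rewrite -(@sqrtr0 R).
apply: (@cvg_comp _ _ _ (fun n => ip (f_ n) (f_ n)) Num.sqrt _ (nbhs (0 : R))) => //.
exact: sqrt_continuous.
Qed.

Lemma bounded_cvg_nrm (f_ : nat -> R -> R) (M : R) :
  (forall n, measurable_fun setT (f_ n)) -> (forall n x, `|f_ n x| <= M) ->
  {ae mu, forall x, f_ n x @[n --> \oo] --> (0 : R)} ->
  nrm (f_ n) @[n --> \oo] --> (0 : R).
Proof.
move=> mf fM f0; apply: cvg_nrm0.
have -> : (0 : R) = \int[mu]_x 0 by rewrite Rintegral_cst// mul0r.
apply: (circle_bounded_cvg (M := M * M)) => //.
- by move=> n; exact: measurable_funM.
- by move=> n x; rewrite normrM ler_pM.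
- apply: circle_aeS f0 => x h; rewrite -(mulr0 (0 : R)); exact: cvgM.
Qed.

Definition clamp (M x : R) : R := Num.max (- M) (Num.min x M).

Lemma measurable_clamp M f : measurable_fun setT f ->
  measurable_fun setT (fun x => clamp M (f x)).
Proof.
by move=> mf; apply: measurable_maxr => //; exact: measurable_minr.
Qed.

Lemma clamp_bound M x : 0 <= M -> `|clamp M x| <= M.
Proof.
move=> M0; rewrite ler_norml /clamp le_max lexx/= ge_max ge_min lexx orbT andbT.
lra.
Qed.

Lemma clamp_id M x : `|x| <= M -> clamp M x = x.
Proof.
by rewrite ler_norml => /andP[a b]; rewrite /clamp min_l// max_r.
Qed.

Lemma clamp_dist M x y : `|clamp M x - clamp M y| <= `|x - y|.
Proof.
have := ler_norm (x - y); have := ler_norm (- (x - y)); rewrite normrN => ? ?.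
rewrite /clamp !minEle !maxEle; case: (leP x M) => ?; case: (leP y M) => ?;
  case: (leP (- M) x) => ?; case: (leP (- M) y) => ?; case: (leP (- M) M) => ?;
  rewrite ler_norml; apply/andP; split; lra.
Qed.

Lemma clamp_sub_le M x : 0 <= M -> `|x - clamp M x| <= `|x|.
Proof.
move=> M0; have := ler_norm x; have := ler_norm (- x); rewrite normrN => ? ?.
rewrite /clamp minEle maxEle; case: (leP x M) => ?;
  case: (leP (- M) x) => ?; case: (leP (- M) M) => ?;
  rewrite ler_norml; apply/andP; split; lra.
Qed.

Lemma nrm_clamp_cvg f : sqint f ->
  nrm (fun x => f x - clamp n%:R (f x)) @[n --> \oo] --> (0 : R).
Proof.
move=> sf; apply: cvg_nrm0.
have sc n : sqint (fun x => f x - clamp n%:R (f x)).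
  apply: sqintB => //; apply: sqint_bounded; split.
    by apply: measurable_clamp; exact: sf.1.
  by exists n%:R => x; exact: clamp_bound.
have [] := @dominated_convergence _ _ _ mu setT measurableT
  (fun n x => ((f x - clamp n%:R (f x)) ^+ 2)%:E) (cst 0%E)
  (fun x => (f x ^+ 2)%:E).
- move=> n; apply/measurable_EFinP; apply: measurable_funX; exact: (sc n).1.
- by [].
- apply: aeW => x _; apply: cvg_near_cst.
  near=> n; rewrite clamp_id ?subrr ?expr0n//.
  near: n; exact: nbhs_infty_ger.
- have := sqint_integrableM sf sf; exact: eq_integrable.
- apply: aeW => x n _; rewrite /= lee_fin ger0_norm ?sqr_ge0//.
  rewrite -(real_normK (num_real (f x - _))) -(real_normK (num_real (f x))).
  by rewrite lerXn2r ?nnegrE// clamp_sub_le.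
move=> _ _; rewrite integral0 => h.
rewrite (_ : (fun n => _) = fun n =>
    fine (\int[mu]_x ((f x - clamp n%:R (f x)) ^+ 2)%:E)%E).
  exact: (fine_cvg h).
by apply/funext => n; rewrite ip_sqrE.
Unshelve. all: by end_near.
Qed.

(** Density in L^1 is raised to L^2 by truncation: once both functions take values in [-M, M], the
    square of their difference is at most 2 M times its absolute value. *)
Lemma continuous_approx f (e : R) : sqint f -> 0 < e ->
  exists g : R -> R, [/\ continuous g, exists M, forall x, `|g x| <= M &
    nrm (fun x => f x - g x) <= e].
Proof.
move=> sf e0; have e20 : 0 < e / 2 by rewrite divr_gt0.
have /cvgrPdist_le/(_ _ e20)[m _ /(_ m (leqnn m))] := nrm_clamp_cvg sf.
rewrite /= sub0r normrN ger0_norm ?nrm_ge0// => fm.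
pose M : R := m%:R; have M0 : 0 <= M by [].
have mh : measurable_fun setT (fun x => clamp M (f x)).
  by apply: measurable_clamp; exact: sf.1.
have sh : sqint (fun x => clamp M (f x)).
  by apply: sqint_bounded; split => //; exists M => x; exact: clamp_bound.
have muE : (@lebesgue_measure R `[0%R, 1%R[%classic < +oo)%E.
  by rewrite lebesgue_measure_itv/= lte_fin ltr01 -EFinB ltry.
have [||g_ [cg _ gh]] := @approximation_continuous_integrable R `[0%R, 1%R[
    (fun x => clamp M (f x)) (measurable_itv _).
- exact: muE.
- apply: measurable_bounded_integrable => //.
  + exact: measurable_funTS.
  + exists M; split; first exact: num_real.
    by move=> x Mx t _; apply: le_trans (clamp_bound _ _) (ltW Mx).
(* Multiplied by 2 M this stays below (e / 2)^2; the summand 1 covers M = 0. *)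
have d0 : 0 < e ^+ 2 / 4 / (2 * M + 1).
  by rewrite !divr_gt0 ?exprn_gt0// ltr_wpDl// mulr_ge0.
have /fine_cvgP[gfin /cvgrPdist_lt/(_ _ d0) gd] := gh.
have [n [gn1 gn2]] : exists n,
    (\int[lebesgue_measure]_(z in `[0%R, 1%R[) `|(clamp M (f z) - g_ n z)%:E|)%E
       \is a fin_num /\
    `|0 - fine (\int[lebesgue_measure]_(z in `[0%R, 1%R[)
          `|(clamp M (f z) - g_ n z)%:E|)%E| < e ^+ 2 / 4 / (2 * M + 1).
  near \oo => n; exists n; split; near: n => //.
exists (fun x => clamp M (g_ n x)).
have cc : continuous (fun x => clamp M (g_ n x)).
  move=> x; apply/cvgrPdist_le => d d_gt0.
  have /cvgrPdist_le/(_ _ d_gt0) := cg n x; apply: filterS => y.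
  exact/le_trans/clamp_dist.
split => //; first by exists M => x; exact: clamp_bound.
have mc : measurable_fun setT (fun x => clamp M (g_ n x)).
  exact: continuous_measurable_fun.
have mg : measurable_fun setT (g_ n) by exact: continuous_measurable_fun.
have sc : sqint (fun x => clamp M (g_ n x)).
  by apply: sqint_bounded; split => //; exists M => x; exact: clamp_bound.
have -> : (fun x => f x - clamp M (g_ n x)) =
    (fun x => (f x - clamp M (f x)) + (clamp M (f x) - clamp M (g_ n x))).
  by apply/funext => x; rewrite addrA subrK.
apply: le_trans (nrmD (sqintB sf sh) (sqintB sh sc)) _.
rewrite [leRHS](splitr e) lerD//.
rewrite -(ler_pXn2r (n := 2))// ?nnegrE ?nrm_ge0 ?(ltW e20)//.
rewrite sqr_nrm -lee_fin -(ip_sqrE (sqintB sh sc)).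
apply: (@le_trans _ _ (\int[mu]_x ((2 * M)%:E * `|(clamp M (f x) - g_ n x)%:E|))%E).
  apply: ge0_le_integral => //.
  - by move=> x _; rewrite lee_fin sqr_ge0.
  - by apply/measurable_EFinP; apply: measurable_funX; exact: measurable_funB.
  - apply: emeasurable_funM => //; apply: measurableT_comp => //.
    by apply/measurable_EFinP; exact: measurable_funB.
  - move=> x _; rewrite -EFinM lee_fin -(real_normK (num_real (_ - _))) expr2.
    apply: ler_pM => //.
      apply: le_trans (ler_normB _ _) _; rewrite mulr_natl mulr2n.
      by apply: lerD; exact: clamp_bound.
    have := clamp_dist M (clamp M (f x)) (g_ n x).
    by rewrite (clamp_id (clamp_bound (f x) M0)).
rewrite integral_circle; last 2 first.
- by move=> x; rewrite mule_ge0// lee_fin mulr_ge0.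
- apply: emeasurable_funM => //; apply: measurableT_comp => //.
  by apply/measurable_EFinP; exact: measurable_funB.
rewrite ge0_integralZl_EFin//; last 2 first.
- apply: measurableT_comp => //; apply/measurable_EFinP.
  by apply: measurable_funTS; exact: measurable_funB.
- by rewrite mulr_ge0.
rewrite -(fineK gn1) -EFinM lee_fin.
move: gn2; rewrite sub0r normrN ger0_norm; last first.
  by apply: fine_ge0; apply: integral_ge0.
set I := fine _ => Ile.
have I0 : 0 <= I by apply: fine_ge0; apply: integral_ge0.
apply: (@le_trans _ _ ((2 * M + 1) * I)).
  by apply: ler_wpM2r => //; rewrite lerDl.
apply: (@le_trans _ _ ((2 * M + 1) * (e ^+ 2 / 4 / (2 * M + 1)))).
  by apply: ler_wpM2l; [rewrite addr_ge0// mulr_ge0|exact: ltW].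
rewrite mulrCA divff ?gt_eqF ?ltr_wpDl ?mulr_ge0// mulr1.
by rewrite exprMn exprVn -natrX.
Unshelve. all: by end_near.
Qed.

Lemma stepf_bound n (c : 'I_n.+1 -> R) (M x : R) : 0 <= M ->
  (forall m, `|c m| <= M) -> `|stepf c x| <= M.
Proof.
move=> M0 cM; have [[m xm]|nm] := pselect (exists m : 'I_n.+1, cell n m x).
  by rewrite (stepf_cell _ xm).
rewrite /stepf big1 ?normr0// => m _.
by rewrite /cellf indicE memNset ?mulr0// => xm; apply: nm; exists m.
Qed.

(** By [cell_proj_best] some step functions close to [f] suffice. They sample a bounded continuous
    approximation [g] at left endpoints of cells, which tend to [x], and dominated convergence
    applies. *)
Lemma cell_proj_cvg f : sqint f ->
  nrm (fun t => f t - cell_proj n f t) @[n --> \oo] --> (0 : R).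
Proof.
move=> sf; apply/cvgrPdist_le => e e0; have e20 : 0 < e / 2 by rewrite divr_gt0.
have [g [cg [M gM] fg]] := continuous_approx sf e20.
have mg : measurable_fun setT g by exact: continuous_measurable_fun.
have sg : sqint g by apply: sqint_bounded; split => //; exists M.
have M0 : 0 <= M by apply: le_trans (gM 0).
pose s n := stepf (fun m : 'I_n.+1 => g (m%:R / n.+1%:R)).
have sM n x : `|s n x| <= M by apply: stepf_bound.
have : nrm (fun x => g x - s n x) @[n --> \oo] --> (0 : R).
  apply: (@bounded_cvg_nrm _ (M + M)).
  - by move=> n; apply: measurable_funB => //; exact: (sqint_stepf _).1.
  - by move=> n x; apply: le_trans (ler_normB _ _) (lerD _ _).
  - apply: circle_ae => x x0 x1; rewrite -(subrr (g x)).
    apply: cvgB; first exact: cvg_cst.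
    pose t (n : nat) : R := (Num.truncn (x * n.+1%:R))%:R / n.+1%:R.
    have -> : (fun n => s n x) = (fun n => g (t n)).
      apply/funext => n; have [m xm] := cell_ex n (ltW x0) x1.
      rewrite /s (stepf_cell _ xm); congr (g (_%:R / _)); apply/esym/truncn_def.
      have N0 : (0 : R) < n.+1%:R by rewrite ltr0n.
      by move: xm; rewrite /cell/= in_itv/= ler_pdivrMr// ltr_pdivlMr.
    apply: (@cvg_comp _ _ _ t g _ (nbhs x)); last exact: cg.
    apply/cvgrPdist_le => d d0; near=> n.
    have N0 : (0 : R) < n.+1%:R by rewrite ltr0n.
    have /andP[] := truncn_itv (mulr_ge0 (ltW x0) (ltW N0)).
    rewrite -ler_pdivrMr// -ltr_pdivlMr// -/(t n) -natr1 mulrDl -/(t n) => tx xt.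
    rewrite ger0_norm ?subr_ge0// lerBlDl (le_trans (ltW xt))// lerD2l div1r.
    rewrite invf_ple ?posrE//; apply: (@le_trans _ _ n%:R); last by rewrite ler_nat.
    by near: n; exact: nbhs_infty_ger.
move=> /cvgrPdist_le/(_ _ e20); apply: filterS => n.
rewrite !sub0r !normrN !ger0_norm ?nrm_ge0// => gs.
apply: le_trans (cell_proj_best (fun m : 'I_n.+1 => g (m%:R / n.+1%:R)) sf) _.
have ss : sqint (s n) by exact: sqint_stepf.
have -> : (fun t => f t - s n t) = (fun t => (f t - g t) + (g t - s n t)).
  by apply/funext => t; rewrite addrA subrK.
apply: le_trans (nrmD (sqintB sf sg) (sqintB sg ss)) _.
by rewrite [leRHS](splitr e) lerD.
Unshelve. all: by end_near.
Qed.

End cell_projection_density.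

(** * Trigonometric polynomials *)

Section circle_calculus.
Context {R : realType}.
Local Notation mu := (circle_measure R).
Local Notation leb := (@lebesgue_measure R).
Implicit Types (f g F G : R -> R).

Lemma Rintegral_circle f : measurable_fun setT f ->
  \int[mu]_x f x = \int[leb]_(x in `[0%R, 1%R[) f x.
Proof.
move=> mf; have mf' : measurable_fun setT (EFin \o f) by exact/measurable_EFinP.
rewrite /Rintegral; congr fine.
rewrite integralE [RHS]integralE; congr (_ - _)%E; apply: integral_circle => //.
- exact: measurable_funepos.
- exact: measurable_funeneg.
Qed.

Lemma continuous_integrable_itv f (a b : R) : continuous f ->
  leb.-integrable `[a, b] (EFin \o f).
Proof.
move=> cf; apply: continuous_compact_integrable; first exact: segment_compact.
exact: continuous_subspaceT.
Qed.

Lemma continuous_integrable_itvco f (a b : R) : continuous f ->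
  leb.-integrable `[a, b[ (EFin \o f).
Proof.
move=> cf; apply: integrableS (continuous_integrable_itv a b cf) => //.
by apply: subset_itvl; rewrite bnd_simp.
Qed.

Lemma Rintegral_circle_itv f : continuous f ->
  \int[mu]_x f x = \int[leb]_(x in `[0%R, 1%R]) f x.
Proof.
move=> cf; rewrite Rintegral_circle; last exact: continuous_measurable_fun.
by rewrite Rintegral_itv_bndo_bndc//; exact: continuous_integrable_itvco.
Qed.

Lemma is_derive_continuous F f : (forall x : R, is_derive x (1 : R) F (f x)) ->
  continuous F.
Proof.
move=> dF x; apply: differentiable_continuous.
by apply/derivable1_diffP; have [] := dF x.
Qed.

Lemma is_derive_LRcontinuous F f (a b : R) :
  (forall x : R, is_derive x (1 : R) F (f x)) -> derivable_oo_LRcontinuous F a b.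
Proof.
move=> dF; have cF := is_derive_continuous dF; split.
- by move=> x _; have [] := dF x.
- by apply: cvg_at_right_filter; exact: cF.
- by apply: cvg_at_left_filter; exact: cF.
Qed.

Lemma ip_cellf_FTC n (m : 'I_n.+1) F f : continuous f ->
  (forall x : R, is_derive x (1 : R) F (f x)) ->
  ip f (cellf n m) = F (m.+1%:R / n.+1%:R) - F (m%:R / n.+1%:R).
Proof.
move=> cf dF; have N0 : (0 : R) < n.+1%:R by rewrite ltr0n.
have mf : measurable_fun setT f by exact: continuous_measurable_fun.
have mc := @measurable_cellf R n m.
rewrite /ip Rintegral_circle; last exact: measurable_funM.
have -> : \int[leb]_(x in `[0%R, 1%R[) (f x * cellf n m x) =
    \int[leb]_(x in cell n m) f x.
  rewrite [LHS]Rintegral_mkcond [RHS]Rintegral_mkcond; apply: eq_Rintegral => x _.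
  rewrite !patchE /cellf indicE; case: ifPn => [_|x01].
    by case: ifPn; rewrite ?mulr1 ?mulr0.
  rewrite ifF//; apply/negP => /set_mem xm; move/negP: x01; apply; apply/mem_set.
  move: x xm; rewrite /cell; apply: subset_itv; rewrite bnd_simp.
    by rewrite divr_ge0// ler0n.
  by rewrite ler_pdivrMr// mul1r ler_nat.
rewrite /cell Rintegral_itv_bndo_bndc; last exact: continuous_integrable_itvco.
rewrite /Rintegral (@continuous_FTC2 _ f F).
- by [].
- by rewrite ltr_pM2r ?invr_gt0// ltr_nat.
- exact: continuous_subspaceT.
- exact: is_derive_LRcontinuous dF.
- by move=> x _; rewrite derive1E; have [] := dF x.
Qed.

Lemma circle_by_parts F f G g : continuous f -> continuous g ->
  (forall x : R, is_derive x (1 : R) F (f x)) -> (forall x : R, is_derive x (1 : R) G (g x)) ->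
  F 1 = F 0 -> G 1 = G 0 ->
  \int[mu]_x (F x * g x) = - \int[mu]_x (f x * G x).
Proof.
move=> cf cg dF dG F1 G1.
have cF := is_derive_continuous dF; have cG := is_derive_continuous dG.
rewrite !Rintegral_circle_itv; first last.
- by move=> x; apply: cvgM; [exact: cF|exact: cg].
- by move=> x; apply: cvgM; [exact: cf|exact: cG].
rewrite (@Rintegration_by_parts _ F G f g)//.
- by rewrite F1 G1 subrr sub0r.
- exact: continuous_subspaceT.
- exact: is_derive_LRcontinuous dF.
- by move=> x _; rewrite derive1E; have [] := dF x.
- exact: continuous_subspaceT.
- exact: is_derive_LRcontinuous dG.
- by move=> x _; rewrite derive1E; have [] := dG x.
Qed.

End circle_calculus.

Section trigonometric_polynomials.
Context {R : realType}.
Local Notation mu := (circle_measure R).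

Definition freq (k : nat) : R := k%:R * (pi *+ 2).

Definition tmode (k : nat) (b t : R) : R := cos (freq k * t + b).

(** A term is a triple (amplitude, frequency, phase). With phases, sines need no family of their
    own. *)
Definition trigp (s : seq (R * nat * R)) (t : R) : R :=
  \sum_(x <- s) x.1.1 * tmode x.1.2 x.2 t.

Definition is_trig (f : R -> R) := exists s, f = trigp s.

(** Differentiation shifts the phase, because - sin u = cos (u + pi / 2). *)
Definition dtrig (s : seq (R * nat * R)) :=
  [seq (x.1.1 * freq x.1.2, x.1.2, x.2 + pi / 2) | x <- s].

Lemma is_derive_tmode k b t :
  is_derive t (1 : R) (tmode k b) (freq k * tmode k (b + pi / 2) t).
Proof.
rewrite /tmode addrA cosDpihalf mulrN -mulNr mulrC mulrN -mulNr.
have -> : (fun t : R => cos (freq k * t + b)) = cos \o (fun t => freq k * t + b).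
  by [].
apply: is_derive1_comp.
rewrite -[X in is_derive _ _ _ X]addr0 -[freq k in X in is_derive _ _ _ X]mulr1.
apply: is_deriveD.
Qed.

Lemma is_derive_trigp s t : is_derive t (1 : R) (trigp s) (trigp (dtrig s) t).
Proof.
elim: s => [|x s IH].
  rewrite /trigp/= big_nil.
  have -> : (fun t => \sum_(x <- [::]) x.1.1 * tmode x.1.2 x.2 t) = cst (0 : R).
    by apply/funext => u; rewrite big_nil.
  exact: is_derive_cst.
have -> : trigp (x :: s) = (fun t => x.1.1 * tmode x.1.2 x.2 t) + trigp s.
  by apply/funext => u; rewrite /trigp big_cons.
rewrite {2}/trigp/= big_cons/=.
apply: is_deriveD => //.
rewrite -mulrA.
apply: is_deriveZ.
exact: is_derive_tmode.
Qed.

Lemma continuous_trigp s : continuous (trigp s).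
Proof. exact: is_derive_continuous (is_derive_trigp s). Qed.

Lemma tmode_bound k b t : `|tmode k b t| <= 1.
Proof. exact: cos_max. Qed.

Lemma sqint_trigp s : sqint (trigp s).
Proof.
apply: sqint_bounded; split.
  by apply: continuous_measurable_fun; exact: continuous_trigp.
exists (\sum_(x <- s) `|x.1.1|) => t; apply: le_trans (ler_norm_sum _ _ _) _.
by apply: ler_sum => x _; rewrite normrM ler_piMr// tmode_bound.
Qed.

Lemma cosD2pin (k : nat) (x : R) : cos (x + k%:R * (pi *+ 2)) = cos x.
Proof.
elim: k x => [|k IH] x; first by rewrite mul0r addr0.
by rewrite -natr1 mulrDl mul1r addrA cosD2pi IH.
Qed.

Lemma sinD2pin (k : nat) (x : R) : sin (x + k%:R * (pi *+ 2)) = sin x.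
Proof.
elim: k x => [|k IH] x; first by rewrite mul0r addr0.
by rewrite -natr1 mulrDl mul1r addrA sinD2pi IH.
Qed.

Lemma tmode_periodic k b t : tmode k b (t + 1) = tmode k b t.
Proof. by rewrite /tmode mulrDr mulr1 addrAC cosD2pin. Qed.

Lemma trigp_periodic s t : trigp s (t + 1) = trigp s t.
Proof. by apply: eq_bigr => x _; rewrite tmode_periodic. Qed.

Lemma derive1_trigp s : (trigp s)^`()%classic = trigp (dtrig s).
Proof.
by apply/funext => t; rewrite derive1E; have [] := is_derive_trigp s t.
Qed.

Lemma derive1n_trigp n s : derive1n n (trigp s) = trigp (iter n dtrig s).
Proof. by elim: n => //= n ->; exact: derive1_trigp. Qed.

Lemma periodic_smooth_trigp s : periodic_smooth (trigp s).
Proof.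
split; last exact: trigp_periodic.
by move=> n x; rewrite derive1n_trigp; have [] := is_derive_trigp (iter n dtrig s) x.
Qed.

Lemma is_trig_cst c : is_trig (fun=> c).
Proof.
exists [:: (c, 0%N, 0)]; apply/funext => t.
by rewrite /trigp big_seq1/= /tmode /freq !mul0r add0r cos0 mulr1.
Qed.

Lemma is_trigD f g : is_trig f -> is_trig g -> is_trig (fun t => f t + g t).
Proof.
by move=> [s ->] [s' ->]; exists (s ++ s'); apply/funext => t; rewrite /trigp big_cat.
Qed.

Lemma is_trigZ a f : is_trig f -> is_trig (fun t => a * f t).
Proof.
move=> [s ->]; exists [seq (a * x.1.1, x.1.2, x.2) | x <- s]; apply/funext => t.
by rewrite /trigp big_map mulr_sumr; apply: eq_bigr => x _; rewrite mulrA.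
Qed.

Lemma is_trig_tmode k b : is_trig (tmode k b).
Proof.
by exists [:: (1, k, b)]; apply/funext => t; rewrite /trigp big_seq1 mul1r.
Qed.

Lemma is_trig_tmodeM k b k' b' : is_trig (fun t => tmode k b t * tmode k' b' t).
Proof.
(* Frequencies are natural numbers, so the difference [k - k'] in the product formula has to be a
   true one. *)
wlog kk' : k b k' b' / (k' <= k)%N => [H|].
  have [|/ltnW] := leqP k' k; first exact: H.
  by move=> /H; under eq_fun do rewrite mulrC.
have -> : (fun t => tmode k b t * tmode k' b' t) =
  (fun t => 2^-1 * tmode (k + k') (b + b') t + 2^-1 * tmode (k - k') (b - b') t).
  apply/funext => t; rewrite /tmode /freq natrD natrB//.
  have -> : (k%:R + k'%:R) * (pi *+ 2) * t + (b + b') =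
    (k%:R * (pi *+ 2) * t + b) + (k'%:R * (pi *+ 2) * t + b') by ring.
  have -> : (k%:R - k'%:R) * (pi *+ 2) * t + (b - b') =
    (k%:R * (pi *+ 2) * t + b) - (k'%:R * (pi *+ 2) * t + b') by ring.
  move: (k%:R * _ * t + b) (k'%:R * _ * t + b') => A B.
  by rewrite (cosD A B) (cosB A B); field.
by apply: is_trigD; apply: is_trigZ; exact: is_trig_tmode.
Qed.

Lemma is_trigM f g : is_trig f -> is_trig g -> is_trig (fun t => f t * g t).
Proof.
move=> [s ->] [s' ->]; elim: s => [|x s IH].
  by under eq_fun do rewrite /trigp big_nil mul0r; exact: is_trig_cst.
under eq_fun do rewrite [trigp (x :: s) _]big_cons mulrDl; apply: is_trigD => //.
elim: s' {IH} => [|x' s' IH].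
  by under eq_fun do rewrite /trigp big_nil mulr0; exact: is_trig_cst.
under eq_fun do rewrite [trigp (x' :: s') _]big_cons mulrDr; apply: is_trigD => //.
under eq_fun do rewrite mulrACA.
by apply: is_trigZ; exact: is_trig_tmodeM.
Qed.

Lemma is_trig_bern m (F : nat -> R) p y : is_trig p ->
  is_trig (fun t => bern m F (p t) y).
Proof.
move=> tp; elim: m y => [|m IH] y /=; first exact: is_trig_cst.
apply: is_trigD; apply: is_trigM => //.
have := is_trigD (is_trig_cst 1) (is_trigZ (-1) tp).
by under eq_fun do rewrite mulN1r.
Qed.

Lemma weak_derivative_trigp s :
  weak_derivative (mkL2 (trigp s)) (mkL2 (trigp (dtrig s))).
Proof.
move=> phi [dphi pphi].
have dphi0 (x : R) : is_derive x (1 : R) phi (phi^`()%classic x).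
  by rewrite derive1E; exact/derivableP/(dphi 0%N x).
have dphi1 (x : R) : is_derive x (1 : R) (phi^`()%classic) ((phi^`()^`())%classic x).
  by rewrite [X in is_derive _ _ _ X]derive1E; exact/derivableP/(dphi 1%N x).
have cphi := is_derive_continuous dphi0; have cphi' := is_derive_continuous dphi1.
have per0 f : (forall x, f (x + 1) = f x) -> f 1 = f 0 :> R.
  by move=> /(_ 0); rewrite add0r.
have mk s' (g : R -> R) : continuous g ->
    \int[mu]_x (mkL2 (trigp s') x * g x) = \int[mu]_x (trigp s' x * g x).
  move=> cg; rewrite /Rintegral; congr fine.
  have mg : measurable_fun setT g by exact: continuous_measurable_fun.
  have ms := (sqint_trigp s').1.
  have mL := measurable_L2fun (mkL2 (trigp s')).
  apply: ae_eq_integral => //.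
  - by apply/measurable_EFinP; exact: measurable_funM.
  - by apply/measurable_EFinP; exact: measurable_funM.
  - by apply: circle_aeS (mkL2E (sqint_trigp s')) => x /= -> _.
rewrite !mk//; apply: circle_by_parts => //.
- exact: continuous_trigp.
- exact: is_derive_trigp.
- by apply: per0; exact: trigp_periodic.
- exact: per0.
Qed.

End trigonometric_polynomials.

(** * Approximation of cell indicators by trigonometric polynomials *)

Section trigonometric_approximation.
Context {R : realType}.
Local Notation mu := (circle_measure R).

Lemma circle_ae_neq (a : R) : {ae mu, forall x, x <> a}.
Proof.
exists [set a]; split => //.
- rewrite /= /mrestr; apply/eqP; rewrite eq_le measure_ge0 andbT.
  rewrite -(@lebesgue_measure_set1 R a); apply: le_measure; rewrite ?inE//.
  by apply: measurableI => //; exact: measurable_itv.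
- by move=> x /= h; apply: contrapT => xa; apply: h.
Qed.

(** Each sine has half the basic frequency, but the product is a trigonometric polynomial of period
    1. For 0 <= a < b <= 1 and t in ]0, 1[, its values exceed 1/2 on ]a, b[ and are below 1/2
    outside [a, b], so a polynomial approximation of the threshold at 1/2 turns it into one of the
    indicator. *)
Definition cell_sign (a b t : R) : R :=
  (1 + sin (pi * (t - a)) * sin (pi * (b - t))) / 2.

Lemma is_trig_cell_sign a b : is_trig (cell_sign a b).
Proof.
have -> : cell_sign a b = (fun t => (1 - cos (pi * (b - a)) / 2) / 2 +
    4^-1 * tmode 1 (- (pi * (a + b))) t).
  apply/funext => t; rewrite /cell_sign /tmode /freq mul1r mulr2n.
  have -> : (pi + pi) * t - pi * (a + b) = pi * (t - a) - pi * (b - t).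
    by ring.
  have -> : pi * (b - a) = pi * (t - a) + pi * (b - t) by ring.
  move: (pi * (t - a)) (pi * (b - t)) => A B.
  by rewrite (cosD A B) (cosB A B); field.
apply: is_trigD; first exact: is_trig_cst.
by apply: is_trigZ; exact: is_trig_tmode.
Qed.

Lemma cell_sign_itv a b t : 0 <= cell_sign a b t <= 1.
Proof.
have h1 := sin_max (pi * (t - a)); have h2 := sin_max (pi * (b - t)).
have : `|sin (pi * (t - a)) * sin (pi * (b - t))| <= 1.
  by rewrite normrM -[leRHS]mulr1 ler_pM.
by rewrite ler_norml /cell_sign => /andP[? ?]; apply/andP; split; lra.
Qed.

Lemma sinpi_gt0 (x : R) : 0 < x -> x < 1 -> 0 < sin (pi * x).
Proof.
move=> x0 x1; apply: sin_gt0_pi; rewrite mulr_gt0 ?pi_gt0//=.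
by rewrite gtr_pMr// pi_gt0.
Qed.

Lemma cell_sign_in a b t : 0 <= a -> b <= 1 -> 0 < t -> t < 1 ->
  a < t -> t < b -> 2^-1 < cell_sign a b t.
Proof.
move=> a0 b1 t0 t1 ta tb.
have : 0 < sin (pi * (t - a)) by apply: sinpi_gt0; lra.
have : 0 < sin (pi * (b - t)) by apply: sinpi_gt0; lra.
move=> h1 h2; have := mulr_gt0 h2 h1; rewrite /cell_sign; lra.
Qed.

Lemma cell_sign_out a b t : 0 <= a -> b <= 1 -> a < b -> 0 < t -> t < 1 ->
  t < a \/ b < t -> cell_sign a b t < 2^-1.
Proof.
move=> a0 b1 ab t0 t1 [ta|bt].
  have h1 : 0 < sin (pi * (a - t)) by apply: sinpi_gt0; lra.
  have h2 : 0 < sin (pi * (b - t)) by apply: sinpi_gt0; lra.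
  rewrite /cell_sign -(opprB a t) mulrN sinN.
  have := mulr_gt0 h1 h2; lra.
have h1 : 0 < sin (pi * (t - a)) by apply: sinpi_gt0; lra.
have h2 : 0 < sin (pi * (t - b)) by apply: sinpi_gt0; lra.
rewrite /cell_sign -(opprB t b) mulrN sinN.
have := mulr_gt0 h1 h2; lra.
Qed.

(** The probability that the success rate in [m] Bernoulli trials of parameter [p] exceeds one
    half. *)
Definition bern_sign (m : nat) (p : R) : R :=
  bern m (fun j => (2^-1 < j%:R / m%:R :> R)%R%:R) p 0.

(** Chebyshev's inequality: if the threshold separates j / m from p, then |j / m - p| >= |p - 1/2|,
    while the variance of j / m is at most 1 / m. At the threshold itself convergence fails. *)
Lemma bern_sign_cvg (p : R) : 0 <= p <= 1 -> p != 2^-1 ->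
  bern_sign m p @[m --> \oo] --> (((2^-1 < p)%R%:R) : R).
Proof.
move=> p01 p2; have d0 : 0 < (p - 2^-1) ^+ 2.
  by rewrite exprn_even_gt0//= subr_eq0.
apply/cvgrPdist_le => e e0; near=> m.
have m0 : (0 < m)%N by near: m; exact: nbhs_infty_gt.
have mR : (0 : R) < m%:R by rewrite ltr0n.
rewrite distrC -(bern_cst m ((2^-1 < p)%R%:R) p 0) /bern_sign -bernB.
apply: le_trans (ler_norm_bern _ _ _ p01) _.
apply: (@le_trans _ _ (bern m (fun j => ((p - 2^-1) ^+ 2)^-1 *
    (j%:R / m%:R - p) ^+ 2) p 0)).
  apply: le_bern => // j; rewrite [leRHS]mulrC ler_pdivlMr//.
  move: (j%:R / m%:R) => x.
  case: (ltP 2^-1 x) => h1; case: (ltP 2^-1 p) => h2 /=.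
  - by rewrite subrr normr0 mul0r sqr_ge0.
  - rewrite subr0 normr1 mul1r; nra.
  - rewrite sub0r normrN normr1 mul1r; nra.
  - by rewrite subrr normr0 mul0r sqr_ge0.
rewrite bernZ [leLHS]mulrC ler_pdivrMr//.
apply: le_trans (bern_variance m0 p01) _.
have ed : 0 < e * (p - 2^-1) ^+ 2 by exact: mulr_gt0.
rewrite invf_ple ?posrE//.
by near: m; exact: nbhs_infty_ger.
Unshelve. all: by end_near.
Qed.

Lemma bern_sign_bound m (p : R) : 0 <= p <= 1 -> `|bern_sign m p| <= 1.
Proof.
move=> p01; apply: le_trans (ler_norm_bern _ _ _ p01) _.
rewrite -[leRHS](bern_cst m 1 p 0); apply: le_bern => // j.
by case: (_ < _); rewrite ?normr1 ?normr0.
Qed.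

Lemma trig_approx_cellf n (m : 'I_n.+1) (e : R) : 0 < e ->
  exists s, nrm (fun t => cellf n m t - trigp s t) <= e.
Proof.
move=> e0; have N0 : (0 : R) < n.+1%:R by rewrite ltr0n.
pose a : R := m%:R / n.+1%:R; pose b : R := m.+1%:R / n.+1%:R.
have a0 : 0 <= a by rewrite divr_ge0// ler0n.
have b1 : b <= 1 by rewrite ler_pdivrMr// mul1r ler_nat.
have ab : a < b by rewrite ltr_pM2r ?invr_gt0// ltr_nat.
have tT k : is_trig (fun t => bern_sign k (cell_sign a b t)).
  by apply: is_trig_bern; exact: is_trig_cell_sign.
have mT k : measurable_fun setT (fun t => bern_sign k (cell_sign a b t)).
  by have [s ->] := tT k; exact: (sqint_trigp s).1.
have : nrm (fun t => cellf n m t - bern_sign k (cell_sign a b t)) @[k --> \oo] -->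
    (0 : R).
  apply: (@bounded_cvg_nrm _ _ 2).
  - by move=> k; apply: measurable_funB => //; exact: measurable_cellf.
  - move=> k x; apply: le_trans (ler_normB _ _) _.
    have := bern_sign_bound k (cell_sign_itv a b x).
    have : `|cellf n m x| <= 1.
      by rewrite /cellf indicE; case: (_ \in _); rewrite ?normr1 ?normr0.
    lra.
  - have H01 : {ae mu, forall x : R, 0 < x /\ x < 1}.
      by apply: circle_ae.
    have := @filterS3 _ _ (ae_filter_ringOfSetsType mu) _ _ _ _ _ H01
      (circle_ae_neq a) (circle_ae_neq b); apply => x [x0 x1] xa xb.
    rewrite -(subrr (cellf n m x)); apply: cvgB; first exact: cvg_cst.
    have -> : cellf n m x = (2^-1 < cell_sign a b x)%R%:R.
      rewrite /cellf indicE; congr ((nat_of_bool _)%:R); apply/idP/idP => [/set_mem|h].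
        rewrite /cell/= in_itv/= -/a -/b => /andP[ax xb'].
        apply: cell_sign_in => //; rewrite lt_neqAle ax andbT.
        by apply/eqP => /esym.
      apply/mem_set; rewrite /cell/= in_itv/= -/a -/b.
      apply/andP; split.
        rewrite leNgt; apply/negP => xa'; have := cell_sign_out a0 b1 ab x0 x1.
        by move=> /(_ (or_introl xa')) /(lt_trans h); rewrite ltxx.
      rewrite ltNge; apply/negP => bx.
      have {}bx : b < x by rewrite lt_neqAle bx andbT; apply/eqP => /esym.
      have := cell_sign_out a0 b1 ab x0 x1.
      by move=> /(_ (or_intror bx)) /(lt_trans h); rewrite ltxx.
    apply: bern_sign_cvg; first exact: cell_sign_itv.
    have [xa'|ax] := ltP x a.
      by rewrite lt_eqF//; apply: cell_sign_out => //; left.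
    have {}ax : a < x by rewrite lt_neqAle ax andbT; apply/eqP => /esym.
    have [bx|xb'] := ltP b x.
      by rewrite lt_eqF//; apply: cell_sign_out => //; right.
    rewrite gt_eqF//; apply: cell_sign_in => //.
    by rewrite lt_neqAle xb' andbT; apply/eqP.
move=> /cvgrPdist_le/(_ _ e0)[k _ /(_ k (leqnn k))].
rewrite /= sub0r normrN ger0_norm ?nrm_ge0// => h.
by have [s es] := tT k; exists s; rewrite -es.
Qed.

End trigonometric_approximation.

(** * The covariance of the limit on trigonometric polynomials *)

Section continuum_covariance.
Context {R : realType}.
Local Notation mu := (circle_measure R).

(** The inverse of kappa (- d^2/dt^2 + Id), which is diagonal in the modes. *)
Definition resolvent (kappa : R) (s : seq (R * nat * R)) :=
  [seq (x.1.1 / (kappa * (1 + freq x.1.2 ^+ 2)), x.1.2, x.2) | x <- s].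

Lemma resolventE kappa s t : 0 < kappa ->
  trigp s t = kappa * (trigp (resolvent kappa s) t -
                       trigp (dtrig (dtrig (resolvent kappa s))) t).
Proof.
move=> k0; rewrite /trigp !big_map -sumrB mulr_sumr; apply: eq_bigr => x _ /=.
rewrite /tmode -addrA -splitr addrA cosDpi.
have h : 1 + freq x.1.2 ^+ 2 != 0 :> R.
  by rewrite gt_eqF// ltr_wpDr// sqr_ge0.
by field; rewrite h gt_eqF.
Qed.

(** Symmetry evaluates the pairing for whichever preimage [u] of g = [trigp s] is chosen. With A =
    kappa (- d^2/dt^2 + Id) and A r = g, one has (g, u) = (A r, u) = (r, A u) = (r, g), where the
    weak derivatives of [u] are tested against [r] and its derivative. *)
Lemma inverse_operator_trigp kappa s : 0 < kappa ->
  L2dot (mkL2 (trigp s))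
    (inverse_operator (scale_graph kappa (@scrL_graph R)) (mkL2 (trigp s))) =
  ip (trigp s) (trigp (resolvent kappa s)).
Proof.
move=> k0; set r := resolvent kappa s.
have st := @sqint_trigp R.
(* The resolvent is a witness that the set is nonempty, so that [get] returns one of its elements
   rather than a default value. *)
have : [set u | scale_graph kappa (@scrL_graph R) u (mkL2 (trigp s))] (mkL2 (trigp r)).
  exists (mkL2 (fun t => kappa^-1 * trigp s t)).
    exists (mkL2 (trigp (dtrig r))), (mkL2 (trigp (dtrig (dtrig r)))).
    split; [exact: weak_derivative_trigp|exact: weak_derivative_trigp|].
    have := @filterS3 _ _ (ae_filter_ringOfSetsType mu) _ _ _ _ _
      (mkL2E (sqintZ kappa^-1 (st s))) (mkL2E (st (dtrig (dtrig r)))) (mkL2E (st r)).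
    apply => x -> -> ->.
    by rewrite (resolventE _ _ k0) mulrA mulVf ?gt_eqF// mul1r addrC.
  have := @filterS2 _ _ (ae_filter_ringOfSetsType mu) _ _ _ _
    (mkL2E (sqintZ kappa^-1 (st s))) (mkL2E (st s)); apply => x -> ->.
  by rewrite mulrA divff ?gt_eqF// mul1r.
move=> /getI; rewrite -/(inverse_operator _ _).
set u := inverse_operator _ _ => -[h [v [w [uv vw hE]]] sE].
have su := sqint_L2fun u; have sv := sqint_L2fun v; have sw := sqint_L2fun w.
have sh := sqint_L2fun h.
rewrite /L2dot -/(ip _ _) (ip_mkL2l (st s) su).
have uvE := uv _ (periodic_smooth_trigp (dtrig r)).
have vwE := vw _ (periodic_smooth_trigp r).
rewrite derive1_trigp -!/(ip _ _) in uvE.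
rewrite derive1_trigp -!/(ip _ _) in vwE.
transitivity (kappa * (ip u (trigp r) - ip w (trigp r))).
  have -> : ip w (trigp r) = ip u (trigp (dtrig (dtrig r))).
    by rewrite uvE vwE opprK.
  rewrite !(ipC u) -(ipBl (st _) (st _) su) -ipZl//; last exact: sqintB.
  by congr ip; apply/funext => t; exact: resolventE.
rewrite -(ipBl su sw (st _)) -ipZl//; last exact: sqintB.
have sz := sqintZ kappa (sqintB su sw).
apply: (ip_ae sz (st s) (st r)).
have := @filterS3 _ _ (ae_filter_ringOfSetsType mu) _ _ _ _ _ sE hE (mkL2E (st s)).
by apply => x /= a b c; rewrite -c a b addrC.
Qed.

End continuum_covariance.

(** * The discrete covariance *)

Section discrete_covariance.
Context {R : realType} (n : nat) (kappa : R).
Hypothesis kappa_gt0 : 0 < kappa.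
Local Notation N := n.+1.
Local Notation L := (@discreteL R n).
Implicit Types a f w : 'cV[R]_N.

Let N_gt0 : 0 < N%:R :> R. Proof. by rewrite ltr0n. Qed.

Lemma vec_dotZr (c : R) f w : vec_dot f (c *: w) = c * vec_dot f w.
Proof.
by rewrite /vec_dot mulr_sumr; apply: eq_bigr => i _; rewrite mxE mulrCA.
Qed.

Lemma vec_dotC f w : vec_dot f w = vec_dot w f.
Proof. by apply: eq_bigr => i _; rewrite mulrC. Qed.

Lemma vec_dot_sqr f : vec_dot f f = \sum_(i < N) f i 0 ^+ 2.
Proof. by apply: eq_bigr => i _; rewrite expr2. Qed.

Lemma discreteL_form_ge f : N%:R^-1 * vec_dot f f <= vec_dot f (L *m f).
Proof.
rewrite discreteL_form vec_dot_sqr ler_wpM2l ?invr_ge0 ?(ltW N_gt0)//.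
apply: ler_sum => i _; rewrite lerDl mulr_ge0// sqr_ge0.
by [].
Qed.

Lemma discreteL_form_grad_ge f :
  N%:R * \sum_(i < N) (f (ordS i) 0 - f i 0) ^+ 2 <= vec_dot f (L *m f).
Proof.
rewrite discreteL_form big_split/= -mulr_sumr mulrDr mulrA.
have -> : N%:R^-1 * N%:R ^+ 2 = N%:R :> R.
  by rewrite expr2 mulrA mulVf ?mul1r// gt_eqF.
rewrite lerDr mulr_ge0 ?invr_ge0 ?(ltW N_gt0)//.
by apply: sumr_ge0 => i _; exact: sqr_ge0.
Qed.

(** A vector in the kernel has zero energy, and the energy is at least its squared norm divided by
    N. The transposes are there because [det0P] provides a row vector. *)
Lemma discreteL_unit : kappa *: L \in unitmx.
Proof.
rewrite unitmxE unitfE -det_tr; apply/negP => /det0P[v v0].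
rewrite -[v]trmxK -trmx_mul => /(congr1 trmx); rewrite trmxK trmx0 -scalemxAl.
move=> /eqP; rewrite scaler_eq0 gt_eqF//= => /eqP Lv.
have := discreteL_form_ge v^T; rewrite Lv.
have -> : vec_dot v^T 0 = 0.
  by rewrite /vec_dot big1// => i _; rewrite [X in _ * X]mxE mulr0.
rewrite pmulr_rle0 ?invr_gt0// vec_dot_sqr => h.
move/eqP: v0; apply; apply/rowP => i; rewrite mxE.
have /eqP : \sum_(i < N) v^T i 0 ^+ 2 = 0.
  by apply/eqP; rewrite eq_le h sumr_ge0// => j _; exact: sqr_ge0.
rewrite psumr_eq0; last by move=> j _; exact: sqr_ge0.
by move=> /allP/(_ i (mem_index_enum _)); rewrite /= sqrf_eq0 mxE => /eqP.
Qed.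

Definition discrete_inv (a : 'cV[R]_N) : 'cV[R]_N := invmx (kappa *: L) *m a.

Lemma discrete_invE a : kappa *: (L *m discrete_inv a) = a.
Proof.
by rewrite scalemxAl /discrete_inv mulKVmx// discreteL_unit.
Qed.

(** A variance becomes the energy of the solution of an equation, so that lower bounds on [L] turn
    into upper bounds on variances. *)
Lemma discrete_inv_energy a : vec_dot a (discrete_inv a) =
  kappa * vec_dot (discrete_inv a) (L *m discrete_inv a).
Proof. by rewrite -vec_dotZr discrete_invE vec_dotC. Qed.

Lemma discrete_inv_eigen a (c : R) : c != 0 -> L *m a = c *: a ->
  discrete_inv a = (kappa * c)^-1 *: a.
Proof.
move=> c0 La; apply: (can_inj (mulKmx discreteL_unit)).
rewrite /discrete_inv mulKVmx ?discreteL_unit// -scalemxAr -scalemxAl La !scalerA.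
by rewrite -mulrA mulVf ?scale1r// mulf_neq0// gt_eqF.
Qed.

Lemma vec_dot_cauchy f w : vec_dot f w ^+ 2 <= vec_dot f f * vec_dot w w.
Proof.
have H (c : R) : 0 <= vec_dot f f + 2 * (c * vec_dot f w) + c ^+ 2 * vec_dot w w.
  have : 0 <= \sum_(i < N) (f i 0 + c * w i 0) ^+ 2.
    by apply: sumr_ge0 => i _; exact: sqr_ge0.
  suff -> : \sum_(i < N) (f i 0 + c * w i 0) ^+ 2 =
      vec_dot f f + 2 * (c * vec_dot f w) + c ^+ 2 * vec_dot w w by [].
  rewrite /vec_dot !mulr_sumr -!big_split/=; apply: eq_bigr => i _; ring.
have : 0 <= vec_dot w w by rewrite vec_dot_sqr sumr_ge0// => i _; exact: sqr_ge0.
rewrite le0r => /orP[/eqP w0|w0].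
  rewrite w0 mulr0; suff -> : vec_dot f w = 0 by rewrite expr0n.
  apply/eqP/negPn/negP => fg0.
  have := H (- (vec_dot f f + 1) / (2 * vec_dot f w)).
  rewrite w0 mulr0 addr0.
  have -> : 2 * (- (vec_dot f f + 1) / (2 * vec_dot f w) * vec_dot f w) =
    - (vec_dot f f + 1) by field.
  lra.
have := H (- vec_dot f w / vec_dot w w).
have -> : vec_dot f f + 2 * (- vec_dot f w / vec_dot w w * vec_dot f w) +
   (- vec_dot f w / vec_dot w w) ^+ 2 * vec_dot w w =
   (vec_dot f f * vec_dot w w - vec_dot f w ^+ 2) / vec_dot w w.
  by field; rewrite gt_eqF.
by rewrite pmulr_lge0 ?invr_gt0// subr_ge0.
Qed.

(** The bound L >= 1/N, inverted by duality: kappa |w|^2 / N <= q and q^2 <= |a|^2 |w|^2 give q^2 <=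
    (N / kappa) |a|^2 q, which is divided by q. *)
Lemma discrete_cov_le a :
  vec_dot a (discrete_inv a) <= N%:R / kappa * vec_dot a a.
Proof.
set w := discrete_inv a; set q := vec_dot a w.
have h1 : kappa / N%:R * vec_dot w w <= q.
  rewrite /q discrete_inv_energy -/w -mulrA ler_wpM2l ?(ltW kappa_gt0)//.
  exact: discreteL_form_ge.
have h2 := vec_dot_cauchy a w.
have a0 : 0 <= vec_dot a a.
  by rewrite vec_dot_sqr sumr_ge0// => i _; exact: sqr_ge0.
have [q0|q0] := leP q 0.
  by apply: le_trans q0 _; rewrite mulr_ge0// divr_ge0 ?ltW.
have h3 : vec_dot w w <= N%:R / kappa * q.
  rewrite mulrAC ler_pdivlMr// -ler_pdivrMl//; move: h1; rewrite mulrAC.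
  by rewrite (mulrC (vec_dot w w)) (mulrC N%:R^-1).
have h4 : q ^+ 2 <= vec_dot a a * (N%:R / kappa * q).
  by apply: le_trans h2 _; rewrite ler_wpM2l.
by rewrite -(ler_pM2r q0) -expr2; apply: le_trans h4 _; rewrite mulrA (mulrC (vec_dot a a)).
Qed.

Lemma telescope_cauchy (u : nat -> R) (i k : nat) :
  (u (i + k)%N - u i) ^+ 2 <= k%:R * \sum_(i <= l < i + k) (u l.+1 - u l) ^+ 2.
Proof.
elim: k => [|k IH]; first by rewrite addn0 subrr expr0n mul0r.
rewrite addnS big_nat_recr/= ?leq_addr//.
set S := \sum_(i <= l < i + k) _ in IH *.
set A := u (i + k)%N - u i in IH *; set B := u (i + k).+1 - u (i + k)%N.
have -> : u (i + k).+1 - u i = A + B by rewrite /A /B; ring.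
have S0 : 0 <= S by apply: sumr_ge0 => l _; exact: sqr_ge0.
rewrite -natr1.
have [k0|k0] := posnP k.
  by move: IH; rewrite k0 mul0r => IH; nra.
have kR : 0 < k%:R :> R by rewrite ltr0n.
(* AM-GM: [2 A B <= A^2 / k + k B^2] *)
have h : 2 * (A * B) <= A ^+ 2 / k%:R + k%:R * B ^+ 2.
  rewrite -(ler_pM2r kR) [leRHS]mulrDl divfK ?gt_eqF//.
  by have := sqr_ge0 (A - k%:R * B); nra.
have h' : A ^+ 2 / k%:R <= S by rewrite ler_pdivrMr// mulrC.
nra.
Qed.

(** The variance equals the increment D of the solution [w] between i and j. With E the sum of
    squared increments of [w], Cauchy-Schwarz gives D^2 <= (j - i) E and the energy gives kappa N E
    <= D; combine and divide by D. The linear growth in j - i is that of Brownian increments. *)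
Lemma discrete_cov_increment (i j : 'I_N) a : (i <= j)%N ->
  a = delta_mx j 0 - delta_mx i 0 ->
  vec_dot a (discrete_inv a) <= (j - i)%:R / (kappa * N%:R).
Proof.
move=> ij aE; set w := discrete_inv a.
have dE (k : 'I_N) f : vec_dot (delta_mx k 0) f = f k 0.
  rewrite /vec_dot (bigD1 k)//= mxE !eqxx mul1r big1 ?addr0// => l /negbTE lk.
  by rewrite mxE lk mul0r.
have aw : vec_dot a w = w j 0 - w i 0.
  rewrite aE -(dE j w) -(dE i w) /vec_dot -sumrB; apply: eq_bigr => l _.
  by rewrite !mxE mulrBl.
pose u (l : nat) : R := w (inord l) 0.
have uE (l : 'I_N) : u l = w l 0 by rewrite /u inord_val.
have h1 : (w j 0 - w i 0) ^+ 2 <=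
    (j - i)%:R * \sum_(l < N) (w (ordS l) 0 - w l 0) ^+ 2.
  rewrite -!uE -{1}(subnKC ij); apply: le_trans (telescope_cauchy _ _ _) _.
  rewrite ler_wpM2l// subnKC//.
  rewrite [leRHS](_ : _ = \sum_(0 <= l < N) (w (ordS (inord l)) 0 - u l) ^+ 2); last first.
    by rewrite big_mkord; apply: eq_bigr => l _; rewrite /u inord_val.
  (* Increments outside the path from [i] to [j] are dropped. The one closing the circle is among
     them, so on the path the successor modulo N is the ordinary one. *)
  rewrite (@big_cat_nat _ _ _ i 0 N)//=; last by rewrite ltnW.
  rewrite (@big_cat_nat _ _ _ j i N)//=; last by rewrite ltnW.
  rewrite addrCA -[leLHS]addr0; apply: lerD; last first.
    by rewrite addr_ge0// sumr_ge0// => l _; exact: sqr_ge0.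
  rewrite le_eqVlt; apply/orP; left; apply/eqP; apply: eq_big_nat => l /andP[il lj].
  congr ((w _ 0 - _) ^+ 2); apply: val_inj.
  have lN : (l.+1 < N)%N by apply: leq_ltn_trans lj _.
  by rewrite /= !inordK// ?modn_small// ltnW.
have h2 := discreteL_form_grad_ge w.
have := discrete_inv_energy a; rewrite -/w aw => d.
set D := w j 0 - w i 0 in h1 d *.
set E := \sum_(l < N) _ in h1 h2.
have h3 : kappa * (N%:R * E) <= D by rewrite d ler_pM2l.
have E0 : 0 <= E by apply: sumr_ge0 => l _; exact: sqr_ge0.
have kN : 0 < kappa * N%:R by rewrite mulr_gt0.
rewrite ler_pdivlMr//.
have D0 : 0 <= D by apply: le_trans h3; rewrite !mulr_ge0// ltW.
move: D0; rewrite le0r => /orP[/eqP ->|D0]; first by rewrite mul0r.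
rewrite -(ler_pM2l D0) mulrA -expr2.
apply: (@le_trans _ _ ((j - i)%:R * E * (kappa * N%:R))).
  by rewrite ler_wpM2r// ltW.
have -> : (j - i)%:R * E * (kappa * N%:R) = kappa * (N%:R * E) * (j - i)%:R.
  by ring.
exact: ler_wpM2r.
Qed.

End discrete_covariance.

(** * Discrete eigenvectors and convergence of variances *)

Section covariance_limit.
Context {R : realType}.
Local Notation mu := (circle_measure R).

(** The adjoint of the reconstruction map, see [ip_reconstruction]: a functional on L^2 becomes a
    vector. *)
Definition cell_ints (n : nat) (f : R -> R) : 'cV[R]_n.+1 :=
  \col_i ip f (cellf n i).

Definition discrete_eigenvalue (n k : nat) : R := n.+1%:R^-1 *
  (1 + n.+1%:R ^+ 2 * (2 - 2 * cos (freq k / n.+1%:R))).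

Lemma continuous_tmode k b : continuous (tmode k b : R -> R).
Proof. exact: is_derive_continuous (is_derive_tmode k b). Qed.

Lemma sqint_tmode k b : sqint (tmode k b : R -> R).
Proof. by have [s ->] := @is_trig_tmode R k b; exact: sqint_trigp. Qed.

(** Extending the cell integrals to a sequence on [nat] replaces indices modulo N by periodicity. As
    differences of a primitive at equally spaced points, they inherit the recurrence sin (x + h) +
    sin (x - h) = 2 cos h sin x, which is the eigenvector equation. *)
Lemma cell_ints_tmode n k b : exists A : nat -> R,
  [/\ forall i : 'I_n.+1, ip (tmode k b) (cellf n i) = A i,
      forall m, A (m + n.+1)%N = A m &
      forall m, A m.+2 + A m = 2 * cos (freq k / n.+1%:R) * A m.+1].
Proof.
have N0 : n.+1%:R != 0 :> R by rewrite pnatr_eq0.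
have cont := @continuous_tmode k b.
(* The mode of frequency 0 is a constant; otherwise the primitive divides by [freq k]. *)
have [->|k0] := posnP k.
  exists (fun=> cos b / n.+1%:R); split => //.
    have dF (x : R) : is_derive x (1 : R) (fun x => cos b * x) (tmode 0 b x).
      rewrite /tmode /freq !mul0r add0r.
      by rewrite -[X in is_derive _ _ _ X]mulr1; exact: is_deriveZ.
    move=> i; rewrite (ip_cellf_FTC i (@continuous_tmode 0 b) dF).
    by rewrite -mulrBr -mulrBl -natrB// subSnn mul1r.
  by move=> m; rewrite /freq !mul0r cos0; ring.
have w0 : freq k != 0 :> R.
  by rewrite gt_eqF// mulr_gt0 ?ltr0n// mulrn_wgt0// pi_gt0.
set w : R := freq k.
pose F x := w^-1 * sin (w * x + b).
have dF (x : R) : is_derive x (1 : R) F (tmode k b x).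
  have -> : tmode k b x = w^-1 * (cos (w * x + b) * w).
    by rewrite mulrCA mulVf// mulr1.
  apply: is_deriveZ.
  have -> : (fun x => sin (w * x + b)) = sin \o (fun x => w * x + b) by [].
  apply: is_derive1_comp; rewrite -[X in is_derive _ _ _ X]addr0.
  rewrite -[w in X in is_derive _ _ _ X]mulr1.
  exact: is_deriveD.
exists (fun m => F (m.+1%:R / n.+1%:R) - F (m%:R / n.+1%:R)); split.
- by move=> i; exact: ip_cellf_FTC cont dF.
- have per m : F ((m + n.+1)%:R / n.+1%:R) = F (m%:R / n.+1%:R).
    by rewrite /F natrD mulrDl divff// mulrDr mulr1 addrAC sinD2pin.
  by move=> m; rewrite -addSn !per.
- move=> m; rewrite /F -/w.
  rewrite -(natr1 m.+2) -(natr1 m.+1) -(natr1 m).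
  set x := w * (m%:R / n.+1%:R) + b; set h := w / n.+1%:R.
  have -> : w * ((m%:R + 1 + 1 + 1) / n.+1%:R) + b = x + h + h + h.
    by rewrite /x /h; field.
  have -> : w * ((m%:R + 1 + 1) / n.+1%:R) + b = x + h + h.
    by rewrite /x /h; field.
  have -> : w * ((m%:R + 1) / n.+1%:R) + b = x + h.
    by rewrite /x /h; field.
  have S3 : sin (x + h + h + h) = 2 * cos h * sin (x + h + h) - sin (x + h).
    have -> : sin (x + h) = sin (x + h + h - h) by rewrite addrK.
    by rewrite (sinD (x + h + h) h) (sinB (x + h + h) h); ring.
  have S2 : sin (x + h + h) = 2 * cos h * sin (x + h) - sin x.
    have -> : sin x = sin (x + h - h) by rewrite addrK.
    by rewrite (sinD (x + h) h) (sinB (x + h) h); ring.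
  by rewrite S3 S2; ring.
Qed.

Lemma discreteL_tmode n k b : @discreteL R n *m cell_ints n (tmode k b) =
  discrete_eigenvalue n k *: cell_ints n (tmode k b).
Proof.
have [A [AE Aper Arec]] := cell_ints_tmode n k b.
have Amod m : A (m %% n.+1)%N = A m.
  rewrite [in RHS](divn_eq m n.+1) addnC.
  by elim: (m %/ n.+1)%N => [|q IH]; rewrite ?addn0// mulSn addnCA addnC Aper.
apply/matrixP => i j; rewrite ord1 discreteLE !mxE !AE /= !Amod.
(* The cyclic predecessor of [i] is represented by [(i + n.+1).-1], a true predecessor one period
   higher; [Aper] moves the other two terms there so that the recurrence applies. *)
have -> : A i.+1 = 2 * cos (freq k / n.+1%:R) * A i - A (i + n.+1).-1.
  have -> : A i.+1 = A (i + n.+1).-1.+2 by rewrite addnS/= -Aper addSn addnS.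
  have -> : A i = A (i + n.+1).-1.+1 by rewrite addnS/= -Aper addnS.
  by rewrite -Arec addrK.
by rewrite /discrete_eigenvalue; ring.
Qed.

Lemma discrete_eigenvalue_gt0 n k : 0 < discrete_eigenvalue n k.
Proof.
rewrite mulr_gt0 ?invr_gt0 ?ltr0n// ltr_wpDr// mulr_ge0 ?sqr_ge0//.
Qed.

Lemma discrete_inv_trigp n kappa s : 0 < kappa ->
  discrete_inv kappa (cell_ints n (trigp s)) =
  cell_ints n (trigp [seq (x.1.1 / (kappa * discrete_eigenvalue n x.1.2),
    x.1.2, x.2) | x <- s]).
Proof.
move=> k0; elim: s => [|x s IH] /=.
  have -> : cell_ints n (trigp [::]) = 0.
    apply/colP => i; rewrite !mxE (_ : trigp [::] = fun=> 0) ?ip0l//.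
    by apply/funext => t; rewrite /trigp big_nil.
  by rewrite /discrete_inv mulmx0.
have consE y s' : cell_ints n (trigp (y :: s')) =
    y.1.1 *: cell_ints n (tmode y.1.2 y.2) + cell_ints n (trigp s').
  apply/colP => i; rewrite !mxE.
  have sc := @sqint_cellf R n i.
  have sm := sqint_tmode y.1.2 y.2.
  rewrite -(ipZl _ sm sc) -(ipDl (sqintZ _ sm) (sqint_trigp _) sc).
  by congr ip; apply/funext => t; rewrite /trigp big_cons.
have DE c (u v : 'cV[R]_n.+1) : discrete_inv kappa (c *: u + v) =
    c *: discrete_inv kappa u + discrete_inv kappa v.
  by rewrite /discrete_inv mulmxDr scalemxAr.
rewrite consE DE IH consE/=; congr (_ + _).
rewrite (discrete_inv_eigen k0 _ (discreteL_tmode n _ _)).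
  by rewrite scalerA.
by rewrite gt_eqF// discrete_eigenvalue_gt0.
Qed.

Lemma vec_dot_cell_ints n (f g : R -> R) : sqint f ->
  vec_dot (cell_ints n f) (cell_ints n g) = n.+1%:R^-1 * ip f (cell_proj n g).
Proof.
move=> sf; rewrite ipC ip_stepfl// mulr_sumr; apply: eq_bigr => i _.
rewrite !mxE /cell_avg (ipC f) !mulrA mulVf ?pnatr_eq0// mul1r mulrC.
by [].
Qed.

Lemma ip_cell_projC n (f g : R -> R) : sqint f -> sqint g ->
  ip f (cell_proj n g) = ip g (cell_proj n f).
Proof.
move=> sf sg; have := vec_dotC (cell_ints n f) (cell_ints n g).
rewrite (vec_dot_cell_ints n g sf) (vec_dot_cell_ints n f sg) => /mulfI; apply.
by rewrite invr_eq0 pnatr_eq0.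
Qed.

Lemma cvg_inv_natS : (n.+1%:R^-1 : R) @[n --> \oo] --> (0 : R).
Proof. exact: (@cvg_harmonic R). Qed.

(** The factor N comes from [vec_dot_cell_ints]. Since 2 - 2 cos x = 4 sin (x / 2)^2, the scaled
    eigenvalue is 1 + r^2 with r = 2 N sin (w / (2 N)), and [sin_sub_le] bounds |w - r| by w^2 / (2
    N). *)
Lemma scaled_eigenvalue_cvg k :
  n.+1%:R * discrete_eigenvalue n k @[n --> \oo] --> 1 + (freq k : R) ^+ 2.
Proof.
set w : R := freq k.
pose r (n : nat) : R := 2 * n.+1%:R * sin (w / 2 / n.+1%:R).
have -> : (fun n => n.+1%:R * discrete_eigenvalue n k) = (fun n => 1 + r n ^+ 2).
  apply/funext => n; rewrite /discrete_eigenvalue mulrA divff ?pnatr_eq0// mul1r.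
  rewrite -/w /r; congr (1 + _).
  have -> : w / n.+1%:R = (w / 2 / n.+1%:R) *+ 2.
    by rewrite -mulr_natr; field; rewrite addrC natr1 pnatr_eq0.
  by rewrite cos_mulr2n cos2sin2; ring.
apply: cvgD; first exact: cvg_cst.
suff rw : r n @[n --> \oo] --> w by rewrite expr2; exact: cvgM.
apply/cvgrPdist_le => e e0.
have h : (w ^+ 2 * n.+1%:R^-1 : R) @[n --> \oo] --> (0 : R).
  by rewrite -(mulr0 (w ^+ 2)); apply: cvgM; [exact: cvg_cst|exact: cvg_inv_natS].
have /cvgrPdist_le/(_ _ e0) := h; apply: filterS => n.
have w2 : 0 <= w ^+ 2 / n.+1%:R.
  by apply: mulr_ge0; [exact: sqr_ge0|rewrite invr_ge0].
rewrite sub0r normrN (ger0_norm w2) => we.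
apply: le_trans we.
have N0 : (0 : R) < n.+1%:R by rewrite ltr0n.
have -> : w - r n = - (2 * n.+1%:R * (sin (w / 2 / n.+1%:R) - w / 2 / n.+1%:R)).
  by rewrite /r; field; rewrite addrC natr1 gt_eqF.
rewrite normrN normrM ger0_norm ?mulr_ge0 ?(ltW N0)//.
apply: (@le_trans _ _ (2 * n.+1%:R * (w / 2 / n.+1%:R) ^+ 2)).
  by apply: ler_wpM2l; [rewrite mulr_ge0// ltW|exact: sin_sub_le].
have -> : 2 * n.+1%:R * (w / 2 / n.+1%:R) ^+ 2 = 2^-1 * (w ^+ 2 / n.+1%:R).
  by field; rewrite addrC natr1 gt_eqF.
by apply: ler_piMl => //; lra.
Qed.

Lemma ip_cell_proj_cvg (f g : R -> R) : sqint f -> sqint g ->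
  ip f (cell_proj n g) @[n --> \oo] --> ip f g.
Proof.
move=> sf sg; apply/cvgrPdist_le => e e0.
have /cvgrPdist_le : nrm f * nrm (fun t => g t - cell_proj n g t) @[n --> \oo] -->
    nrm f * 0.
  by apply: cvgM; [exact: cvg_cst|exact: cell_proj_cvg].
move=> /(_ _ e0); apply: filterS => n; rewrite mulr0 sub0r normrN.
rewrite ger0_norm ?mulr_ge0 ?nrm_ge0//; apply: le_trans.
have sp := sqint_cell_proj n g.
rewrite !(ipC f) -(ipBl sg sp sf) mulrC.
exact: ip_nrm (sqintB sg sp) sf.
Qed.

Lemma cvg_sum_seq (I T : Type) (F : set_system T) (FF : Filter F) (s : seq I)
  (u : I -> T -> R) (l : I -> R) :
  (forall i, u i n @[n --> F] --> l i) ->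
  \sum_(i <- s) u i n @[n --> F] --> \sum_(i <- s) l i.
Proof.
move=> ul; elim: s => [|i s IH].
  by under eq_fun do rewrite big_nil; rewrite big_nil; exact: cvg_cst.
by under eq_fun do rewrite big_cons; rewrite big_cons; exact: cvgD.
Qed.

Lemma discrete_variance_cvg kappa s : 0 < kappa ->
  vec_dot (cell_ints n (trigp s)) (discrete_inv kappa (cell_ints n (trigp s)))
    @[n --> \oo] --> ip (trigp s) (trigp (resolvent kappa s)).
Proof.
move=> k0; have ss := sqint_trigp s.
have -> : ip (trigp s) (trigp (resolvent kappa s)) =
    \sum_(x <- s) x.1.1 / (kappa * (1 + freq x.1.2 ^+ 2)) *
      ip (trigp s) (tmode x.1.2 x.2).
  rewrite ipC /trigp ip_suml//; last first.
    by move=> x; apply: sqintZ; exact: sqint_tmode.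
  rewrite big_map; apply: eq_bigr => x _ /=.
  by rewrite ipZl//; [rewrite (ipC (tmode _ _))|exact: sqint_tmode].
have -> : (fun n => vec_dot (cell_ints n (trigp s))
      (discrete_inv kappa (cell_ints n (trigp s)))) =
    (fun n => \sum_(x <- s) x.1.1 / (kappa * (n.+1%:R * discrete_eigenvalue n x.1.2)) *
      ip (trigp s) (cell_proj n (tmode x.1.2 x.2))).
  apply/funext => n; rewrite discrete_inv_trigp// vec_dot_cell_ints//.
  rewrite ip_cell_projC//; last exact: sqint_trigp.
  rewrite /trigp ip_suml; last 2 first.
  - by move=> x; apply: sqintZ; exact: sqint_tmode.
  - exact: sqint_cell_proj.
  rewrite big_map mulr_sumr; apply: eq_bigr => x _ /=.
  rewrite ipZl; last 2 first.
  - exact: sqint_tmode.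
  - exact: sqint_cell_proj.
  rewrite ip_cell_projC//; last exact: sqint_tmode.
  by rewrite [kappa * (n.+1%:R * _)]mulrCA [(n.+1%:R * _)^-1]invfM; ring.
apply: cvg_sum_seq => x; apply: cvgM; last first.
  by apply: ip_cell_proj_cvg => //; exact: sqint_tmode.
apply: cvgM; first exact: cvg_cst.
apply: cvgV; first by rewrite mulf_neq0// gt_eqF// ltr_wpDr// sqr_ge0.
by apply: cvgM; [exact: cvg_cst|exact: scaled_eigenvalue_cvg].
Qed.

End covariance_limit.

(** * Moments of the reconstructed measures *)

Section gaussian_measures.
Context {R : realType} {T : ptopologicalType} (dot : T -> T -> R).

Lemma continuous_measurable_borel (f : T -> R) : continuous f ->
  measurable_fun [set: borel T] f.
Proof.
move=> /continuousP cf; apply: (measurability _ (RGenOpens.measurableE R)).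
move=> _ [_ [a [b ->] <-]]; rewrite setTI.
by apply: sub_sigma_algebra; exact/cf/interval_open.
Qed.

Variables (C : T -> T) (P : probability (borel T) R).
Hypothesis Pgauss : centered_gaussian dot C P.

Lemma centered_gaussian_moment1 h : (\int[P]_x (dot h x)%:E = 0)%E.
Proof. by have [_ c _] := Pgauss; have := c h; rewrite unlock. Qed.

Lemma centered_gaussian_moment2 h :
  (\int[P]_x (dot h x ^+ 2)%:E = (dot h (C h))%:E)%E.
Proof.
have [_ c cov] := Pgauss; have := cov h h.
rewrite unlock c unlock/= => <-; apply: eq_integral => x _.
by rewrite -[dot h x]subr0 expr2.
Qed.

Lemma centered_gaussian_moment_cos h b : continuous (dot h) ->
  \int[P]_x cos (dot h x + b) =
  gaussian_cos b (Num.sqrt (dot h (C h) / standard_normal_sqr)).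
Proof.
move=> ch; have [g _ _] := Pgauss; have [m [s ms]] := g h.
apply: (centered_gaussian_cos (m := m) (s := s)) => //.
- exact: continuous_measurable_borel.
- exact: centered_gaussian_moment1.
- exact: centered_gaussian_moment2.
Qed.

End gaussian_measures.

(** * Continuity and measurability of functionals on L^2 *)

Section L2_functionals.
Context {R : realType}.
Local Notation mu := (circle_measure R).

Lemma lipschitz_continuous_L2 (g : L2circle R -> R) (c : R) :
  (forall x y, `|g x - g y| <= c * L2dist x y) -> continuous g.
Proof.
move=> gl x A /nbhs_ballP[e /= e0 eA].
suff h : nbhs x (g @^-1` A) by exact: h.
have c0 : 0 < `|c| + 1 by rewrite ltr_wpDl.
apply/nbhs_ballP; exists (e / (`|c| + 1)) => /=; first by rewrite divr_gt0.
move=> y; rewrite ballEmdist/= => xy; apply: eA.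
rewrite -ball_normE/=; apply: le_lt_trans (gl x y) _.
have d0 : 0 <= L2dist x y by rewrite L2dist_nrm nrm_ge0.
apply: le_lt_trans (_ : (`|c| + 1) * L2dist x y < e).
  by apply: ler_wpM2r => //; have := ler_norm c; lra.
by rewrite mulrC -ltr_pdivlMr.
Qed.

Lemma ip_L2_lipschitz (h : R -> R) (x y : L2circle R) : sqint h ->
  `|ip h x - ip h y| <= nrm h * L2dist x y.
Proof.
move=> sh; rewrite !(ipC h) -(ipBl (sqint_L2fun x) (sqint_L2fun y) sh) L2dist_nrm.
rewrite mulrC; apply: ip_nrm => //; apply: sqintB; exact: sqint_L2fun.
Qed.

Lemma continuous_ip_L2 (h : R -> R) : sqint h ->
  continuous (fun x : L2circle R => ip h x).
Proof.
by move=> sh; apply: (@lipschitz_continuous_L2 _ (nrm h)) => x y; exact: ip_L2_lipschitz.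
Qed.

Lemma measurable_ip_L2 (h : R -> R) : sqint h ->
  measurable_fun [set: borel (L2circle R)] (fun x : L2circle R => ip h x).
Proof. by move=> sh; apply: continuous_measurable_borel; exact: continuous_ip_L2. Qed.

Definition proj_error (n : nat) (x : L2circle R) : R :=
  nrm (fun t => x t - cell_proj n x t).

Lemma cell_projB n (f g : R -> R) t : sqint f -> sqint g ->
  cell_proj n f t - cell_proj n g t = cell_proj n (fun t => f t - g t) t.
Proof.
move=> sf sg; rewrite /cell_proj stepfB; apply: eq_bigr => m _; congr (_ * _).
by rewrite /cell_avg -mulrBr ipBl//; exact: sqint_cellf.
Qed.

(** The map f -> f - P f is linear, and it does not increase the norm by [cell_proj_best] against
    the zero step function. *)
Lemma proj_error_lipschitz n (x y : L2circle R) :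
  `|proj_error n x - proj_error n y| <= 1 * L2dist x y.
Proof.
have H (u v : L2circle R) : proj_error n u <= proj_error n v + L2dist u v.
  have su := sqint_L2fun u; have sv := sqint_L2fun v; have suv := sqintB su sv.
  have spu := sqint_cell_proj n u; have spv := sqint_cell_proj n v.
  pose d t := u t - v t.
  have spd := sqint_cell_proj n d.
  have -> : proj_error n u = nrm (fun t => (v t - cell_proj n v t) + (d t - cell_proj n d t)).
    congr nrm; apply/funext => t; rewrite -cell_projB//.
    by rewrite /d; ring.
  apply: le_trans (nrmD (sqintB sv spv) (sqintB suv spd)) _.
  rewrite lerD2l L2dist_nrm.
  apply: le_trans (cell_proj_best (fun=> 0) suv) _.
  rewrite le_eqVlt; apply/orP; left; apply/eqP; congr nrm; apply/funext => t.
  by rewrite /stepf big1 ?subr0// => m _; rewrite mul0r.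
have := H y x; have := H x y; rewrite (L2dist_sym y x) mul1r.
move: (proj_error n x) (proj_error n y) (L2dist x y) => a b d ? ?.
by rewrite ler_norml; apply/andP; split; lra.
Qed.

Lemma measurable_proj_error n :
  measurable_fun [set: borel (L2circle R)] (proj_error n).
Proof.
apply: continuous_measurable_borel.
exact: (lipschitz_continuous_L2 (proj_error_lipschitz n)).
Qed.

End L2_functionals.

Section reconstructed_measures.
Context {R : realType} (n : nat) (kappa : R).
Hypothesis kappa_gt0 : 0 < kappa.
Variable nu : probability (borel 'cV[R]_n.+1) R.
Hypothesis nu_gaussian : centered_gaussian (@vec_dot R n)
  (mulmx (invmx (kappa *: discreteL n))) nu.
Local Notation Q := (distribution nu (@reconstruction_mfun R n)).
Local Notation N := n.+1.
Implicit Types f : 'cV[R]_N.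

Lemma reconstruction_ae f :
  {ae circle_measure R, forall t, reconstruction f t = stepf (fun m => f m 0) t}.
Proof. exact: L2_ofE. Qed.

Lemma ip_reconstruction h f : sqint h ->
  ip h (reconstruction f) = vec_dot (cell_ints n h) f.
Proof.
move=> sh; rewrite ipC.
rewrite (ip_ae (sqint_L2fun _) (sqint_stepf _) sh (reconstruction_ae f)).
rewrite ip_stepfl//; apply: eq_bigr => m _; rewrite mxE (ipC h) mulrC.
by [].
Qed.

Lemma continuous_vec_dot f : continuous (vec_dot f).
Proof.
move=> w; apply: (@cvg_sum_seq R _ _ (nbhs w) (nbhs_filter w)) => i; apply: cvgM; first exact: cvg_cst.
exact: coord_continuous.
Qed.

Lemma reconstructed_moment2 h : sqint h ->
  (\int[Q]_x (ip h x ^+ 2)%:E =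
   (vec_dot (cell_ints n h) (discrete_inv kappa (cell_ints n h)))%:E)%E.
Proof.
move=> sh; rewrite ge0_integral_distribution.
- rewrite -(centered_gaussian_moment2 nu_gaussian); apply: eq_integral => f _ /=.
  by rewrite ip_reconstruction.
- by apply/measurable_EFinP; apply: measurable_funX; exact: measurable_ip_L2.
- by move=> x; rewrite lee_fin sqr_ge0.
Qed.

(** The factor N of [discrete_cov_le] cancels the 1/N of [vec_dot_cell_ints], and projecting does
    not increase the norm. Uniformity in N is what allows replacing [h] by a nearby trigonometric
    polynomial. *)
Lemma reconstructed_moment2_le h : sqint h ->
  (\int[Q]_x (ip h x ^+ 2)%:E <= (ip h h / kappa)%:E)%E.
Proof.
move=> sh; rewrite reconstructed_moment2// lee_fin.
apply: le_trans (discrete_cov_le kappa_gt0 _) _.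
rewrite (vec_dot_cell_ints n h sh) mulrACA divff ?pnatr_eq0// mul1r.
rewrite [leLHS]mulrC ler_wpM2r ?invr_ge0 ?(ltW kappa_gt0)//.
rewrite (_ : ip h (cell_proj n h) = ip (cell_proj n h) (cell_proj n h)).
  by have := nrm_cell_proj n sh; rewrite ler_sqrt ?ip_ge0.
exact: ip_cell_proj.
Qed.

Lemma reconstructed_moment_cos s b :
  \int[Q]_x cos (ip (trigp s) x + b) = gaussian_cos b (Num.sqrt
    (vec_dot (cell_ints n (trigp s)) (discrete_inv kappa (cell_ints n (trigp s)))
     / standard_normal_sqr)).
Proof.
rewrite -(centered_gaussian_moment_cos nu_gaussian _ (@continuous_vec_dot _)).
have bc : bounded_measurable (fun x : borel (L2circle R) => cos (ip (trigp s) x + b)).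
  split; last by exists 1 => x; exact: cos_max.
  rewrite (_ : (fun _ => _) = (fun z => cos (1 * z + b)) \o (fun x : L2circle R => ip (trigp s) x)).
    apply: measurableT_comp; first exact: measurable_cos_affine.
    exact: measurable_ip_L2 (sqint_trigp s).
  by apply/funext => x /=; rewrite mul1r.
rewrite /Rintegral integral_distribution.
- congr fine; apply: eq_integral => f _ /=.
  by rewrite ip_reconstruction//; exact: sqint_trigp.
- by apply/measurable_EFinP; exact: bc.1.
- apply: (@bounded_measurable_integrable _ _ _ nu (fun f => cos (ip (trigp s) (reconstruction f) + b))).
  split; last by exists 1 => x; exact: cos_max.
  exact: (measurableT_comp bc.1 (@measurable_reconstruction R n)).
Qed.

End reconstructed_measures.

(** * Overlaps of two uniform grids *)

Section grid_refinement.
Context {R : realType}.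
Local Notation mu := (circle_measure R).

Lemma ip_cellf2_ge0 n k m l : 0 <= ip (cellf n m : R -> R) (cellf k l).
Proof. by apply: Rintegral_ge0 => t _; rewrite mulr_ge0// /cellf indicE. Qed.

Lemma ip_cellf2_neq0 n k m l : ip (cellf n m : R -> R) (cellf k l) != 0 ->
  exists t : R, cell n m t /\ cell k l t.
Proof.
move=> h; apply: contrapT => H; move/eqP: h; apply.
rewrite -(@ip0l R (cellf k l)); apply: eq_Rintegral => t _.
rewrite /cellf !indicE; case/boolP: (t \in cell n m) => tm; last by rewrite !mul0r.
case/boolP: (t \in cell k l) => tl; last by rewrite !mulr0.
by exfalso; apply: H; exists t; split; exact: set_mem.
Qed.

Lemma ip_cellf2_sum n k :
  \sum_(m < n.+1) \sum_(l < k.+1) ip (cellf n m : R -> R) (cellf k l) = 1.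
Proof.
have one j : {ae mu, forall t, stepf (fun _ : 'I_j.+1 => 1) t = (1 : R)}.
  apply: circle_ae => t t0 t1; have [m tm] := cell_ex j (ltW t0) t1.
  by rewrite (stepf_cell _ tm).
have s1 := @sqint_cst R 1.
transitivity (ip (stepf (fun _ : 'I_n.+1 => 1 : R)) (stepf (fun _ : 'I_k.+1 => 1))).
  rewrite ip_stepfl; last exact: sqint_stepf.
  apply: eq_bigr => m _; rewrite mul1r ipC ip_stepfl; last exact: sqint_cellf.
  by apply: eq_bigr => l _; rewrite mul1r ipC.
rewrite (ip_ae (sqint_stepf _) s1 (sqint_stepf _) (one n)) ipC.
rewrite (ip_ae (sqint_stepf _) s1 s1 (one k)) /ip mulr1.
by rewrite Rintegral_cst// circle_measureT mul1r.
Qed.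

(** The two grids need not be nested. Almost every point lies in exactly one cell of each, and the
    weight is the length of the overlap of two cells. *)
Lemma stepf_dist_sqr n k (c : 'I_n.+1 -> R) (e : 'I_k.+1 -> R) :
  nrm (fun t => stepf c t - stepf e t) ^+ 2 =
  \sum_(m < n.+1) \sum_(l < k.+1) (c m - e l) ^+ 2 * ip (cellf n m) (cellf k l).
Proof.
pose F (m : 'I_n.+1) := stepf (fun l : 'I_k.+1 => (c m - e l) ^+ 2).
have sF m : sqint (fun t => F m t * cellf n m t).
  apply: sqint_bounded; split.
    by apply: measurable_funM; [exact: (sqint_stepf _).1|exact: measurable_cellf].
  exists (\sum_(l < k.+1) (c m - e l) ^+ 2) => t; rewrite normrM.
  rewrite -[leRHS]mulr1; apply: ler_pM => //.
    apply: le_trans (ler_norm_sum _ _ _) _; apply: ler_sum => l _.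
    rewrite normrM ger0_norm ?sqr_ge0// ler_piMr ?sqr_ge0//.
    by rewrite /cellf indicE; case: (_ \in _); rewrite ?normr1 ?normr0.
  by rewrite /cellf indicE; case: (_ \in _); rewrite ?normr1 ?normr0.
have s1 := @sqint_cst R 1.
transitivity (ip (fun t => \sum_(m < n.+1) F m t * cellf n m t) (fun=> 1)).
  rewrite sqr_nrm /ip /Rintegral; congr fine; apply: ae_eq_integral => //.
  - apply/measurable_EFinP; apply: measurable_funM;
      apply: measurable_funB; exact: (sqint_stepf _).1.
  - apply/measurable_EFinP; apply: measurable_funM => //.
    by apply: measurable_sum => m; exact: (sF m).1.
  apply: circle_ae => t t0 t1 _; congr EFin; rewrite mulr1.
  have [m tm] := cell_ex n (ltW t0) t1; have [l tl] := cell_ex k (ltW t0) t1.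
  rewrite (stepf_cell _ tm) (stepf_cell _ tl) -expr2.
  have := stepf_cell (fun m => F m t) tm; rewrite /stepf => ->.
  by rewrite /F (stepf_cell _ tl).
rewrite ip_suml//; apply: eq_bigr => m _.
transitivity (ip (F m) (cellf n m)).
  by apply: eq_Rintegral => t _; rewrite mulr1.
rewrite ip_stepfl; last exact: sqint_cellf.
by apply: eq_bigr => l _; rewrite ipC.
Qed.

(** The cell of the grid of n.+1 cells that contains the left endpoint of the [l]-th of k.+1
    cells. *)
Definition coarse_index n k (l : 'I_k.+1) : 'I_n.+1 := inord ((l * n.+1) %/ k.+1).

(** The common point [t] lies to the right of l / K, hence the order, and within 1/K of it; rounding
    to the grid of N cells costs at most 1/N more. The comparison is carried out on integers after
    clearing denominators. *)
Lemma coarse_index_le n k (m : 'I_n.+1) (l : 'I_k.+1) (t : R) :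
  cell n m t -> cell k l t -> (coarse_index n l <= m)%N /\
  (m - coarse_index n l)%:R / n.+1%:R <= k.+1%:R^-1 + n.+1%:R^-1 :> R.
Proof.
have N0 : (0 : R) < n.+1%:R by rewrite ltr0n.
have K0 : (0 : R) < k.+1%:R by rewrite ltr0n.
rewrite /cell/= !in_itv/= => /andP[m1 m2] /andP[l1 l2].
have h1 : (l * n.+1 < m.+1 * k.+1)%N.
  rewrite -(ltr_nat R) !natrM -ltr_pdivrMr// mulrAC -ltr_pdivlMr//.
  exact: le_lt_trans l1 m2.
have h2 : (m * k.+1 < l.+1 * n.+1)%N.
  rewrite -(ltr_nat R) !natrM -ltr_pdivrMr// mulrAC -ltr_pdivlMr//.
  exact: le_lt_trans m1 l2.
have q1 : ((l * n.+1) %/ k.+1 < m.+1)%N by rewrite ltn_divLR.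
have -> : coarse_index n l = ((l * n.+1) %/ k.+1)%N :> nat.
  by rewrite /coarse_index inordK//; apply: leq_trans q1 (ltn_ord m).
split; first by rewrite -ltnS.
have h3 : (l * n.+1 < ((l * n.+1) %/ k.+1).+1 * k.+1)%N by rewrite ltn_ceil.
set q := (_ %/ _)%N in q1 h3 *.
have h4 : ((m - q) * k.+1 <= k.+1 + n.+1)%N.
  rewrite mulnBl leq_subLR; apply: ltnW; apply: leq_trans h2 _.
  by rewrite mulSn addnA addnC leq_add2r addnC -mulSn ltnW.
have : (m - q)%:R * k.+1%:R <= k.+1%:R + n.+1%:R :> R.
  by rewrite -natrM -natrD ler_nat.
move: k.+1%:R n.+1%:R (m - q)%:R K0 N0 => x y z x0 y0 h.
have -> : x^-1 + y^-1 = (x + y) / x / y by field; rewrite !gt_eqF.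
by rewrite ler_wpM2r ?invr_ge0 ?(ltW y0)// ler_pdivlMr.
Qed.

End grid_refinement.

(** * The projection error, uniformly in N *)

Section reconstructed_projection.
Context {R : realType} (n : nat) (kappa : R).
Hypothesis kappa_gt0 : 0 < kappa.
Variable nu : probability (borel 'cV[R]_n.+1) R.
Hypothesis nu_gaussian : centered_gaussian (@vec_dot R n)
  (mulmx (invmx (kappa *: discreteL n))) nu.
Local Notation Q := (distribution nu (@reconstruction_mfun R n)).

(** Averages are replaced by samples at [coarse_index], at no loss by [cell_proj_best]; the error is
    then a weighted sum of squared increments, to which [discrete_cov_increment] applies. *)
Lemma proj_error_reconstruction k (f : 'cV[R]_n.+1) :
  proj_error k (reconstruction f) ^+ 2 <=
  \sum_(m < n.+1) \sum_(l < k.+1)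
    (f m 0 - f (coarse_index n l) 0) ^+ 2 * ip (cellf n m) (cellf k l).
Proof.
rewrite -stepf_dist_sqr lerXn2r ?nnegrE ?nrm_ge0//.
have sr := sqint_L2fun (reconstruction f).
apply: le_trans (cell_proj_best (fun l => f (coarse_index n l) 0) sr) _.
rewrite le_eqVlt; apply/orP; left; apply/eqP; apply: nrm_ae.
- by apply: sqintB => //; exact: sqint_stepf.
- by apply: sqintB => //; exact: sqint_stepf.
- by apply: circle_aeS (reconstruction_ae f) => t ->.
Qed.

Lemma reconstructed_proj_error k :
  (\int[Q]_x (proj_error k x ^+ 2)%:E <=
   ((k.+1%:R^-1 + n.+1%:R^-1) / kappa)%:E)%E.
Proof.
set c := (_ / kappa).
have mpe := @measurable_proj_error R k.
rewrite ge0_integral_distribution; last 2 first.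
- by apply/measurable_EFinP; exact: measurable_funX.
- by move=> x; rewrite lee_fin sqr_ge0.
pose a (m : 'I_n.+1) (l : 'I_k.+1) : 'cV[R]_n.+1 :=
  delta_mx m 0 - delta_mx (coarse_index n l) 0.
have aE m l f : vec_dot (a m l) f = f m 0 - f (coarse_index n l) 0.
  have dE (j : 'I_n.+1) : vec_dot (delta_mx j 0) f = f j 0.
    rewrite /vec_dot (bigD1 j)//= mxE !eqxx mul1r big1 ?addr0// => i /negbTE ij.
    by rewrite mxE ij mul0r.
  rewrite -!dE /vec_dot -sumrB; apply: eq_bigr => i _.
  by rewrite !mxE mulrBl.
have md m l : measurable_fun [set: borel 'cV[R]_n.+1]
    (fun f : 'cV[R]_n.+1 => (vec_dot (a m l) f ^+ 2)%:E).
  apply/measurable_EFinP; apply: measurable_funX.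
  by apply: continuous_measurable_borel; exact: continuous_vec_dot.
have w0 (m : 'I_n.+1) (l : 'I_k.+1) : 0 <= ip (cellf n m : R -> R) (cellf k l).
  exact: ip_cellf2_ge0.
apply: (@le_trans _ _ (\int[nu]_f \sum_(m < n.+1) \sum_(l < k.+1)
    ((ip (cellf n m) (cellf k l))%:E * (vec_dot (a m l) f ^+ 2)%:E))%E).
  apply: ge0_le_integral => //.
  - by move=> f _; rewrite lee_fin sqr_ge0.
  - apply/measurable_EFinP; apply: measurable_funX.
    exact: (measurableT_comp mpe (@measurable_reconstruction R n)).
  - apply: emeasurable_sum => m; apply: emeasurable_sum => l.
    exact: emeasurable_funM.
  - move=> f _ /=.
    under eq_bigr do under eq_bigr do rewrite -EFinM.
    under eq_bigr do rewrite sumEFin.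
    rewrite sumEFin lee_fin; apply: le_trans (proj_error_reconstruction _ _) _.
    rewrite le_eqVlt; apply/orP; left; apply/eqP.
    by apply: eq_bigr => m _; apply: eq_bigr => l _; rewrite aE mulrC.
rewrite ge0_integral_sum//; last 2 first.
- by move=> m; apply: emeasurable_sum => l; exact: emeasurable_funM.
- by move=> m f _; apply: sume_ge0 => l _; rewrite -EFinM lee_fin mulr_ge0// sqr_ge0.
have -> : (c%:E = \sum_(m < n.+1) \sum_(l < k.+1)
    (c * ip (cellf n m) (cellf k l))%:E)%E.
  under eq_bigr do rewrite sumEFin -mulr_sumr.
  by rewrite sumEFin -mulr_sumr ip_cellf2_sum mulr1.
apply: lee_sum => m _; rewrite ge0_integral_sum//; last 2 first.
- by move=> l; exact: emeasurable_funM.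
- by move=> l f _; rewrite -EFinM lee_fin mulr_ge0// sqr_ge0.
apply: lee_sum => l _.
rewrite ge0_integralZl_EFin//; last first.
  by move=> f _; rewrite lee_fin sqr_ge0.
rewrite (centered_gaussian_moment2 nu_gaussian) -EFinM lee_fin.
(* Only pairs of overlapping cells carry weight, and for these the two indices are close. *)
have [->|wn0] := eqVneq (ip (cellf n m : R -> R) (cellf k l)) 0.
  by rewrite mul0r mulr0.
rewrite mulrC ler_wpM2r//.
have [t [tm tl]] := ip_cellf2_neq0 wn0.
have [cm cle] := coarse_index_le tm tl.
apply: le_trans (discrete_cov_increment kappa_gt0 cm erefl) _.
by rewrite /c (mulrC kappa) invfM mulrA ler_wpM2r// invr_ge0 ltW.
Qed.

End reconstructed_projection.

(** * Convergence of expectations *)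

Lemma le_integral_norm_affine_sqr d (T : measurableType d) (R : realType)
    (P : probability T R) (f X : T -> R) (a D V : R) :
  measurable_fun setT f -> measurable_fun setT X -> 0 <= a -> 0 <= D ->
  (forall x, `|f x| <= a * X x ^+ 2 + D) ->
  (\int[P]_x (X x ^+ 2)%:E <= V%:E)%E ->
  (\int[P]_x `|f x|%:E <= (a * V + D)%:E)%E.
Proof.
move=> mf mX a0 D0 fX XV.
have mX2 : measurable_fun setT (fun x => (X x ^+ 2)%:E).
  by apply/measurable_EFinP; exact: measurable_funX.
apply: (@le_trans _ _ (\int[P]_x (a%:E * (X x ^+ 2)%:E + D%:E))%E).
  apply: ge0_le_integral => //.
  - by apply/measurable_EFinP; exact: measurableT_comp.
  - by apply: emeasurable_funD => //; exact: emeasurable_funM.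
  - by move=> x _; rewrite -EFinM -EFinD lee_fin.
rewrite ge0_integralD//.
- rewrite integral_cst// [X in (_ + _ * X)%E]probability_setT mule1.
  rewrite ge0_integralZl_EFin//; last by move=> x _; rewrite lee_fin sqr_ge0.
  by rewrite EFinD leeD2r// EFinM lee_wpmul2l// lee_fin.
- by move=> x _; rewrite -EFinM lee_fin mulr_ge0// sqr_ge0.
- exact: emeasurable_funM.
Qed.

Section trig_closure.
Context {R : realType}.

Definition trig_closure (h : R -> R) :=
  sqint h /\ forall e, 0 < e -> exists s, nrm (fun t => h t - trigp s t) <= e.

Lemma trig_closureD f g : trig_closure f -> trig_closure g ->
  trig_closure (fun t => f t + g t).
Proof.
move=> [sf tf] [sg tg]; split=> [|e e0]; first exact: sqintD.
have e20 : 0 < e / 2 by rewrite divr_gt0.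
have [s hs] := tf _ e20; have [s' hs'] := tg _ e20.
exists (s ++ s'); rewrite (splitr e); apply: le_trans (lerD hs hs').
apply: le_trans (nrmD (sqintB sf (sqint_trigp s)) (sqintB sg (sqint_trigp s'))).
rewrite le_eqVlt; apply/orP; left; apply/eqP; congr nrm; apply/funext => t.
by rewrite /trigp big_cat/=; ring.
Qed.

Lemma trig_closureZ a f : trig_closure f -> trig_closure (fun t => a * f t).
Proof.
move=> [sf tf]; split=> [|e e0]; first exact: sqintZ.
have a0 : 0 < `|a| + 1 by rewrite ltr_wpDl.
have [s hs] := tf _ (divr_gt0 e0 a0).
have [s' es'] := @is_trigZ R a (trigp s) (ex_intro _ s erefl).
exists s'; rewrite -es'.
have -> : (fun t => a * f t - a * trigp s t) = (fun t => a * (f t - trigp s t)).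
  by apply/funext => t; rewrite mulrBr.
rewrite nrmZ; last exact: sqintB sf (sqint_trigp s).
apply: (@le_trans _ _ ((`|a| + 1) * (e / (`|a| + 1)))); last first.
  by rewrite mulrC divfK// gt_eqF.
by apply: ler_pM; rewrite ?nrm_ge0// lerDl.
Qed.

Lemma trig_closure_cellf n (m : 'I_n.+1) : trig_closure (cellf n m).
Proof.
by split=> [|e e0]; [exact: sqint_cellf|exact: trig_approx_cellf].
Qed.

Lemma trig_closure0 : trig_closure (fun=> 0).
Proof.
split=> [|e e0]; first exact: sqint_cst.
exists [::]; rewrite (_ : (fun _ => _) = fun=> 0); last first.
  by apply/funext => t; rewrite /trigp big_nil subr0.
by rewrite /nrm ip0l sqrtr0 ltW.
Qed.

End trig_closure.

(** * From cosines to functions of finitely many functionals *)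

Section cosine_convergence.
Context {R : realType}.
Local Notation L2 := (L2circle R).
Variables (P_ : nat -> probability (borel L2) R) (P : probability (borel L2) R).
Variable c0 : R.
Hypothesis c0_ge0 : 0 <= c0.
Hypothesis moment2_ : forall n h, sqint h ->
  (\int[P_ n]_x (ip h x ^+ 2)%:E <= (c0 * ip h h)%:E)%E.
Hypothesis moment2 : forall h, sqint h -> exists v : R,
  (\int[P]_x (ip h x ^+ 2)%:E <= v%:E)%E.
Hypothesis cos_trigp_cvg : forall s b,
  \int[P_ n]_x cos (ip (trigp s) x + b) @[n --> \oo] -->
  \int[P]_x cos (ip (trigp s) x + b).

Lemma bounded_measurable_cos_ip h b : sqint h ->
  bounded_measurable (fun x : borel L2 => cos (ip h x + b)).
Proof.
move=> sh; split; last by exists 1 => x; exact: cos_max.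
rewrite (_ : (fun _ => _) = (fun z => cos (1 * z + b)) \o (fun x : L2 => ip h x)).
  by apply: measurableT_comp; [exact: measurable_cos_affine|exact: measurable_ip_L2].
by apply/funext => x /=; rewrite mul1r.
Qed.

(** The cosine is 1-Lipschitz, so replacing [h] by a trigonometric polynomial costs at most the mean
    of |(h - s, x)|: small under all [P_ n] at once by [moment2_], and under [P] by dominated
    convergence. *)
Lemma cos_ip_cvg h b : trig_closure h ->
  \int[P_ n]_x cos (ip h x + b) @[n --> \oo] --> \int[P]_x cos (ip h x + b).
Proof.
move=> [sh th].
have [s_ s_h] : exists s_ : nat -> seq (R * nat * R),
    forall j, nrm (fun t => h t - trigp (s_ j) t) <= j.+1%:R^-1.
  have H j : exists s, nrm (fun t => h t - trigp s t) <= j.+1%:R^-1.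
    by apply: th; rewrite invr_gt0 ltr0n.
  by exists (fun j => projT1 (cid (H j))) => j; exact: (projT2 (cid (H j))).
have ipS j (x : L2) : `|ip h x - ip (trigp (s_ j)) x| <= j.+1%:R^-1 * nrm x.
  rewrite -(ipBl sh (sqint_trigp _) (sqint_L2fun x)).
  apply: le_trans (ip_nrm (sqintB sh (sqint_trigp _)) (sqint_L2fun x)) _.
  by apply: ler_wpM2r => //; exact: nrm_ge0.
have PS : \int[P]_x cos (ip (trigp (s_ j)) x + b) @[j --> \oo] -->
    \int[P]_x cos (ip h x + b).
  apply: (bounded_cvg_Rintegral (M := 1)).
  - by move=> j; exact: (bounded_measurable_cos_ip _ (sqint_trigp _)).1.
  - exact: (bounded_measurable_cos_ip _ sh).1.
  - by move=> j x; exact: cos_max.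
  - apply: aeW => x; apply: (@cvg_comp _ _ _ (fun j => ip (trigp (s_ j)) x + b)
      cos _ (nbhs (ip h x + b))); last exact: continuous_cos.
    apply: cvgD; last exact: cvg_cst.
    apply/cvgrPdist_le => e e0.
    have /cvgrPdist_le/(_ _ e0) : (j.+1%:R^-1 * nrm x : R) @[j --> \oo] --> 0 * nrm x.
      by apply: cvgM; [exact: cvg_inv_natS|exact: cvg_cst].
    apply: filterS => j; rewrite mul0r sub0r normrN ger0_norm; last first.
      by rewrite mulr_ge0 ?nrm_ge0// invr_ge0.
    exact: le_trans (ipS j x).
apply/cvgrPdist_le => e e0.
(* One quarter is spent under [P], two under [P_ n] through [le_integral_norm_sqr], and one on the
   convergence for the trigonometric polynomial. *)
have e40 : 0 < e / 4 by rewrite divr_gt0.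
have hj : (c0 * j.+1%:R^-1 * j.+1%:R^-1 / (e / 4) : R) @[j --> \oo] -->
    c0 * 0 * 0 / (e / 4).
  apply: cvgM; last exact: cvg_cst.
  apply: cvgM; last exact: cvg_inv_natS.
  by apply: cvgM; [exact: cvg_cst|exact: cvg_inv_natS].
have [j [j1 j2]] : exists j,
    `|\int[P]_x cos (ip h x + b) - \int[P]_x cos (ip (trigp (s_ j)) x + b)| <= e / 4 /\
    c0 * j.+1%:R^-1 * j.+1%:R^-1 / (e / 4) <= e / 4.
  near \oo => j; exists j; split; near: j.
    by move/cvgrPdist_le: PS => /(_ _ e40).
  move/cvgrPdist_le: hj => /(_ _ e40); apply: filterS => j.
  rewrite !(mulr0, mul0r) sub0r normrN; apply: le_trans; exact: ler_norm.
have /cvgrPdist_le/(_ _ e40) := @cos_trigp_cvg (s_ j) b; apply: filterS => n hn.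
have sd := sqintB sh (sqint_trigp (s_ j)).
have bh := bounded_measurable_cos_ip b sh.
have bs := bounded_measurable_cos_ip b (sqint_trigp (s_ j)).
have : `|\int[P_ n]_x cos (ip h x + b) - \int[P_ n]_x cos (ip (trigp (s_ j)) x + b)|
    <= e / 4 + e / 4.
  apply: (Rintegral_dist_le (P := P_ n)) => //.
  apply: (@le_trans _ _ (\int[P_ n]_x `|ip (fun t => h t - trigp (s_ j) t) x|%:E)%E).
    apply: ge0_le_integral => //.
    - apply/measurable_EFinP; apply: measurableT_comp => //.
      exact: (bounded_measurableB bh bs).1.
    - apply/measurable_EFinP; apply: measurableT_comp => //.
      exact: measurable_ip_L2.
    - move=> x _; rewrite lee_fin; apply: le_trans (ler_norm_cosB _ _) _.
      rewrite (ipBl sh (sqint_trigp _) (sqint_L2fun x)).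
      by rewrite [X in `|X| <= _](_ : _ = ip h x - ip (trigp (s_ j)) x)//; ring.
  apply: le_trans (le_integral_norm_sqr _ e40 (moment2_ n sd)) _.
    exact: measurable_ip_L2.
  rewrite lee_fin lerD2l; apply: le_trans j2.
  apply: ler_wpM2r; first by rewrite invr_ge0 ltW.
  rewrite -mulrA; apply: ler_wpM2l => //.
  by rewrite -sqr_nrm expr2; apply: ler_pM; rewrite ?nrm_ge0.
move: hn j1.
move: (\int[P]_x cos (ip h x + b)) (\int[P]_x cos (ip (trigp (s_ j)) x + b))
  (\int[P_ n]_x cos (ip h x + b)) (\int[P_ n]_x cos (ip (trigp (s_ j)) x + b)).
move=> A B C D; rewrite !ler_norml => /andP[? ?] /andP[? ?] /andP[? ?].
by apply/andP; split; lra.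
Unshelve. all: by end_near.
Qed.

(* Testing against all cosines makes this class stable under products with
   cosines, which convergence of the expectations of [g] alone is not. *)
Definition cos_stable (g : L2 -> R) :=
  bounded_measurable (g : borel L2 -> R) /\
  forall h b, trig_closure h ->
    \int[P_ n]_x (g x * cos (ip h x + b)) @[n --> \oo] -->
    \int[P]_x (g x * cos (ip h x + b)).

Let bmi d (T : measurableType d) (p : probability T R) :=
  @bounded_measurable_integrable d T R p.

Lemma cos_stable_cst c : cos_stable (fun=> c).
Proof.
split=> [|h b th]; first exact: bounded_measurable_cst.
have E (p : probability (borel L2) R) :
    \int[p]_x (c * cos (ip h x + b)) = c * \int[p]_x cos (ip h x + b).
  by rewrite RintegralZl//; apply: bmi; apply: bounded_measurable_cos_ip; exact: th.1.
under eq_fun do rewrite E.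
by rewrite E; apply: cvgM; [exact: cvg_cst|exact: cos_ip_cvg].
Qed.

Lemma cos_stableD f g : cos_stable f -> cos_stable g -> cos_stable (fun x => f x + g x).
Proof.
move=> [bf cf] [bg cg]; split=> [|h b th]; first exact: bounded_measurableD.
have bc := bounded_measurable_cos_ip b th.1.
have E (p : probability (borel L2) R) :
    \int[p]_x ((f x + g x) * cos (ip h x + b)) =
    \int[p]_x (f x * cos (ip h x + b)) + \int[p]_x (g x * cos (ip h x + b)).
  rewrite -RintegralD//; [|exact: bmi (bounded_measurableM _ _)..].
  by apply: eq_Rintegral => x _; rewrite mulrDl.
under eq_fun do rewrite E.
by rewrite E; apply: cvgD; [exact: cf|exact: cg].
Qed.

Lemma cos_stableZ a f : cos_stable f -> cos_stable (fun x => a * f x).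
Proof.
move=> [bf cf]; split=> [|h b th].
  by apply: (@bounded_measurableM _ (borel L2) R (cst a) f) => //;
    exact: bounded_measurable_cst.
have bc := bounded_measurable_cos_ip b th.1.
have E (p : probability (borel L2) R) :
    \int[p]_x (a * f x * cos (ip h x + b)) =
    a * \int[p]_x (f x * cos (ip h x + b)).
  rewrite -RintegralZl//; last exact: bmi (bounded_measurableM _ _).
  by apply: eq_Rintegral => x _; rewrite mulrA.
under eq_fun do rewrite E.
by rewrite E; apply: cvgM; [exact: cvg_cst|exact: cf].
Qed.

Lemma cos_stable_cosM f h b : trig_closure h -> cos_stable f ->
  cos_stable (fun x => f x * cos (ip h x + b)).
Proof.
move=> th [bf cf]; split=> [|h' b' th'].
  exact: bounded_measurableM bf (bounded_measurable_cos_ip b th.1).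
pose hp t := h t + h' t; pose hm t := h t + (-1) * h' t.
have tN := trig_closureZ (-1) th'.
have tp : trig_closure hp by exact: trig_closureD.
have tm : trig_closure hm by exact: trig_closureD.
have E (p : probability (borel L2) R) :
    \int[p]_x (f x * cos (ip h x + b) * cos (ip h' x + b')) =
    2^-1 * \int[p]_x (f x * cos (ip hp x + (b + b'))) +
    2^-1 * \int[p]_x (f x * cos (ip hm x + (b - b'))).
  have bp := bounded_measurableM bf (bounded_measurable_cos_ip (b + b') tp.1).
  have bm := bounded_measurableM bf (bounded_measurable_cos_ip (b - b') tm.1).
  rewrite -!RintegralZl//; [|exact: bmi..].
  have c2 : bounded_measurable (cst 2^-1 : borel L2 -> R).
    exact: bounded_measurable_cst.
  have ip2 := bmi p (bounded_measurableM c2 bp).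
  have im2 := bmi p (bounded_measurableM c2 bm).
  rewrite -RintegralD//.
  apply: eq_Rintegral => x _; have sx := sqint_L2fun x.
  rewrite /hp /hm (ipDl th.1 th'.1 sx) (ipDl th.1 tN.1 sx) (ipZl _ th'.1 sx).
  rewrite (_ : ip h x + ip h' x + (b + b') = (ip h x + b) + (ip h' x + b')); last by ring.
  rewrite (_ : ip h x + -1 * ip h' x + (b - b') = (ip h x + b) - (ip h' x + b')); last by ring.
  move: (ip h x + b) (ip h' x + b') => A B.
  by rewrite (cosD A B) (cosB A B); field.
under eq_fun do rewrite E.
rewrite E; apply: cvgD; apply: cvgM; try exact: cvg_cst; exact: cf.
Qed.

(** The values at the nodes may themselves depend on [x]; [cos_stable_phi_rank] inserts functions of
    lower rank there. *)
Lemma cos_stable_bern m (F : nat -> L2 -> R) h b y : trig_closure h ->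
  (forall j, cos_stable (F j)) ->
  cos_stable (fun x => bern m (F^~ x) ((1 + cos (ip h x + b)) / 2) y).
Proof.
move=> th mF; elim: m y => [|m IH] y /=; first exact: mF.
set G := fun y x => bern m (F^~ x) ((1 + cos (ip h x + b)) / 2) y.
have -> : (fun x : L2 => (1 + cos (ip h x + b)) / 2 * G y.+1 x +
    (1 - (1 + cos (ip h x + b)) / 2) * G y x) =
    (fun x : L2 => (2^-1 * G y.+1 x + 2^-1 * (G y.+1 x * cos (ip h x + b))) +
      (2^-1 * G y x + - 2^-1 * (G y x * cos (ip h x + b)))).
  by apply/funext => x; field.
by apply: cos_stableD; apply: cos_stableD; apply: cos_stableZ;
  do ?[apply: cos_stable_cosM => //]; exact: IH.
Qed.

Lemma cos_stable_approx g : bounded_measurable (g : borel L2 -> R) ->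
  (forall e, 0 < e -> exists2 g', cos_stable g' &
    (forall n, (\int[P_ n]_x `|g x - g' x|%:E <= e%:E)%E) /\
    (\int[P]_x `|g x - g' x|%:E <= e%:E)%E) ->
  cos_stable g.
Proof.
move=> bg H; split=> // h b th; apply/cvgrPdist_le => e e0.
have e30 : 0 < e / 3 by rewrite divr_gt0.
have [g' [bg' cg'] [Hn H0]] := H _ e30.
have bc := bounded_measurable_cos_ip b th.1.
have K (p : probability (borel L2) R) :
    (\int[p]_x `|g x - g' x|%:E <= (e / 3)%:E)%E ->
    `|\int[p]_x (g x * cos (ip h x + b)) - \int[p]_x (g' x * cos (ip h x + b))|
      <= e / 3.
  move=> hp; apply: Rintegral_dist_le; [exact: bounded_measurableM..|].
  apply: le_trans hp; apply: ge0_le_integral => //.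
  - apply/measurable_EFinP; apply: measurableT_comp => //.
    exact: (bounded_measurableB (bounded_measurableM bg bc) (bounded_measurableM bg' bc)).1.
  - apply/measurable_EFinP; apply: measurableT_comp => //.
    exact: (bounded_measurableB bg bg').1.
  - move=> x _; rewrite lee_fin -mulrBl normrM ler_piMr//; exact: cos_max.
have /cvgrPdist_le/(_ _ e30) := cg' h b th; apply: filterS => n.
have := K _ (Hn n); have := K _ H0.
move: (\int[P]_x (g x * cos (ip h x + b))) (\int[P]_x (g' x * cos (ip h x + b)))
  (\int[P_ n]_x (g x * cos (ip h x + b))) (\int[P_ n]_x (g' x * cos (ip h x + b))).
move=> A B C D; rewrite !ler_norml => /andP[? ?] /andP[? ?] /andP[? ?].
by apply/andP; split; lra.
Qed.

Lemma cos_stable_cvg g : cos_stable g ->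
  \int[P_ n]_x g x @[n --> \oo] --> \int[P]_x g x.
Proof.
move=> [_ /(_ (fun=> 0) 0 trig_closure0)].
have E (p : probability (borel L2) R) :
    \int[p]_x (g x * cos (ip (fun=> 0) x + 0)) = \int[p]_x g x.
  by apply: eq_Rintegral => x _; rewrite ip0l addr0 cos0 mulr1.
by under eq_fun do rewrite E; rewrite E.
Qed.

Definition finite_rank (h e : nat -> R -> R) (K : nat) (x : L2) (t : R) : R :=
  \sum_(k < K) ip (h k) x * e k t.

Lemma sqint_finite_rank h e K x : (forall k, sqint (e k)) ->
  sqint (finite_rank h e K x).
Proof. by move=> se; apply: sqint_sum => k; exact: sqintZ. Qed.

Lemma finite_rank_lipschitz h e K : (forall k, sqint (h k)) ->
  (forall k, sqint (e k)) -> exists c, forall x y : L2,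
  nrm (fun t => finite_rank h e K x t - finite_rank h e K y t) <= c * L2dist x y.
Proof.
move=> sh se; elim: K => [|K [c IH]].
  exists 0 => x y; rewrite mul0r (_ : (fun _ => _) = fun=> 0); last first.
    by apply/funext => t; rewrite /finite_rank !big_ord0 subrr.
  by rewrite /nrm ip0l sqrtr0.
exists (c + nrm (h K) * nrm (e K)) => x y.
have -> : (fun t => finite_rank h e K.+1 x t - finite_rank h e K.+1 y t) =
    (fun t => (finite_rank h e K x t - finite_rank h e K y t) +
      (ip (h K) x - ip (h K) y) * e K t).
  by apply/funext => t; rewrite /finite_rank !big_ord_recr/=; ring.
have sx := sqint_finite_rank h K x se; have sy := sqint_finite_rank h K y se.
apply: le_trans (nrmD (sqintB sx sy) (sqintZ _ (se K))) _.
rewrite mulrDl lerD// nrmZ// mulrAC ler_wpM2r ?nrm_ge0//.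
exact: ip_L2_lipschitz.
Qed.

Variables (phi : L2 -> R) (Lp B : R).
Hypothesis phi_lip : forall x y, `|phi x - phi y| <= Lp * L2dist x y.
Hypothesis phi_bound : forall x, `|phi x| <= B.

Let phi_lip' x y : `|phi x - phi y| <= `|Lp| * L2dist x y.
Proof.
apply: le_trans (phi_lip x y) _; apply: ler_wpM2r; last exact: ler_norm.
by rewrite L2dist_nrm nrm_ge0.
Qed.

(** The offset [v] lets the induction on the rank absorb a coordinate frozen at a node. *)
Definition phi_rank h e K v (x : L2) : R :=
  phi (mkL2 (fun t => v t + finite_rank h e K x t)).

Lemma bounded_measurable_phi_rank h e K v : (forall k, sqint (h k)) ->
  (forall k, sqint (e k)) -> sqint v ->
  bounded_measurable (phi_rank h e K v : borel L2 -> R).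
Proof.
move=> sh se sv; split; last by exists B => x; exact: phi_bound.
apply: continuous_measurable_borel.
have [c hc] := finite_rank_lipschitz K sh se.
apply: (@lipschitz_continuous_L2 _ _ (`|Lp| * c)) => x y.
apply: le_trans (phi_lip' _ _) _; rewrite -mulrA; apply: ler_wpM2l => //.
have sx := sqint_finite_rank h K x se; have sy := sqint_finite_rank h K y se.
rewrite (L2dist_mkL2 (sqintD sv sx) (sqintD sv sy)); apply: le_trans (hc x y).
rewrite le_eqVlt; apply/orP; left; apply/eqP; congr nrm; apply/funext => t.
by ring.
Qed.

(* One coordinate at a time: in the last coordinate [X] replace [phi] by its
   Bernstein polynomial in [(1 + sin (X / L)) / 2] with nodes [L (2 j / m - 1)]. *)
Lemma cos_stable_phi_rank h e K v : (forall k, trig_closure (h k)) ->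
  (forall k, sqint (e k)) -> sqint v -> cos_stable (phi_rank h e K v).
Proof.
move=> th se; have sh k : sqint (h k) := (th k).1.
elim: K v => [|K IH] v sv.
  have -> : phi_rank h e 0 v = fun=> phi (mkL2 v).
    apply/funext => x; rewrite /phi_rank; congr (phi (mkL2 _)); apply/funext => t.
    by rewrite /finite_rank big_ord0 addr0.
  exact: cos_stable_cst.
have bG := bounded_measurable_phi_rank K.+1 sh se sv.
apply: cos_stable_approx => // eps eps0.
have [V0 hV0] := moment2 (sh K).
pose V := Num.max 0 (Num.max V0 (c0 * ip (h K) (h K))).
have V_ge0 : 0 <= V by rewrite /V le_max lexx.
have hV : (\int[P]_x (ip (h K) x ^+ 2)%:E <= V%:E)%E.
  by apply: le_trans hV0 _; rewrite lee_fin /V !le_max lexx orbT.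
have hVn n : (\int[P_ n]_x (ip (h K) x ^+ 2)%:E <= V%:E)%E.
  by apply: le_trans (moment2_ n (sh K)) _; rewrite lee_fin /V !le_max lexx !orbT.
pose C := `|Lp| * nrm (e K).
have C0 : 0 <= C by rewrite mulr_ge0 ?nrm_ge0.
(* Error budget: [L] makes the truncation error C V / L at most eps / 2, [de] makes the term 2 C L
   de at most eps / 4, and then [m] makes the variance term 2 C L / (m de) at most eps / 4. The
   added 1 keeps the divisors positive. *)
pose L := 2 * (C * V + 1) / eps.
have L0 : 0 < L by rewrite divr_gt0// mulr_gt0// ltr_wpDl// mulr_ge0.
pose de := eps / (8 * L * (C + 1)).
have C10 : 0 < C + 1 by rewrite ltr_wpDl.
have de0 : 0 < de by apply: divr_gt0 => //; apply: mulr_gt0 => //; exact: mulr_gt0.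
have [m m0 hm] : exists2 m : nat, (0 < m)%N & (8 * L * (C + 1)) / (eps * de) <= m%:R.
  near \oo => m; exists m; near: m; [exact: nbhs_infty_gt|exact: nbhs_infty_ger].
have mR : (0 : R) < m%:R by rewrite ltr0n.
have CV0 : 0 <= C * V by rewrite mulr_ge0.
have e1 : C / L * V <= eps / 2.
  have CV1 : 0 < C * V + 1 by rewrite ltr_wpDl.
  have -> : C / L * V = (C * V / (C * V + 1)) * (eps / 2).
    by rewrite /L; field; rewrite !gt_eqF.
  by apply: ler_piMl; [rewrite divr_ge0// ltW|rewrite ler_pdivrMr// mul1r lerDl].
have e2 : C * (2 * L * de) <= eps / 4.
  have -> : C * (2 * L * de) = (C / (C + 1)) * (eps / 4).
    by rewrite /de; field; rewrite !gt_eqF.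
  by apply: ler_piMl; [rewrite divr_ge0// ltW|rewrite ler_pdivrMr// mul1r lerDl].
clearbody de L.
pose y (j : nat) : R := L * (2 * (j%:R / m%:R) - 1).
pose F j := phi_rank h e K (fun t => v t + y j * e K t).
(* The phase - pi / 2 turns the cosine into the sine of X / L. *)
pose p (x : L2) := (1 + cos (ip (fun t => L^-1 * h K t) x + - (pi / 2))) / 2.
have tL : trig_closure (fun t => L^-1 * h K t) by exact: trig_closureZ.
have mg : cos_stable (fun x => bern m (F^~ x) (p x) 0).
  by apply: cos_stable_bern => // j; apply: IH; apply: sqintD => //; exact: sqintZ.
exists (fun x => bern m (F^~ x) (p x) 0) => //.
have pE x : p x = (1 + sin (ip (h K) x / L)) / 2.
  rewrite /p (ipZl _ (sh K) (sqint_L2fun x)) cosBpihalf.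
  by rewrite (mulrC L^-1).
have key x : `|phi_rank h e K.+1 v x - bern m (F^~ x) (p x) 0| <=
    C / L * ip (h K) x ^+ 2 + C * (2 * L * (de + m%:R^-1 / de)).
  set X := ip (h K) x.
  have p01 : 0 <= p x <= 1.
    rewrite pE; have := sin_geN1 (X / L); have := sin_le1 (X / L).
    by move=> ? ?; apply/andP; split; rewrite -/X; lra.
  rewrite -(bern_cst m (phi_rank h e K.+1 v x) (p x) 0) -bernB.
  apply: le_trans (ler_norm_bern _ _ _ p01) _.
  have -> : C / L * X ^+ 2 + C * (2 * L * (de + m%:R^-1 / de)) =
      (C / L * X ^+ 2 + C * (2 * L * de)) + (C * (2 * L / de)) * m%:R^-1.
    by field; rewrite !gt_eqF.
  apply: (@le_trans _ _ (bern m (fun j => (C / L * X ^+ 2 + C * (2 * L * de)) +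
      (C * (2 * L / de)) * (j%:R / m%:R - p x) ^+ 2) (p x) 0)); last first.
    rewrite bernD bern_cst bernZ lerD2l ler_wpM2l ?bern_variance//.
    by rewrite mulr_ge0// divr_ge0 ?(ltW de0)// mulr_ge0// ltW.
  apply: le_bern => // j; set q := j%:R / m%:R.
  have step : `|phi_rank h e K.+1 v x - F j x| <= C * `|X - y j|.
    apply: le_trans (phi_lip' _ _) _; rewrite /C -mulrA ler_wpM2l//.
    have sK := sqint_finite_rank h K x se; have sK1 := sqint_finite_rank h K.+1 x se.
    have sy := sqintD sv (sqintZ (y j) (se K)).
    rewrite (L2dist_mkL2 (sqintD sv sK1) (sqintD sy sK)) mulrC -nrmZ//.
    rewrite le_eqVlt; apply/orP; left; apply/eqP; congr nrm; apply/funext => t.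
    by rewrite /finite_rank big_ord_recr/= -/X; ring.
  apply: le_trans step _.
  (* Since L sin (X / L) = L (2 p - 1) and the node is L (2 q - 1), the distance splits into a
     truncation error, quadratic in X, and the deviation of q from its mean p. *)
  have Xy : `|X - y j| <= L^-1 * X ^+ 2 + 2 * L * `|q - p x|.
    have -> : X - y j = - (L * (sin (X / L) - X / L)) - 2 * L * (q - p x).
      by rewrite pE /y -/X -/q; field; rewrite gt_eqF.
    apply: le_trans (ler_normB _ _) _; rewrite normrN !normrM.
    rewrite (ger0_norm (ltW L0)) (ger0_norm (ler0n _ 2)); apply: lerD => //.
    have -> : L^-1 * X ^+ 2 = L * (X / L) ^+ 2 by field; rewrite gt_eqF.
    by rewrite ler_wpM2l ?(ltW L0)// sin_sub_le.
  have dq : `|q - p x| <= de + (q - p x) ^+ 2 / de.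
    move: (q - p x) => z; have [ze|ze] := leP `|z| de.
      by apply: le_trans ze _; rewrite lerDl divr_ge0 ?sqr_ge0// ltW.
    apply: (@le_trans _ _ (z ^+ 2 / de)); last by rewrite lerDr ltW.
    rewrite ler_pdivlMr// -(real_normK (num_real z)) expr2 ler_wpM2l// ltW//.
  apply: (@le_trans _ _ (C * (L^-1 * X ^+ 2 + 2 * L * (de + (q - p x) ^+ 2 / de)))).
    rewrite ler_wpM2l//; apply: le_trans Xy _; rewrite lerD2l ler_wpM2l//.
    by rewrite mulr_ge0// ltW.
  by rewrite le_eqVlt; apply/orP; left; apply/eqP; field; rewrite !gt_eqF.
have D0 : 0 <= C * (2 * L * (de + m%:R^-1 / de)).
  rewrite mulr_ge0// mulr_ge0//; first by rewrite mulr_ge0// ltW.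
  by rewrite addr_ge0 ?divr_ge0 ?invr_ge0// ltW.
have CL0 : 0 <= C / L by rewrite divr_ge0// ltW.
have epsle : C / L * V + C * (2 * L * (de + m%:R^-1 / de)) <= eps.
  have e3 : C * (2 * L * (m%:R^-1 / de)) <= eps / 4.
    have -> : C * (2 * L * (m%:R^-1 / de)) = 2 * L * C / (m%:R * de).
      by field; rewrite !gt_eqF.
    rewrite ler_pdivrMr ?mulr_gt0//.
    have -> : eps / 4 * (m%:R * de) = m%:R * (eps * de) / 4 by field.
    move: hm; rewrite ler_pdivrMr ?mulr_gt0//.
    have : 0 <= L by exact: ltW.
    by move: (m%:R * (eps * de)) => z; nra.
  by rewrite (mulrDr (2 * L)) mulrDr; lra.
have md : measurable_fun [set: borel L2]
    (fun x => phi_rank h e K.+1 v x - bern m (F^~ x) (p x) 0).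
  exact: (bounded_measurableB bG mg.1).1.
have mX := measurable_ip_L2 (sh K).
rewrite -lee_fin in epsle; split=> [n|]; apply: le_trans epsle.
  exact: le_integral_norm_affine_sqr md mX CL0 D0 key (hVn n).
exact: le_integral_norm_affine_sqr md mX CL0 D0 key hV.
Unshelve. all: by end_near.
Qed.

End cosine_convergence.

(** * Inf-convolutions *)

Section lipschitz_regularization.
Context {R : realType}.
Local Notation L2 := (L2circle R).
Variables (phi : L2 -> R) (B : R).
Hypothesis phi_bound : forall x, `|phi x| <= B.

Let dist_ge0 (x y : L2) : 0 <= L2dist x y.
Proof. by rewrite L2dist_nrm nrm_ge0. Qed.

Definition lip_reg (k : nat) (x : L2) : R :=
  inf [set phi y + k%:R * L2dist x y | y in [set: L2]].

Lemma lip_reg_lbound k x : lbound [set phi y + k%:R * L2dist x y | y in [set: L2]] (- B).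
Proof.
move=> _ [y _ <-]; have := phi_bound y; rewrite ler_norml => /andP[? _].
by apply: ler_wpDr => //; rewrite mulr_ge0.
Qed.

Lemma lip_reg_le k x y : lip_reg k x <= phi y + k%:R * L2dist x y.
Proof.
by apply: ge_inf; [exists (- B); exact: lip_reg_lbound|exists y].
Qed.

Lemma le_lip_reg k x c : (forall y, c <= phi y + k%:R * L2dist x y) -> c <= lip_reg k x.
Proof.
move=> h; apply: lb_le_inf; first by exists (phi x + k%:R * L2dist x x), x.
by move=> _ [y _ <-].
Qed.

Lemma lip_reg_le_phi k x : lip_reg k x <= phi x.
Proof. by have := lip_reg_le k x x; rewrite L2distxx mulr0 addr0. Qed.

Lemma lip_reg_bound k x : `|lip_reg k x| <= B.
Proof.
rewrite ler_norml; apply/andP; split.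
  by apply: le_lip_reg => y; apply: lip_reg_lbound; exists y.
apply: le_trans (lip_reg_le_phi k x) _; exact: le_trans (ler_norm _) (phi_bound x).
Qed.

Lemma lip_reg_lipschitz k x y : `|lip_reg k x - lip_reg k y| <= k%:R * L2dist x y.
Proof.
have H (u v : L2) : lip_reg k u - k%:R * L2dist u v <= lip_reg k v.
  apply: le_lip_reg => z; rewrite lerBlDr -addrA -mulrDr.
  apply: le_trans (lip_reg_le k u z) _; rewrite lerD2l ler_wpM2l//.
  by rewrite addrC; exact: L2dist_triangle.
have := H x y; have := H y x; rewrite (L2dist_sym y x).
move: (lip_reg k x) (lip_reg k y) (k%:R * L2dist x y) => a b c ? ?.
by rewrite ler_norml; apply/andP; split; lra.
Qed.

(** Points [y] at distance at least [de] from [x] contribute at least k de - B, which is at least B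
    once k >= 2 B / de; the remaining ones are handled by continuity at [x]. *)
Lemma lip_reg_cvg x : continuous phi -> lip_reg k x @[k --> \oo] --> phi x.
Proof.
move=> cphi; apply/cvgrPdist_le => e e0.
have : nbhs x (phi @^-1` (ball (phi x) e)).
  by apply: (cphi x); apply/nbhs_ballP; exists e.
move=> /nbhs_ballP[de /= de0 hde]; near=> k.
rewrite ger0_norm ?subr_ge0 ?lip_reg_le_phi// lerBlDl -lerBlDr.
apply: le_lip_reg => y; have [yd|yd] := ltP (L2dist x y) de.
  have := hde y; rewrite ballEmdist /= -ball_normE/= => /(_ yd) xy.
  have := mulr_ge0 (ler0n R k) (dist_ge0 x y).
  by have := ler_norm (phi x - phi y); lra.
have kd : 2 * B <= k%:R * L2dist x y.
  apply: (@le_trans _ _ (k%:R * de)); last by rewrite ler_wpM2l.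
  rewrite -ler_pdivrMr//; near: k; exact: nbhs_infty_ger.
have := phi_bound y; have := phi_bound x; rewrite !ler_norml.
by move=> /andP[? ?] /andP[? ?]; lra.
Unshelve. all: by end_near.
Qed.

End lipschitz_regularization.

(** * A criterion for weak convergence on L^2 *)

Section weak_convergence_criterion.
Context {R : realType}.
Local Notation L2 := (L2circle R).
Variables (P_ : nat -> probability (borel L2) R) (P : probability (borel L2) R).

(** Dominated convergence of the regularizations under [P_ n] is not uniform in [n]. As they lie
    below the function, they still give a lower bound on the expectations for large [n]; applied to
    [- phi] it becomes the upper bound. *)
Lemma weakly_converges_lipschitz :
  (forall (phi : L2 -> R) (Lp B : R),
    (forall x y, `|phi x - phi y| <= Lp * L2dist x y) ->
    (forall x, `|phi x| <= B) ->
    \int[P_ n]_x phi x @[n --> \oo] --> \int[P]_x phi x) ->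
  weakly_converges P_ P.
Proof.
move=> H phi cphi [B0 [_ hB0]]; pose B := `|B0| + 1.
have Bphi x : `|phi x| <= B.
  by apply: (hB0 B) => //; rewrite /B; have := ler_norm B0; lra.
have oneside (psi : L2 -> R) : continuous psi -> (forall x, `|psi x| <= B) ->
    forall e, 0 < e -> \forall n \near \oo, \int[P]_x psi x - e <= \int[P_ n]_x psi x.
  move=> cpsi Bpsi e e0; have e20 : 0 < e / 2 by rewrite divr_gt0.
  have mpsi : measurable_fun [set: borel L2] psi by exact: continuous_measurable_borel.
  have bpsi : bounded_measurable (psi : borel L2 -> R) by split => //; exists B.
  have breg k : bounded_measurable (lip_reg psi k : borel L2 -> R).
    split; last by exists B; exact: lip_reg_bound.
    apply: continuous_measurable_borel.
    exact: (lipschitz_continuous_L2 (lip_reg_lipschitz Bpsi k)).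
  have : \int[P]_x lip_reg psi k x @[k --> \oo] --> \int[P]_x psi x.
    apply: (bounded_cvg_Rintegral (M := B)) => //.
    - by move=> k; exact: (breg k).1.
    - by move=> k x; exact: lip_reg_bound.
    - by apply: aeW => x; exact: lip_reg_cvg Bpsi _ cpsi.
  move=> /cvgrPdist_le/(_ _ e20)[k _ /(_ k (leqnn k))] hk.
  have := H _ _ _ (lip_reg_lipschitz Bpsi k) (lip_reg_bound Bpsi k).
  move=> /cvgrPdist_le/(_ _ e20); apply: filterS => n hn.
  have := Rintegral_le (P_ n) (breg k) bpsi (lip_reg_le_phi Bpsi k).
  move: hk hn; rewrite /= !ler_norml => /andP[? ?] /andP[? ?] ?; lra.
apply/cvgrPdist_le => e e0.
have cN : continuous (fun x => - phi x).
  move=> x; apply: (@continuous_comp _ _ _ phi -%R); first exact: cphi.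
  by apply: cvgN; exact: cvg_id.
have BN x : `|- phi x| <= B by rewrite normrN.
have bphi : bounded_measurable (phi : borel L2 -> R).
  by split; [exact: continuous_measurable_borel|exists B].
have EN (p : probability (borel L2) R) : \int[p]_x (- phi x) = - \int[p]_x phi x.
  under eq_Rintegral do rewrite -mulN1r.
  by rewrite RintegralZl ?mulN1r//; exact: bounded_measurable_integrable.
have h1 := oneside _ cphi Bphi _ e0; have h2 := oneside _ cN BN _ e0.
near=> n; have : \int[P]_x phi x - e <= \int[P_ n]_x phi x by near: n.
have : \int[P]_x (- phi x) - e <= \int[P_ n]_x (- phi x) by near: n.
rewrite !EN ler_norml => ? ?; apply/andP; split; lra.
Unshelve. all: by end_near.
Qed.

Variable c0 : R.
Hypothesis c0_ge0 : 0 <= c0.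
Hypothesis moment2_ : forall n h, sqint h ->
  (\int[P_ n]_x (ip h x ^+ 2)%:E <= (c0 * ip h h)%:E)%E.
Hypothesis moment2 : forall h, sqint h -> exists v : R,
  (\int[P]_x (ip h x ^+ 2)%:E <= v%:E)%E.
Hypothesis cos_trigp_cvg : forall s b,
  \int[P_ n]_x cos (ip (trigp s) x + b) @[n --> \oo] -->
  \int[P]_x cos (ip (trigp s) x + b).
Hypothesis proj_error_ : forall k n,
  (\int[P_ n]_x (proj_error k x ^+ 2)%:E <=
   (c0 * (k.+1%:R^-1 + n.+1%:R^-1))%:E)%E.

(** The projection error is of order 1/k + 1/n, so [k] is chosen first and [n] then tends to
    infinity. *)
Lemma lipschitz_cvg (phi : L2 -> R) (Lp B : R) :
  (forall x y, `|phi x - phi y| <= Lp * L2dist x y) ->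
  (forall x, `|phi x| <= B) ->
  \int[P_ n]_x phi x @[n --> \oo] --> \int[P]_x phi x.
Proof.
move=> lphi Bphi.
pose phik k (x : L2) := phi (mkL2 (cell_proj k x)).
have cphi := lipschitz_continuous_L2 lphi.
have bphi : bounded_measurable (phi : borel L2 -> R).
  by split; [exact: continuous_measurable_borel|exists B].
have mphik k : cos_stable P_ P (phik k).
  (* The projection as a finite-rank map: averages are the functionals, cells the directions.
     [inord] extends both families to all of [nat]. *)
  pose h (j : nat) (t : R) := k.+1%:R * cellf k (inord j : 'I_k.+1) t.
  pose e (j : nat) := cellf k (inord j : 'I_k.+1) : R -> R.
  have -> : phik k = phi_rank phi h e k.+1 (fun=> 0).
    apply/funext => x; rewrite /phik /phi_rank; congr (phi (mkL2 _)).
    apply/funext => t; rewrite add0r /finite_rank; apply: eq_bigr => m _.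
    rewrite /h /e inord_val /cell_avg ipZl; last 2 first.
    - exact: sqint_cellf.
    - exact: sqint_L2fun.
    by rewrite ipC.
  apply: (cos_stable_phi_rank c0_ge0 moment2_ moment2 cos_trigp_cvg lphi Bphi).
  - by move=> j; apply: trig_closureZ; exact: trig_closure_cellf.
  - by move=> j; exact: sqint_cellf.
  - exact: sqint_cst.
have dphik k x : `|phi x - phik k x| <= `|Lp| * proj_error k x.
  apply: le_trans (lphi _ _) _; rewrite -{1}(mkL2K x).
  rewrite (L2dist_mkL2 (sqint_L2fun x) (sqint_cell_proj k x)).
  by apply: ler_wpM2r; [exact: nrm_ge0|exact: ler_norm].
have cphik : \int[P]_x phik k x @[k --> \oo] --> \int[P]_x phi x.
  apply: (bounded_cvg_Rintegral (M := B)) => //.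
  - by move=> k; exact: (mphik k).1.1.
  - exact: bphi.1.
  - by move=> k x; exact: Bphi.
  - apply: aeW => x; apply/cvgrPdist_le => e e0.
    have /cvgrPdist_le/(_ _ e0) : `|Lp| * proj_error k x @[k --> \oo] --> `|Lp| * 0.
      by apply: cvgM; [exact: cvg_cst|exact: cell_proj_cvg (sqint_L2fun x)].
    apply: filterS => k; rewrite mulr0 sub0r normrN ger0_norm.
      exact: le_trans (dphik k x).
    by rewrite mulr_ge0// nrm_ge0.
apply/cvgrPdist_le => e e0.
have L1 : 0 < `|Lp| + 1 by rewrite ltr_wpDl.
(* With this [d] the first term of [le_integral_norm_sqr], times the Lipschitz constant, is e / 8;
   [A] collects the factor of 1/k + 1/n in the second. *)
pose d := e / 8 / (`|Lp| + 1); have d0 : 0 < d by rewrite !divr_gt0.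
pose A := (`|Lp| + 1) * (c0 / d).
have e80 : 0 < e / 8 by rewrite divr_gt0.
have e40 : 0 < e / 4 by rewrite divr_gt0.
have hA : (A * k.+1%:R^-1 : R) @[k --> \oo] --> A * 0.
  by apply: cvgM; [exact: cvg_cst|exact: cvg_inv_natS].
have hA' : \forall k \near \oo, A * k.+1%:R^-1 <= e / 8.
  move/cvgrPdist_le: hA => /(_ _ e80); apply: filterS => k.
  by rewrite mulr0 sub0r normrN; apply: le_trans; exact: ler_norm.
have [k [k1 k2]] : exists k, A * k.+1%:R^-1 <= e / 8 /\
    `|\int[P]_x phi x - \int[P]_x phik k x| <= e / 4.
  near \oo => k; exists k; split; near: k => //.
  by move/cvgrPdist_le: cphik => /(_ _ e40).
have hk := cos_stable_cvg (mphik k).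
near=> n.
have n1 : A * n.+1%:R^-1 <= e / 8 by near: n.
have n2 : `|\int[P]_x phik k x - \int[P_ n]_x phik k x| <= e / 4.
  by near: n; move/cvgrPdist_le: hk => /(_ _ e40).
have n3 : `|\int[P_ n]_x phi x - \int[P_ n]_x phik k x| <= e / 8 + (e / 8 + e / 8).
  apply: Rintegral_dist_le => //; first exact: (mphik k).1.
  have mpe := @measurable_proj_error R k.
  apply: (@le_trans _ _ (\int[P_ n]_x ((`|Lp| + 1)%:E * `|proj_error k x|%:E))%E).
    apply: ge0_le_integral => //.
    - apply/measurable_EFinP; apply: measurableT_comp => //.
      exact: (bounded_measurableB bphi (mphik k).1).1.
    - apply: emeasurable_funM => //; apply/measurable_EFinP.
      exact: measurableT_comp.
    - move=> x _; rewrite -EFinM lee_fin; apply: le_trans (dphik k x) _.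
      have pe0 : 0 <= proj_error k x by exact: nrm_ge0.
      by rewrite (ger0_norm pe0) ler_wpM2r// lerDl.
  have La := ltW L1.
  have ma : measurable_fun [set: borel L2] (fun x => `|proj_error k x|%:E).
    by apply/measurable_EFinP; exact: measurableT_comp.
  rewrite ge0_integralZl_EFin//.
  apply: (@le_trans _ _ ((`|Lp| + 1)%:E *
      (d + c0 * (k.+1%:R^-1 + n.+1%:R^-1) / d)%:E)%E).
    rewrite lee_pmul2l ?lte_fin//.
    exact: le_integral_norm_sqr mpe d0 (proj_error_ k n).
  rewrite -EFinM lee_fin mulrDr; apply: lerD.
    by rewrite /d mulrC divfK// gt_eqF.
  rewrite [leLHS](_ : _ = A * k.+1%:R^-1 + A * n.+1%:R^-1); first exact: lerD.
  by rewrite /A; ring.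
move: k2 n2 n3.
move: (\int[P]_x phi x) (\int[P]_x phik k x) (\int[P_ n]_x phi x)
  (\int[P_ n]_x phik k x) => a b c f.
rewrite !ler_norml => /andP[? ?] /andP[? ?] /andP[? ?]; apply/andP; split; lra.
Unshelve. all: by end_near.
Qed.

End weak_convergence_criterion.

Theorem lemma4p2 (R : realType) (kappa : R) (kappa_gt0 : 0 < kappa)
    (nu_ : forall n : nat, probability (borel 'cV[R]_n.+1) R)
    (nu_gaussian : forall n : nat,
      centered_gaussian (@vec_dot R n)
        (mulmx (invmx (kappa *: discreteL n))) (nu_ n))
    (nu : probability (borel (L2circle R)) R)
    (nu_gaussian_L2 :
      centered_gaussian (@L2dot R)
        (inverse_operator (scale_graph kappa (@scrL_graph R))) nu) :
  weakly_converges
    (fun n => distribution (nu_ n) (@reconstruction_mfun R n)) nu.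
Proof.
have dotE h (x : L2circle R) : sqint h -> L2dot (mkL2 h) x = ip h x.
  by move=> sh; exact: ip_mkL2l sh (sqint_L2fun x).
apply: weakly_converges_lipschitz => phi Lp B lphi Bphi.
(* The same constant bounds the second moments and the projection error. *)
apply: (lipschitz_cvg (c0 := kappa^-1) _ _ _ _ _ lphi Bphi).
- by rewrite invr_ge0 ltW.
- by move=> n h sh; rewrite mulrC; exact: reconstructed_moment2_le.
(* For general [h] the variance under the limit is only known to be a real number;
   [inverse_operator] is evaluated on trigonometric polynomials. *)
- move=> h sh; exists (L2dot (mkL2 h)
    (inverse_operator (scale_graph kappa (@scrL_graph R)) (mkL2 h))).
  rewrite -(centered_gaussian_moment2 nu_gaussian_L2).
  by rewrite le_eqVlt; apply/orP; left; apply/eqP; apply: eq_integral => x _; rewrite dotE.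
- move=> s b; have ss := sqint_trigp s.
  under eq_fun do rewrite (reconstructed_moment_cos (nu_gaussian _)).
  have -> : \int[nu]_x cos (ip (trigp s) x + b) =
      \int[nu]_x cos (L2dot (mkL2 (trigp s)) x + b).
    by apply: eq_Rintegral => x _; rewrite dotE.
  rewrite (centered_gaussian_moment_cos nu_gaussian_L2); last first.
    have -> : L2dot (mkL2 (trigp s)) = fun x : L2circle R => ip (trigp s) x.
      by apply/funext => x; rewrite dotE.
    exact: continuous_ip_L2.
  rewrite inverse_operator_trigp//; apply: cvg_gaussian_cos.
  apply: (@cvg_comp _ _ _ _ Num.sqrt _ (nbhs (ip (trigp s) (trigp (resolvent kappa s))
    / standard_normal_sqr))); last exact: sqrt_continuous.
  by apply: cvgM; [exact: discrete_variance_cvg|exact: cvg_cst].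
- by move=> k n; rewrite mulrC; exact: reconstructed_proj_error.
Qed.
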